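(* Let $C>0$ and $\beta>0$, and let $d\mu$ be the spectral measure of the Jacobi matrix with $a_n\equiv1$ and $b_n=-Cn^{-\beta}$ ($n\ge1$). Then $d\mu(x)=w(x)\,dx$ on $(-2,2)$, and writing $w(x)=e^{-2Q(x)}$ and $\delta=2-x$, one has, as $x\uparrow 2$, $$Q(x)=\beta^{-1}C^{1/\beta}\sum_{0\le\ell<\frac1\beta-\frac12}c_\ell\,\frac{\Gamma(\ell+\frac32)\,\Gamma(\frac1\beta-\frac12-\ell)}{\Gamma(\frac1\beta+1)}\,\delta^{-\frac1\beta+\ell+\frac12}+O(|\log\delta|),$$ where the sum is over integers $\ell$ and the $c_\ell$ are the Taylor coefficients defined by $\cosh^{-1}(1+\frac z2)=\sqrt z\sum_{\ell=0}^\infty c_\ell z^\ell$. In particular, if $0<\beta<\frac23$, then as $x\uparrow2$, $$Q(x)=\beta^{-1}C^{1/\beta}\,\frac{\Gamma(\frac32)\,\Gamma(\frac1\beta-\frac12)}{\Gamma(\frac1\beta+1)}\,(2-x)^{\frac12-\frac1\beta}\,\bigl(1+O(2-x)\bigr).$$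
   Context: For bounded Jacobi parameters $\{a_n,b_n\}_{n\ge1}$ ($a_n>0$, $b_n\in\mathbb{R}$), the spectral measure is the unique compactly supported probability measure $\mu$ on $\mathbb{R}$ whose orthonormal polynomials $p_n$ satisfy $xp_n=a_{n+1}p_{n+1}+b_{n+1}p_n+a_np_{n-1}$, $p_{-1}=0$, $p_0=1$. Here $c_0=1$, and $\cosh^{-1}$ denotes the nonnegative inverse of $\cosh$ on $[0,\infty)$. *)

(* Defs.v *)
From HB Require Import structures.
From mathcomp Require Import all_boot all_order all_algebra.
From mathcomp Require Import all_classical all_reals all_analysis.

Set Implicit Arguments.
Unset Strict Implicit.
Unset Printing Implicit Defensive.

Import Order.TTheory GRing.Theory Num.Theory.
Import numFieldNormedType.Exports.

Local Open Scope classical_set_scope.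
Local Open Scope ring_scope.

Definition compactly_supported (R : realType)
    (mu : probability (measurableTypeR R) R) : Prop :=
  exists K : set R, compact K /\ mu (~` K) = 0%E.

Definition orthonormal_polynomials (R : realType)
    (mu : probability (measurableTypeR R) R) (p : nat -> {poly R}) : Prop :=
  (forall n, size (p n) = n.+1 /\ 0 < lead_coef (p n)) /\
  (forall m n,
    (\int[mu]_x ((p m).[x] * (p n).[x])%:E)%E = ((m == n)%:R : R)%:E).

(* Jacobi parameters are indexed from 1, so the values [a 0] and [b 0] are
   irrelevant: the coefficient [a 0] is only ever multiplied by p_(-1) = 0. *)
Definition jacobi_recurrence (R : realType) (a b : nat -> R)
    (p : nat -> {poly R}) : Prop :=
  p 0%N = 1 /\
  forall n, 'X * p n =
    a n.+1 *: p n.+1 + b n.+1 *: p n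
    + a n *: (if n is m.+1 then p m else 0).

Definition spectral_measure (R : realType) (a b : nat -> R)
    (mu : probability (measurableTypeR R) R) : Prop :=
  compactly_supported mu /\
  exists p, orthonormal_polynomials mu p /\ jacobi_recurrence a b p.

Definition has_density_on (R : realType)
    (mu : probability (measurableTypeR R) R) (D : set R) (w : R -> R) : Prop :=
  [/\ measurable_fun D w,
      forall x, D x -> 0 <= w x
    & forall A : set R, measurable A -> A `<=` D ->
        mu A = (\int[lebesgue_measure]_(x in A) (w x)%:E)%E].

Definition cosh (R : realType) (y : R) : R := (expR y + expR (- y)) / 2.

(* The inverse of [cosh] on [0, +oo[; junk value 0 at arguments below 1. *)
Definition arcosh (R : realType) (x : R) : R :=
  xget 0 [set y : R | 0 <= y /\ cosh y = x].

(* arcosh (1 + z / 2) / sqrt z is of the form 0 / 0 at z = 0, so its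
   expansion is required on a punctured right neighbourhood of 0, which
   determines the coefficients. *)
Definition arcosh_taylor_coefs (R : realType) (c : nat -> R) : Prop :=
  exists2 r : R, 0 < r &
    forall z, 0 < z < r ->
      cvgn (pseries c z) /\
      arcosh (1 + z / 2) = Num.sqrt z * limn (pseries c z).

(* Euler's integral, meaningful for 0 < s. *)
Definition Gamma (R : realType) (s : R) : R :=
  \int[lebesgue_measure]_(t in `]0, +oo[) (t `^ (s - 1) * expR (- t)).

(* Main.v *)
(** With [p_(-1) = 0] and [y_n = x - b_(n+1)], the Turán determinants
    [T_n = p_n^2 + p_(n-1)^2 - y_n p_n p_(n-1)] satisfy
    [T_(n+1) = T_n + (y_n - y_(n+1)) p_(n+1) p_n].  Since [y] decreases, once
    [|y_n| < 2] the ratio [T_n / (2 - y_n)] is nonincreasing and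
    [T_n / (2 + y_n)] is nondecreasing, so [T_n] tends to a limit [T(x) > 0],
    locally boundedly, on (-2, 2).  The recurrence alone shows that [T_n dmu]
    tends weakly to the semicircle law, first on polynomials, hence on the
    functions [|x - a|] and on trapezoids; this gives
    [w(x) = sqrt (4 - x^2) / (2 pi T(x))].

    For [x = 2 - delta] let [N] be the first [n] with [y_n < 2].  Before [N],
    writing [y_n = g_n + 1 / g_n] with [g_n = exp (arcosh (y_n / 2))], the
    polynomial [p_n] lies between [G_n = g_0 ... g_(n-1)] and [(n + 1) G_n].
    The monotone ratios, started just after [N], carry this to the limit, so
    that [ln T / 2] is the sum of the [arcosh (y_n / 2)] over [n < N], up to
    [O(ln N) = O(|ln delta|)].  Expanding arcosh leaves the sums of
    [(C n^-beta - delta)^(l + 1/2)], which differ by a bounded amount from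
    Beta integrals as long as [l < 1/beta - 1/2]; the next term of the expansion
    contributes a harmonic sum, again [O(ln N)]. *)

Require Import Defs.
From HB Require Import structures.
From mathcomp Require Import all_boot all_order all_algebra.
From mathcomp Require Import all_classical all_reals all_analysis.
From mathcomp Require Import measurable_realfun zify ring lra.

Set Implicit Arguments.
Unset Strict Implicit.
Unset Printing Implicit Defensive.

Import Order.TTheory GRing.Theory Num.Theory.
Import numFieldNormedType.Exports.

Local Open Scope classical_set_scope.
Local Open Scope ring_scope.

(** * Turán determinants *)

(** At the turning point [2 - y_N] has no lower bound in terms of delta, because
    [a_N = y_N - 2 + delta] may lie arbitrarily close to delta; [T_N] has no useful lower bound
    either. One step later both difficulties are gone: [d = a_N - a_(N+1)] bounds [2 - y_(N+1)] from
    below and enters [T_(N+1) = T_N + d p_(N+1) p_N]. Since [d] is at least a constant times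
    [(N+2)^-(beta+1)], this costs only O(ln N) in the logarithm.

    The weak limit is delicate because [T_n] is controlled only on compact subsets of (-2, 2), while
    [mu] may charge points outside. On the support [|T_n|] is at most a constant times
    [p_(n+1)^2 + p_n^2], whose integral is 2 by orthonormality; this uniform L1 bound carries the
    limit from polynomials to their uniform limits. Trapezoids supported inside (-2, 2) then
    localise it to where the pointwise limit [T] is available. The semicircle appears through x = 2
    cos t: in the limit [p_n p_(n+k) dmu] becomes cos(k t) dt / pi, and the Turán combination
    becomes 2 - 2 cos^2 t = 2 sin^2 t. *)

Section three_term_recurrence.
Variable R : realFieldType.
Implicit Types y g : nat -> R.

(* Indices are shifted by one: [tri y n.+1] is p_n and [tri y 0] is p_(-1). *)
Fixpoint tri_pair y n : R * R :=
  if n is m.+1 then let: (u, v) := tri_pair y m in (v, y m * v - u) else (0, 1).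

Definition tri y n : R := (tri_pair y n).1.

Lemma tri_pair2 y n : (tri_pair y n).2 = tri y n.+1.
Proof. by rewrite /tri /=; case: (tri_pair y n). Qed.

Lemma tri0 y : tri y 0 = 0. Proof. by []. Qed.
Lemma tri1 y : tri y 1 = 1. Proof. by []. Qed.

Lemma triSS y n : tri y n.+2 = y n * tri y n.+1 - tri y n.
Proof.
rewrite -tri_pair2 /= -(tri_pair2 y n) /tri.
by case: (tri_pair y n).
Qed.

Lemma tri_unique y (f : nat -> R) : f 0%N = 0 -> f 1%N = 1 ->
  (forall n, f n.+2 = y n * f n.+1 - f n) -> f =1 tri y.
Proof.
move=> f0 f1 fS n.
suff: f n = tri y n /\ f n.+1 = tri y n.+1 by case.
elim: n => [|n [IH1 IH2]]; first by rewrite f0 f1.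
by split => //; rewrite fS triSS IH1 IH2.
Qed.

(** The quadratic form that the recurrence preserves when its coefficient is frozen at [y n]. *)
Definition turan y n : R :=
  tri y n.+1 ^+ 2 + tri y n ^+ 2 - y n * (tri y n.+1 * tri y n).

Lemma turanS y n :
  turan y n.+1 = turan y n + (y n - y n.+1) * (tri y n.+2 * tri y n.+1).
Proof. rewrite /turan !triSS; ring. Qed.

(** The invariance itself: the form takes the same value on the next pair. Completing a square in
    this version bounds the product that occurs in [turanS]. *)
Lemma turanES y n : turan y n =
  tri y n.+2 ^+ 2 + tri y n.+1 ^+ 2 - y n * (tri y n.+2 * tri y n.+1).
Proof. rewrite /turan !triSS; ring. Qed.

Lemma tri_neq0 y n : (tri y n != 0) || (tri y n.+1 != 0).
Proof.
elim: n => [|n]; first by rewrite tri1 oner_neq0 orbT.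
have [q1|//] := eqVneq (tri y n.+1) 0.
by rewrite orbF /= triSS q1 mulr0 sub0r oppr_eq0.
Qed.

End three_term_recurrence.

(** * Monotone ratios of Turán determinants where |y| < 2 *)

Section oscillatory_region.
Variables (R : realFieldType) (y : nat -> R) (n : nat).

(** The form is definite for |y| < 2: it is a multiple of [(u - v)^2] or [(u + v)^2], according to
    the sign of [y n], plus a positive multiple of [u^2 + v^2]. *)
Lemma turan_gt0 : -2 < y n -> y n < 2 -> 0 < turan y n.
Proof.
move=> y_gt y_lt.
rewrite /turan; have := tri_neq0 y n.
set u := tri y _; set v := tri y _ => uv.
have h : 0 < v ^+ 2 + u ^+ 2.
  case/orP: uv => h.
    by rewrite ltr_wpDl ?sqr_ge0// exprn_even_gt0.
  by rewrite ltr_wpDr ?sqr_ge0// exprn_even_gt0.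
have h1 := sqr_ge0 (u + v); have h2 := sqr_ge0 (u - v).
rewrite !expr2 in h h1 h2 *.
have [y0|y0] := leP 0 (y n).
  have a1 : 0 <= y n * ((u - v) * (u - v)) by rewrite mulr_ge0.
  have a2 : 0 < (2 - y n) * (v * v + u * u) by rewrite mulr_gt0// subr_gt0.
  lra.
have a1 : 0 <= (- y n) * ((u + v) * (u + v)) by rewrite mulr_ge0// oppr_ge0 ltW.
have a2 : 0 < (2 + y n) * (v * v + u * u) by rewrite mulr_gt0// -ltrBlDl sub0r.
lra.
Qed.

(** With [u], [v] the two values, [turan y n] is both [(u - v)^2 + (2 - y n) u v] and
    [(u + v)^2 - (2 + y n) u v]; dropping the squares gives this bound and the next. *)
Let prod_le : (2 - y n) * (tri y n.+2 * tri y n.+1) <= turan y n.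
Proof.
rewrite turanES; have := sqr_ge0 (tri y n.+2 - tri y n.+1).
set u := tri y _; set v := tri y _; rewrite !expr2 => h; nra.
Qed.

Let prod_ge : - turan y n <= (2 + y n) * (tri y n.+2 * tri y n.+1).
Proof.
rewrite turanES; have := sqr_ge0 (tri y n.+2 + tri y n.+1).
set u := tri y _; set v := tri y _; rewrite !expr2 => h; nra.
Qed.

Hypothesis y_dec : y n.+1 <= y n.

(** After [turanS], the difference of the two sides is [y n - y n.+1] times the slack in
    [prod_le]. *)
Lemma turan_divB_le : turan y n.+1 * (2 - y n) <= turan y n * (2 - y n.+1).
Proof.
have d0 : 0 <= y n - y n.+1 by rewrite subr_ge0.
have := ler_wpM2l d0 prod_le; rewrite turanS; lra.
Qed.

Lemma turan_divD_ge : turan y n * (2 + y n.+1) <= turan y n.+1 * (2 + y n).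
Proof.
have d0 : 0 <= y n - y n.+1 by rewrite subr_ge0.
have := ler_wpM2l d0 prod_ge; rewrite turanS; lra.
Qed.

End oscillatory_region.

(** * Two-sided growth bounds where y >= 2 *)

Section growth_region.
Variables (R : realFieldType) (y g : nat -> R) (N : nat).
Hypothesis g_ge1 : forall n, (n < N)%N -> 1 <= g n.
Hypothesis gE : forall n, (n < N)%N -> g n + (g n)^-1 = y n.
Hypothesis g_dec : forall n, (n.+1 < N)%N -> g n.+1 <= g n.

Let G n := \prod_(k < n) g k.

Let g_gt0 n : (n < N)%N -> 0 < g n.
Proof. by move=> nN; rewrite (lt_le_trans _ (g_ge1 nN)). Qed.

Lemma prod_growth_ge1 n : (n <= N)%N -> 1 <= G n.
Proof.
elim: n => [_|n IH nN]; first by rewrite /G big_ord0.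
have h := IH (ltnW nN); rewrite /G big_ord_recr /= (le_trans h)//.
by rewrite ler_peMr ?g_ge1// (le_trans ler01).
Qed.

(** The ratio of consecutive terms stays above the larger characteristic root. In the inductive step
    the surplus [p_(n+1) / g_(n+1)] pays for the subtracted [p_n], because [p_n <= p_(n+1) / g_n]
    and [g] decreases. *)
Let tri_ratio n : (n < N)%N ->
  0 < tri y n.+1 /\ g n * tri y n.+1 <= tri y n.+2.
Proof.
elim: n => [|n IH] nN.
  rewrite triSS tri1 tri0 !mulr1 subr0 -gE //; split => //.
  by rewrite lerDl invr_ge0 ltW ?g_gt0.
have nN' := ltnW nN; have [q1 r1] := IH nN'.
have q2 : 0 < tri y n.+2 by rewrite (lt_le_trans _ r1)// mulr_gt0// g_gt0.
split => //; rewrite [leRHS]triSS -gE // mulrDl.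
suff : tri y n.+1 <= (g n.+1)^-1 * tri y n.+2 by lra.
rewrite -(ler_pM2l (g_gt0 nN)) mulrA divff ?gt_eqF ?g_gt0// mul1r.
rewrite (le_trans _ r1)//; apply: ler_wpM2r; [exact: ltW|exact: g_dec].
Qed.

Lemma tri_growth_gt0 n : (n <= N)%N -> 0 < tri y n.+1.
Proof.
case: n => [|n] nN; first by rewrite tri1.
by have [q1 r1] := tri_ratio nN; rewrite (lt_le_trans _ r1)// mulr_gt0// g_gt0.
Qed.

Lemma tri_growth_incr n : (n <= N)%N -> tri y n <= tri y n.+1.
Proof.
case: n => [|n] nN; first by rewrite tri1 tri0.
have [q1 r1] := tri_ratio nN; rewrite (le_trans _ r1)// ler_peMl ?g_ge1//.
exact: ltW.
Qed.

Lemma prod_le_tri n : (n <= N)%N -> G n <= tri y n.+1.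
Proof.
elim: n => [|n IH] nN; first by rewrite /G big_ord0 tri1.
have [q1 r1] := tri_ratio nN; rewrite (le_trans _ r1)//.
by rewrite /G big_ord_recr /= mulrC ler_wpM2l ?IH ?(ltnW nN)// ltW// g_gt0.
Qed.

(* [tri y n.+1 - tri y n / g n] is the amplitude of the dominant solution of
   the recurrence frozen at [n]; it is multiplied exactly by [g n] at each step
   and then decreased by the passage from [g n] to [g n.+1 <= g n]. *)
Let amplitude n : (n < N)%N -> tri y n.+1 - tri y n / g n <= G n.
Proof.
elim: n => [|n IH] nN; first by rewrite /G big_ord0 tri1 tri0 mul0r subr0.
have nN' := ltnW nN; have [q1 r1] := tri_ratio nN'.
have gn := g_gt0 nN'; have gn1 := g_gt0 nN.
have -> : G n.+1 = G n * g n by rewrite /G big_ord_recr.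
have := IH nN'; rewrite -(ler_pM2r gn) mulrBl divfK ?gt_eqF// => IHg.
rewrite (le_trans _ IHg)// triSS -gE// mulrDl.
have : tri y n.+1 / g n <= tri y n.+1 / g n.+1.
  by rewrite ler_pM2l// lef_pV2// g_dec.
by move=> h; lra.
Qed.

(** The recurrence writes [p_(n+1)] as [g_n] times the amplitude, at most [G_(n+1)], plus
    [p_n / g_n], at most [p_n]; so each step raises the factor by one. The bound is attained when
    every [g] is 1. *)
Lemma tri_le_prod n : (n <= N)%N -> tri y n.+1 <= n.+1%:R * G n.
Proof.
elim: n => [|n IH] nN; first by rewrite /G big_ord0 tri1 mul1r.
have nN' := ltnW nN; have [q1 r1] := tri_ratio nN.
have gn := g_gt0 nN; have IHn := IH nN'; have Gn := prod_growth_ge1 nN'.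
have a := amplitude nN.
have -> : G n.+1 = G n * g n by rewrite /G big_ord_recr.
rewrite triSS -gE// mulrDl -(addrA (g n * _)) -[n.+2%:R]natr1 mulrDl mul1r.
have a' : g n * (tri y n.+1 - tri y n / g n) <= g n * G n by rewrite ler_pM2l.
have h : (g n)^-1 * tri y n.+1 <= n.+1%:R * (G n * g n).
  apply: (@le_trans _ _ (tri y n.+1)).
    by apply: ler_piMl; [exact: ltW|rewrite invf_le1// g_ge1].
  rewrite (le_trans IHn)//; apply: ler_wpM2l => //; apply: ler_peMr.
    exact: le_trans ler01 Gn.
  exact: g_ge1.
rewrite mulrBr mulrCA divff ?gt_eqF// mulr1 in a'.
by lra.
Qed.

End growth_region.

Lemma cvgn_le (R : realType) (u : R^nat) (l B : R) :
  u n @[n --> \oo] --> l -> (forall n, u n <= B) -> l <= B.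
Proof.
move=> ul uB; rewrite -(cvg_lim _ ul)//; apply: limr_le.
  by apply/cvg_ex; exists l.
exact: nearW.
Qed.

Section bounded_functions.
Context d (T : measurableType d) (R : realType).
Variables (mu : {measure set T -> \bar R}) (D : set T).
Hypotheses (mD : measurable D) (muD : (mu D < +oo)%E).

Lemma bounded_integrable (f : T -> R) (B : R) : measurable_fun D f ->
  (forall x, D x -> `|f x| <= B) -> mu.-integrable D (EFin \o f).
Proof.
move=> mf fB; apply: (@le_integrable _ _ _ mu D mD _ (EFin \o cst B)).
- exact/measurable_EFinP.
- by move=> x Dx /=; rewrite lee_fin (le_trans (fB _ Dx))// ler_norm.
- apply/integrableP; split; first exact/measurable_EFinP.
  under eq_integral do rewrite /=.
  by rewrite integral_cst// lte_mul_pinfty.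
Qed.

Lemma bounded_cvg_Rintegral (f_ : (T -> R)^nat) (f : T -> R) (B : R) :
  (forall n, measurable_fun D (f_ n)) ->
  (forall n x, D x -> `|f_ n x| <= B) ->
  (forall x, D x -> f_ n x @[n --> \oo] --> f x) ->
  (\int[mu]_(x in D) f_ n x)%R @[n --> \oo] --> (\int[mu]_(x in D) f x)%R.
Proof.
move=> mf fB ff.
have mf' : measurable_fun D f by apply: measurable_fun_cvg ff.
have fB' x : D x -> `|f x| <= B.
  by move=> Dx; apply: (cvgn_le (cvg_norm (ff x Dx))) => n; exact: fB.
have intf : mu.-integrable D (EFin \o f) by exact: bounded_integrable fB'.
(* The dominating constant [B] is known to be nonnegative only through a point of [D]. *)
have [D0|/set0P[x0 Dx0]] := eqVneq D set0.
  rewrite D0 Rintegral_set0.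
  by under eq_fun do rewrite Rintegral_set0; exact: cvg_cst.
apply: fine_cvg; rewrite fineK; last exact: integrable_fin_num.
apply: (@dominated_cvg _ _ _ mu D mD _ _ (EFin \o cst B)) => //.
- by move=> n; exact/measurable_EFinP.
- by move=> x Dx; apply: cvg_EFin; [exact: nearW|exact: ff].
- apply: (@bounded_integrable _ B) => // x Dx /=.
  by rewrite ger0_norm// (le_trans _ (fB 0%N _ Dx0)).
Qed.

End bounded_functions.

(** * The limit of the Turán determinants *)

Section turan_limit.
Variables (R : realType) (y : nat -> R) (l : R).
Hypothesis l_gt : -2 < l.
Hypothesis y_dec : forall n, y n.+1 <= y n.
Hypothesis y_cvg : y n @[n --> \oo] --> l.

Let y_homo m n : (m <= n)%N -> y n <= y m.
Proof.
move=> mn; apply: (homo_leq (r := fun a b => b <= a)) mn => // ? ? ? h1 h2.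
exact: le_trans h2 h1.
Qed.

Lemma ge_lim n : l <= y n.
Proof.
rewrite -lerN2.
have h : (- y (k + n)%N) @[k --> \oo] --> - l.
  by apply: cvgN; move: y_cvg; rewrite -(@cvg_shiftn n).
rewrite -(cvg_lim _ h)//; apply: limr_ge; first by apply/cvg_ex; exists (- l).
by apply: nearW => k; rewrite lerN2; apply: y_homo; rewrite leq_addl.
Qed.

Let y_gt n : -2 < y n. Proof. exact: lt_le_trans l_gt (ge_lim n). Qed.

Variable m : nat.
Hypothesis ym : y m < 2.

Let y_lt k : y (k + m)%N < 2.
Proof. by apply: le_lt_trans ym; apply: y_homo; rewrite leq_addl. Qed.

Lemma turan_ub k : turan y (k + m)%N * (2 - y m) <= turan y m * (2 - y (k + m)%N).
Proof.
elim: k => [//|k IH]; rewrite addSn.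
have yk := y_lt k; have h := turan_divB_le (y_dec (k + m)%N).
have a : 0 < 2 - y (k + m)%N by rewrite subr_gt0.
have a' : 0 < 2 - y m by rewrite subr_gt0.
have a1 : 0 <= 2 - y (k + m).+1 by rewrite subr_ge0 ltW// (y_lt k.+1).
rewrite -(ler_pM2r a).
have h1 := ler_wpM2r (ltW a') h.
have h2 := ler_wpM2r a1 IH.
by lra.
Qed.

Lemma turan_lb k : turan y m * (2 + y (k + m)%N) <= turan y (k + m)%N * (2 + y m).
Proof.
elim: k => [//|k IH]; rewrite addSn.
have yk := y_lt k; have h := turan_divD_ge (y_dec (k + m)%N).
have a n : 0 < 2 + y n by have := y_gt n; lra.
rewrite -(ler_pM2r (a (k + m)%N)).
have h1 := ler_wpM2r (ltW (a m)) h.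
have h2 := ler_wpM2r (ltW (a (k + m).+1)) IH.
by lra.
Qed.

(** The nonincreasing ratio [v] yields convergence, and the nondecreasing one, through [turan_lb], a
    positive lower bound for the limit. *)
Lemma turan_cvg_exists : exists2 L : R, 0 < L & turan y n @[n --> \oo] --> L.
Proof.
pose v k := turan y (k + m)%N / (2 - y (k + m)%N).
have a k : 0 < 2 - y (k + m)%N by rewrite subr_gt0.
have v_dec k : v k.+1 <= v k.
  rewrite /v addSn ler_pdivrMr ?(a k.+1)// mulrAC ler_pdivlMr//.
  by apply: turan_divB_le.
have v_ge0 k : 0 <= v k.
  by rewrite divr_ge0 ?ltW// turan_gt0.
have v_cvg : cvgn v.
  apply: nonincreasing_is_cvgn.
    by apply/nonincreasing_seqP.
  by exists 0 => _ [k _ <-].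
have t_cvg : turan y n @[n --> \oo] --> limn v * (2 - l).
  rewrite -(@cvg_shiftn m).
  rewrite (_ : [sequence _]_n = fun k => v k * (2 - y (k + m)%N)); last first.
    by apply/funext => k; rewrite /v /= divfK// gt_eqF.
  apply: cvgM => //; apply: cvgB; first exact: cvg_cst.
  by move: y_cvg; rewrite -(@cvg_shiftn m).
exists (limn v * (2 - l)) => //.
apply: (@lt_le_trans _ _ (turan y m * (2 + l) / (2 + y m))).
  have y2 : 0 < 2 + y m by have := y_gt m; lra.
  have tm : 0 < turan y m by apply: turan_gt0.
  by rewrite divr_gt0// mulr_gt0// -ltrBlDl sub0r.
have c2 k : turan y m * (2 + l) / (2 + y m) <= turan y (k + m)%N.
  have y2 : 0 < 2 + y m by have := y_gt m; lra.
  have tm : 0 < turan y m by apply: turan_gt0.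
  rewrite ler_pdivrMr// (le_trans _ (turan_lb k))// ler_pM2l//.
  by rewrite lerD2l ge_lim.
have t_cvg' : turan y (k + m)%N @[k --> \oo] --> limn v * (2 - l).
  by move: t_cvg; rewrite -(@cvg_shiftn m).
rewrite -(cvg_lim _ t_cvg')//; apply: limr_ge.
  by apply/cvg_ex; exists (limn v * (2 - l)).
exact: nearW.
Qed.

Lemma turan_lim_ub (L : R) : turan y n @[n --> \oo] --> L ->
  L * (2 - y m) <= turan y m * (2 - l).
Proof.
move=> tL.
have h : turan y m * (2 - y (k + m)%N) - turan y (k + m)%N * (2 - y m)
    @[k --> \oo] --> turan y m * (2 - l) - L * (2 - y m).
  apply: cvgB; apply: cvgM; try exact: cvg_cst.
    by apply: cvgB; [exact: cvg_cst|move: y_cvg; rewrite -(@cvg_shiftn m)].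
  by move: tL; rewrite -(@cvg_shiftn m).
rewrite -subr_ge0 -(cvg_lim _ h)//; apply: limr_ge; first by apply/cvg_ex; eexists; exact: h.
by apply: nearW => k; rewrite subr_ge0 turan_ub.
Qed.

Lemma turan_lim_lb (L : R) : turan y n @[n --> \oo] --> L ->
  turan y m * (2 + l) <= L * (2 + y m).
Proof.
move=> tL.
have h : turan y (k + m)%N * (2 + y m) - turan y m * (2 + y (k + m)%N)
    @[k --> \oo] --> L * (2 + y m) - turan y m * (2 + l).
  apply: cvgB; apply: cvgM; try exact: cvg_cst.
    by move: tL; rewrite -(@cvg_shiftn m).
  by apply: cvgD; [exact: cvg_cst|move: y_cvg; rewrite -(@cvg_shiftn m)].
rewrite -subr_ge0 -(cvg_lim _ h)//; apply: limr_ge; first by apply/cvg_ex; eexists; exact: h.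
by apply: nearW => k; rewrite subr_ge0 turan_lb.
Qed.

End turan_limit.

(** * The turning point *)

Section arcosh.
Variable R : realType.
Implicit Types x y z : R.

(** The explicit inverse [ln (x + s)] shows that the set behind [xget] is inhabited, so [arcosh]
    satisfies its defining property. Hence [expR (arcosh _)] is the root at least 1 of g + 1/g = 2 +
    z, the characteristic equation of the recurrence. *)
Lemma arcosh_spec z : 0 <= z ->
  0 <= arcosh (1 + z / 2) /\
  expR (arcosh (1 + z / 2)) + (expR (arcosh (1 + z / 2)))^-1 = 2 + z.
Proof.
move=> z0; set x := 1 + z / 2.
have x1 : 1 <= x by rewrite lerDl divr_ge0.
pose s := Num.sqrt (x ^+ 2 - 1).
have s0 : 0 <= s by exact: sqrtr_ge0.
have s2 : s * s = x * x - 1.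
  by rewrite -expr2 sqr_sqrtr ?expr2// subr_ge0 -[leLHS]mulr1 ler_pM.
have xs1 : 1 <= x + s by rewrite -[1]addr0 lerD.
have xs0 : 0 < x + s by rewrite (lt_le_trans ltr01).
have [w0 wE] : [set y | 0 <= y /\ cosh y = x] (arcosh x).
  apply: xgetPex; exists (ln (x + s)); split; first exact: ln_ge0.
  rewrite /cosh expRN lnK ?posrE//.
  have xs : (x + s)^-1 = x - s.
    apply: (mulfI (lt0r_neq0 xs0)); rewrite divff ?lt0r_neq0//; lra.
  by rewrite xs; field.
split=> //; move: wE; rewrite /cosh expRN => h.
have -> : z = 2 * (x - 1) by rewrite /x; field.
lra.
Qed.

Lemma arcosh_ge0 z : 0 <= z -> 0 <= arcosh (1 + z / 2).
Proof. by case/arcosh_spec. Qed.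

Lemma ge1_addV_le (g h : R) : 1 <= g -> 1 <= h ->
  g + g^-1 <= h + h^-1 -> g <= h.
Proof.
move=> g1 h1 gh.
have g0 : 0 < g by rewrite (lt_le_trans ltr01).
have h0 : 0 < h by rewrite (lt_le_trans ltr01).
rewrite leNgt; apply/negP => hg.
have : (g - h) * (1 - (g * h)^-1) <= 0.
  have -> : (g - h) * (1 - (g * h)^-1) = g + g^-1 - (h + h^-1).
    by field; rewrite !gt_eqF.
  by lra.
apply/negP; rewrite -ltNge mulr_gt0 ?subr_gt0// invf_lt1 ?mulr_gt0//.
by rewrite (lt_le_trans (le_lt_trans h1 hg))// ler_peMr// ltW.
Qed.

Lemma le_arcosh z1 z2 : 0 <= z1 -> z1 <= z2 ->
  expR (arcosh (1 + z1 / 2)) <= expR (arcosh (1 + z2 / 2)).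
Proof.
move=> z10 z12; have [a1 e1] := arcosh_spec z10.
have [a2 e2] := arcosh_spec (le_trans z10 z12).
have g1 : 1 <= expR (arcosh (1 + z1 / 2)) by rewrite -[leLHS]expR0 ler_expR.
have g2 : 1 <= expR (arcosh (1 + z2 / 2)) by rewrite -[leLHS]expR0 ler_expR.
by apply: ge1_addV_le => //; rewrite e1 e2; lra.
Qed.

End arcosh.

Section logarithm.
Variable R : realType.

Lemma powR_expR (a r : R) : 0 < a -> a `^ r = expR (r * ln a).
Proof. by move=> a0; rewrite /powR gt_eqF. Qed.

(** This is ln(1 + x) <= x at x = -1/(n+2). *)
Lemma inv_le_ln_diff n : n.+2%:R^-1 <= ln n.+2%:R - ln n.+1%:R :> R.
Proof.
rewrite -ln_div ?posrE// -[n.+2%:R / _]invrK lnV ?posrE ?invr_gt0 ?divr_gt0//.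
rewrite invf_div lerNr.
have -> : n.+1%:R / n.+2%:R = 1 + (- n.+2%:R^-1) :> R.
  have E (a : R) : a + 1 != 0 -> a / (a + 1) = 1 + (- (a + 1)^-1) by move=> ?; field.
  by rewrite -[n.+2%:R]natr1; apply: E; rewrite natr1 pnatr_eq0.
apply: le_ln1Dx; rewrite ltrN2 invf_lt1// ltr1n//.
Qed.

Lemma harmonic_sum_le N : \sum_(n < N) n.+1%:R^-1 <= 1 + ln N.+1%:R :> R.
Proof.
case: N => [|N]; first by rewrite big_ord0 ln1 addr0.
have : ln N.+1%:R <= ln N.+2%:R :> R by rewrite ler_ln ?posrE// ler_nat.
suff : \sum_(n < N.+1) n.+1%:R^-1 <= 1 + ln N.+1%:R :> R by lra.
elim: N => [|N IH]; first by rewrite big_ord1 invr1 ln1 addr0.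
rewrite big_ord_recr /=; apply: le_trans (lerD IH (inv_le_ln_diff N)) _.
by rewrite -addrA subrKC.
Qed.

(** Lets any constant [A >= 0] be absorbed in the error term, as [A / ln 2] times it. *)
Lemma ln2_le_norm_ln (delta : R) : 0 < delta <= 2^-1 -> ln 2 <= `|ln delta|.
Proof.
move=> /andP[d0 d1].
rewrite ler0_norm ?ln_le0 ?(le_trans d1)// ?invf_le1 ?ler1n//.
by rewrite lerNr -lnV ?posrE// ler_ln ?posrE.
Qed.

End logarithm.

Section power_decay.
Variables (R : realType) (C beta : R).
Hypotheses (C0 : 0 < C) (beta0 : 0 < beta).

(** This is -b_(n+1), indexed from 0 like the recurrence [tri]. *)
Definition decay (n : nat) : R := C * n.+1%:R `^ (- beta).

Lemma decay_gt0 n : 0 < decay n.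
Proof. by rewrite mulr_gt0// powR_gt0. Qed.

(** A mean value estimate, obtained from e^x >= 1 + x. It keeps the step at the turning point above
    a power of the index, so that its logarithm is O(ln n). *)
Lemma decay_diff n :
  C * beta * n.+2%:R `^ (- (beta + 1)) <= decay n - decay n.+1.
Proof.
rewrite /decay -mulrBr -mulrA ler_pM2l// !powR_expR//.
set u := ln n.+1%:R; set v := ln n.+2%:R.
have vu : n.+2%:R^-1 <= v - u := inv_le_ln_diff R n.
have -> : - beta * u = - beta * v + beta * (v - u) by ring.
have -> : - (beta + 1) * v = - beta * v - v by ring.
rewrite !expRD expRN lnK ?posrE//.
have e0 : 0 < expR (- beta * v) by exact: expR_gt0.
rewrite -[X in _ - X]mulr1 -mulrBr mulrCA ler_pM2l//.
rewrite lerBrDl; apply: le_trans (expR_ge1Dx _).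
by rewrite lerD2l ler_pM2l.
Qed.

Lemma decay_le n : decay n.+1 <= decay n.
Proof.
rewrite -subr_ge0; apply: le_trans (decay_diff n).
by apply: mulr_ge0; [apply: mulr_ge0; exact: ltW|exact: powR_ge0].
Qed.

Lemma decay_le_C n : decay n <= C.
Proof.
elim: n => [|n]; first by rewrite /decay powR1 mulr1.
exact: le_trans (decay_le n).
Qed.

Lemma decay_cvg : decay n @[n --> \oo] --> 0.
Proof.
rewrite -[X in _ --> X](mulr0 C); apply: cvgM; first exact: cvg_cst.
have /cvg_at_rightP H := powR_cvg0 beta0.
have := H (@harmonic R) (conj (@harmonic_gt0 R) (@cvg_harmonic R)).
rewrite (_ : (fun n => _ n `^ beta) = fun n => n.+1%:R `^ (- beta))//.
by apply/funext => n; rewrite !powR_expR ?invr_gt0// lnV ?posrE// mulrN mulNr.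
Qed.

(** The last index before [N] gives N^beta <= C / delta. The [N.+2] is the one of [decay_diff]; N +
    2 <= 3 N accounts for [ln 3] when N > 0. *)
Lemma ln_turning_index : exists2 K : R, 0 <= K &
  forall (delta : R) N, 0 < delta <= 2^-1 ->
  (forall n, (n < N)%N -> delta <= decay n) ->
  ln N.+2%:R <= K * `|ln delta|.
Proof.
pose K := (ln 3 + `|ln C| / beta) / ln 2 + beta^-1.
have l2 : 0 < ln 2 :> R by rewrite ln_gt0 // ltr1n.
have l3 : 0 <= ln 3 :> R by rewrite ln_ge0 // ler1n.
have K0 : 0 <= K.
  by rewrite addr_ge0 ?divr_ge0 ?addr_ge0 ?divr_ge0 ?invr_ge0// ltW.
exists K => // delta N /andP[d0 d1] H.
have ld : ln 2 <= `|ln delta| by apply: ln2_le_norm_ln; rewrite d0.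
have h : ln 3 + `|ln C| / beta <= (ln 3 + `|ln C| / beta) / ln 2 * `|ln delta|.
  rewrite -mulrA; apply: ler_peMr.
    by rewrite addr_ge0// ?divr_ge0// ltW.
  by rewrite mulrC ler_pdivlMr// mul1r.
rewrite /K mulrDl.
case: N H => [|N] H.
  have : ln 2 <= ln 3 :> R by rewrite ler_ln ?posrE// ler_nat.
  have : 0 <= `|ln C| / beta by rewrite divr_ge0// ltW.
  have : 0 <= beta^-1 * `|ln delta| by rewrite mulr_ge0// invr_ge0 ltW.
  lra.
have := H N (ltnSn N); rewrite /decay powR_expR//.
rewrite -ler_ln ?posrE ?mulr_gt0 ?expR_gt0// lnM ?posrE ?expR_gt0// expRK => h1.
have h2 : ln N.+1%:R <= (`|ln C| + `|ln delta|) / beta.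
  rewrite ler_pdivlMr// mulrC.
  have := ler_norm (ln C); have := ler_norm (- ln delta); rewrite normrN; lra.
have h3 : ln N.+3%:R <= ln 3 + ln N.+1%:R :> R.
  rewrite -lnM ?posrE// ler_ln ?posrE ?mulr_gt0// -natrM ler_nat; lia.
rewrite mulrDl in h2; rewrite [beta^-1 * _]mulrC; lra.
Qed.

End power_decay.

(** * Crossing the turning point *)

Section turning_point.
Variables (R : realType) (C beta : R).
Hypotheses (C0 : 0 < C) (beta0 : 0 < beta).
Notation a := (decay C beta).

Section fixed_delta.
Variables (delta : R) (N : nat) (L : R).
Hypothesis delta_itv : 0 < delta <= 2^-1.
Hypothesis before : forall n, (n < N)%N -> delta <= a n.
Hypothesis after : a N < delta.

Let y n : R := 2 - delta + a n.
Hypothesis yL : turan y n @[n --> \oo] --> L.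

Let g n : R := expR (arcosh (1 + (a n - delta) / 2)).
Let G := \prod_(k < N) g k.
Let d := a N - a N.+1.

Let d0 : 0 < delta. Proof. by case/andP: delta_itv. Qed.
Let d1 : delta <= 2^-1. Proof. by case/andP: delta_itv. Qed.

Let g_ge1 n : (n < N)%N -> 1 <= g n.
Proof.
move=> nN; have h : 0 <= a n - delta by rewrite subr_ge0 before.
by rewrite -[leLHS]expR0 ler_expR arcosh_ge0.
Qed.

Let gE n : (n < N)%N -> g n + (g n)^-1 = y n.
Proof.
move=> nN; have h : 0 <= a n - delta by rewrite subr_ge0 before.
by have [_ ->] := arcosh_spec h; rewrite /y; lra.
Qed.

Let g_dec n : (n.+1 < N)%N -> g n.+1 <= g n.
Proof.
move=> nN; have h : 0 <= a n.+1 - delta by rewrite subr_ge0 before.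
by apply: le_arcosh => //; rewrite lerD2r decay_le.
Qed.

Let G_ge1 : 1 <= G. Proof. by have := prod_growth_ge1 g_ge1 (leqnn N). Qed.
Let q := tri y N.+1.
Let q_lb : G <= q. Proof. by have := prod_le_tri g_ge1 gE g_dec (leqnn N). Qed.
Let q_ub : q <= N.+1%:R * G.
Proof. by have := tri_le_prod g_ge1 gE g_dec (leqnn N). Qed.
Let q_gt0 : 0 < q.
Proof. by have := tri_growth_gt0 g_ge1 gE g_dec (leqnn N). Qed.
Let q'_le : tri y N <= q.
Proof. by have := tri_growth_incr g_ge1 gE g_dec (leqnn N). Qed.
Let q'_ge0 : 0 <= tri y N.
Proof.
have := tri_growth_gt0 g_ge1 gE g_dec; case: N => [_|n h]; first by rewrite tri0.
by rewrite ltW// h.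
Qed.

Let d_gt0 : 0 < d.
Proof.
apply: lt_le_trans (decay_diff C0 beta0 N).
by rewrite mulr_gt0 ?powR_gt0// mulr_gt0.
Qed.

Let d_le : d <= C.
Proof.
have := decay_le_C C0 beta0 N; have := decay_gt0 beta C0 N.+1.
by rewrite /d; lra.
Qed.

Let yN_ge : 3 / 2 <= y N.
Proof. by have := decay_gt0 beta C0 N; have := d1; rewrite /y; lra. Qed.

Let yN_lt : y N < 2.
Proof. by have := after; rewrite /y; lra. Qed.

Let yS : tri y N.+2 = y N * q - tri y N. Proof. exact: triSS. Qed.

Let y_dec n : y n.+1 <= y n. Proof. by rewrite /y lerD2l decay_le. Qed.

Let y_cvg : y n @[n --> \oo] --> 2 - delta.
Proof.
rewrite -[X in _ --> X]addr0; apply: cvgD; first exact: cvg_cst.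
exact: decay_cvg.
Qed.

Let yN1 : y N.+1 < 2. Proof. exact: le_lt_trans (y_dec N) yN_lt. Qed.

Let turanN : 0 <= turan y N <= 2 * q ^+ 2.
Proof.
apply/andP; split.
  by rewrite ltW// turan_gt0//; have := yN_ge; lra.
rewrite /turan -/q.
have h1 : tri y N ^+ 2 <= q ^+ 2 by rewrite lerXn2r// nnegrE// ltW.
have h2 : 0 <= y N * (q * tri y N).
  by rewrite mulr_ge0//; [have := yN_ge; lra|rewrite mulr_ge0// ltW].
lra.
Qed.

Let turanN1 : turan y N.+1 = turan y N + d * (tri y N.+2 * q).
Proof. by rewrite turanS /q /d /y; congr (_ + _ * _); ring. Qed.

(** From delta <= 1/2 one gets [y N >= 3/2], hence p_(N+1) >= p_N / 2 as p_(N-1) <= p_N, and T_(N+1)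
    >= d G^2 / 2 as T_N >= 0. The nondecreasing ratio then loses at most a factor 2 on the way to
    the limit. *)
Lemma turan_limit_lb : d * G ^+ 2 / 4 <= L.
Proof.
have h1 : q / 2 <= tri y N.+2.
  rewrite yS; have := q'_le.
  have : 3 / 2 * q <= y N * q by rewrite ler_pM2r.
  lra.
have G0 : 0 <= G by rewrite (le_trans ler01).
have h2 : G ^+ 2 / 2 <= tri y N.+2 * q.
  have := ler_pM G0 G0 q_lb q_lb; have := ler_pM (ltW q_gt0) _ (lexx q) h1.
  have q2 : 0 <= q / 2 by rewrite divr_ge0// ltW.
  by move=> /(_ q2); rewrite expr2; lra.
have h3 : d * (G ^+ 2 / 2) <= turan y N.+1.
  have /andP[t0 _] := turanN.
  by rewrite turanN1 (le_trans (_ : _ <= d * (tri y N.+2 * q))) ?ler_pM2l// lerDr.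
have l2 : -2 < 2 - delta by have := d1; lra.
have := turan_lim_lb l2 y_dec y_cvg yN1 yL.
have t0 : 0 <= turan y N.+1.
  by apply: le_trans h3; rewrite mulr_ge0 ?divr_ge0 ?exprn_ge0// ltW.
have L0 : 0 <= L.
  have y0 n : 2 - delta <= y n by exact: (ge_lim y_dec y_cvg).
  have cL : turan y (n + N.+1)%N @[n --> \oo] --> L.
    by move: yL; rewrite -(@cvg_shiftn N.+1).
  rewrite -(cvg_lim _ cL)//; apply: limr_ge; first by apply/cvg_ex; exists L.
  apply: nearW => n; rewrite ltW// turan_gt0//.
    by rewrite (lt_le_trans _ (y0 _)).
  elim: n => [//|n IH]; rewrite addSn; exact: le_lt_trans (y_dec _) IH.
have e1 : 2 + y N.+1 <= 4 by have := yN1; lra.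
have e2 : turan y N.+1 * 2 <= turan y N.+1 * (2 + (2 - delta)).
  by apply: ler_wpM2l => //; have := d1; lra.
have e3 : L * (2 + y N.+1) <= L * 4 by exact: ler_wpM2l.
by lra.
Qed.

(** The nonincreasing ratio gives [L * (2 - y N.+1) <= turan y N.+1 * delta]. Here
    [2 - y N.+1 >= d], because [a N < delta], and T_(N+1) <= 2 p_N^2 + d (2 p_N^2) with [d <= C]. *)
Lemma turan_limit_ub : L <= (2 + 2 * C) * (N.+1%:R * G) ^+ 2 / d.
Proof.
have h1 : tri y N.+2 <= 2 * q.
  rewrite yS; have := q'_ge0; have : y N * q <= 2 * q by rewrite ler_pM2r// ltW.
  lra.
have h2 : turan y N.+1 <= (2 + 2 * C) * q ^+ 2.
  have /andP[_ t0] := turanN; rewrite turanN1.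
  have e1 : d * (tri y N.+2 * q) <= d * (2 * q * q) by rewrite ler_pM2l// ler_pM2r.
  have e2 : d * (2 * q * q) <= C * (2 * q * q).
    by rewrite ler_pM2r// !mulr_gt0.
  by rewrite expr2 in t0 *; lra.
have h3 : q ^+ 2 <= (N.+1%:R * G) ^+ 2.
  by rewrite lerXn2r ?nnegrE ?(le_trans _ q_ub)// ltW.
have C2 : 0 < 2 + 2 * C by rewrite addr_gt0// mulr_gt0.
have h4 : turan y N.+1 <= (2 + 2 * C) * (N.+1%:R * G) ^+ 2.
  by rewrite (le_trans h2)// ler_pM2l.
have := turan_lim_ub y_dec y_cvg yN1 yL; rewrite subKr => h5.
have yd : d <= 2 - y N.+1 by rewrite /d /y; have := yN_lt; rewrite /y; lra.
rewrite ler_pdivlMr//.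
have [L0|L0] := leP L 0.
  apply: le_trans (_ : 0 <= _); first by rewrite mulr_le0_ge0// ltW.
  by rewrite mulr_ge0 ?exprn_ge0 ?ltW// (lt_le_trans q_gt0).
have e1 : L * d <= L * (2 - y N.+1) by rewrite ler_pM2l.
have e2 : turan y N.+1 * delta <= (2 + 2 * C) * (N.+1%:R * G) ^+ 2.
  have R0 : 0 <= (2 + 2 * C) * (N.+1%:R * G) ^+ 2.
    by rewrite mulr_ge0 ?exprn_ge0 ?ltW// (lt_le_trans q_gt0).
  have f1 : turan y N.+1 * delta <= (2 + 2 * C) * (N.+1%:R * G) ^+ 2 * delta.
    by rewrite ler_pM2r.
  apply: le_trans f1 _; rewrite ler_piMr//; have := d1; lra.
lra.
Qed.

End fixed_delta.

Lemma ln_turan_limit : exists2 K : R, 0 <= K &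
  forall (delta : R) N (L : R), 0 < delta <= 2^-1 ->
  (forall n, (n < N)%N -> delta <= a n) -> a N < delta ->
  turan (fun n => 2 - delta + a n) n @[n --> \oo] --> L ->
  `|ln L / 2 - \sum_(n < N) arcosh (1 + (a n - delta) / 2)| <= K * `|ln delta|.
Proof.
have [K K0 HK] := ln_turning_index C0 beta0.
have l2 : 0 < ln 2 :> R by rewrite ln_gt0// ltr1n.
pose A := `|ln (2 + 2 * C)| + `|ln (C * beta)| + ln 4.
have l4 : 0 <= ln 4 :> R by rewrite ln_ge0// ler1n.
have A0 : 0 <= A by rewrite !addr_ge0.
(* [beta + 1] comes from the lower bound on [d], the remaining 2 from the square of [N.+1]; [A]
   gathers the constants. *)
exists (A / ln 2 + (beta + 3) * K).
  by rewrite addr_ge0 ?divr_ge0 ?mulr_ge0 ?addr_ge0// ltW.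
move=> delta N L dI before after yL.
have := turan_limit_lb dI before after yL.
have := turan_limit_ub dI before after yL.
have ld := ln2_le_norm_ln dI.
have lN := HK delta N dI before.
have dd := decay_diff C0 beta0 N.
set G := \prod_(k < N) _; set d := a N - a N.+1.
have w0 : 0 < C * beta * N.+2%:R `^ (- (beta + 1)).
  by rewrite mulr_gt0 ?powR_gt0// mulr_gt0.
have d0 : 0 < d by exact: lt_le_trans dd.
have G0 : 0 < G by apply: prodr_gt0 => i _; exact: expR_gt0.
have C2 : 0 < 2 + 2 * C by rewrite addr_gt0// mulr_gt0.
move=> ub lb.
have L0 : 0 < L by apply: lt_le_trans lb; rewrite divr_gt0// mulr_gt0// exprn_gt0.
have lnG : ln G = \sum_(n < N) arcosh (1 + (a n - delta) / 2).
  by rewrite /G -expR_sum expRK.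
have lnd : ln (C * beta) - (beta + 1) * ln N.+2%:R <= ln d.
  apply: le_trans (_ : ln (C * beta * N.+2%:R `^ (- (beta + 1))) <= _).
    rewrite [leRHS]lnM ?posrE ?mulr_gt0 ?powR_gt0// powR_expR// expRK; lra.
  by rewrite ler_ln ?posrE.
have lnub : ln L <= ln (2 + 2 * C) + 2 * (ln N.+2%:R + ln G) - ln d.
  apply: le_trans (_ : ln ((2 + 2 * C) * (N.+1%:R * G) ^+ 2 / d) <= _).
    by rewrite ler_ln ?posrE// divr_gt0// mulr_gt0// exprn_gt0// mulr_gt0.
  rewrite ln_div ?posrE// ?mulr_gt0 ?exprn_gt0 ?mulr_gt0//.
  rewrite lnM ?posrE ?exprn_gt0 ?mulr_gt0// lnXn ?mulr_gt0// lnM ?posrE//.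
  have : ln N.+1%:R <= ln N.+2%:R :> R by rewrite ler_ln ?posrE// ler_nat.
  by rewrite -mulr_natl; lra.
have lnlb : ln d + 2 * ln G - ln 4 <= ln L.
  apply: le_trans (_ : ln (d * G ^+ 2 / 4) <= _); last first.
    by rewrite ler_ln ?posrE// divr_gt0// mulr_gt0// exprn_gt0.
  rewrite ln_div ?posrE ?mulr_gt0 ?exprn_gt0// lnM ?posrE ?exprn_gt0//.
  by rewrite lnXn// -mulr_natl; lra.
rewrite -lnG.
have n1 := ler_norm (ln (2 + 2 * C)).
have n2 := ler_norm (- ln (C * beta)); rewrite normrN in n2.
have n3 := normr_ge0 (ln (2 + 2 * C)).
have lN0 : 0 <= ln N.+2%:R :> R by rewrite ln_ge0// ler1n.
have hA : A <= A / ln 2 * `|ln delta|.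
  by rewrite -mulrA; apply: ler_peMr => //; rewrite mulrC ler_pdivlMr// mul1r.
have hK : (beta + 3) * ln N.+2%:R <= (beta + 3) * K * `|ln delta|.
  by rewrite -mulrA ler_wpM2l// addr_ge0// ltW.
rewrite mulrDl ler_norml; rewrite /A in hA *.
have hb : 0 <= (beta + 1) * ln N.+2%:R by rewrite mulr_ge0// addr_ge0// ltW.
by apply/andP; split; lra.
Qed.

End turning_point.

(** * The spectral density *)

Section polynomial_moments.
Variables (R : realType) (mu : probability (measurableTypeR R) R) (D : set R).
Hypothesis mD : measurable (D : set (measurableTypeR R)).
Variable M : R.
Hypothesis DM : forall x, D x -> `|x| <= M.

Lemma horner_bounded (r : {poly R}) : exists B, forall x, D x -> `|r.[x]| <= B.
Proof.
elim/poly_ind: r => [|r a [B Br]].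
  by exists 0 => x _; rewrite horner0 normr0.
exists (B * M + `|a|) => x Dx; rewrite hornerMXaddC (le_trans (ler_normD _ _))//.
by rewrite lerD2r normrM ler_pM// ?Br ?DM.
Qed.

Lemma horner_integrable (r : {poly R}) :
  mu.-integrable D (fun x => (r.[x])%:E).
Proof.
have [B Br] := horner_bounded r.
apply: (bounded_integrable mD _ _ Br); last exact: measurable_poly.
by rewrite (le_lt_trans (probability_le1 _ mD))// ltry.
Qed.

Definition moment (r : {poly R}) : R := (\int[mu]_(x in D) r.[x])%R.

Lemma momentD r s : moment (r + s) = moment r + moment s.
Proof.
rewrite /moment -RintegralD//; try exact: horner_integrable.
by apply: eq_Rintegral => x _; rewrite hornerD.
Qed.

Lemma momentZ a r : moment (a *: r) = a * moment r.
Proof.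
rewrite /moment -RintegralZl//; try exact: horner_integrable.
by apply: eq_Rintegral => x _; rewrite hornerZ.
Qed.

Variables (p : nat -> {poly R}) (b : nat -> R).
Hypothesis pS : forall n, 'X * p n.+1 = p n.+2 + b n.+2 *: p n.+1 + p n.
Hypothesis porth : forall m n, moment (p m * p n) = (m == n)%:R.
Hypothesis b0 : b n @[n --> \oo] --> 0.

(** The number of walks on the integers with [j] steps of +1 or -1 from [k] to 0, folded by symmetry
    to [k >= 0]: the (0, k) entry of the j-th power of the free two-sided Jacobi matrix. *)
Fixpoint free_moment (j k : nat) : R :=
  if j is i.+1 then
    free_moment i k.+1 + (if k is l.+1 then free_moment i l else free_moment i 1)
  else (k == 0%N)%:R.

(** One factor 'X is absorbed by the recurrence, the diagonal term disappearing because b tends to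
    0. For [k = 0] the recurrence reaches down to the preceding polynomial, so the sequence is
    shifted by one first. *)
Lemma moment_cvg j k :
  moment ('X^j * (p n * p (n + k)%N)) @[n --> \oo] --> free_moment j k.
Proof.
elim: j k => [|j IH] k.
  rewrite (_ : (fun n => _) = cst ((k == 0%N)%:R)); first exact: cvg_cst.
  apply/funext => n; rewrite expr0 mul1r porth.
  by rewrite -{1}[n]addn0 eqn_add2l eq_sym.
case: k => [|k].
  rewrite -cvg_shiftS /=.
  rewrite (_ : (fun n => _) = fun n => moment ('X^j * (p n.+1 * p (n.+1 + 1)%N))
     + b n.+2 * moment ('X^j * (p n.+1 * p (n.+1 + 0)%N))
     + moment ('X^j * (p n * p (n + 1)%N))); last first.
    apply/funext => n; rewrite -momentZ -!momentD; congr moment.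
    rewrite exprSr -mulrA [in 'X * _]mulrA pS !addn1 addn0 -!mul_polyC; ring.
  have h : b n.+2 * moment ('X^j * (p n.+1 * p (n.+1 + 0)%N)) @[n --> \oo] --> 0.
    rewrite -(mul0r (free_moment j 0)); apply: cvgM.
      by move: b0; rewrite -cvg_shiftS -cvg_shiftS.
    by have := IH 0%N; rewrite -cvg_shiftS.
  rewrite -[free_moment _ _ + _]addr0 addrAC; apply: cvgD; last exact: (IH 1%N).
  apply: cvgD => //.
  by have := IH 1%N; rewrite -cvg_shiftS.
rewrite (_ : (fun n => _) = fun n => moment ('X^j * (p n * p (n + k.+2)%N))
     + b (n + k).+2 * moment ('X^j * (p n * p (n + k.+1)%N))
     + moment ('X^j * (p n * p (n + k)%N))); last first.
  apply/funext => n; rewrite -momentZ -!momentD; congr moment.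
  rewrite exprSr !addnS.
  transitivity ('X^j * (p n * ('X * p (n + k).+1))); first by ring.
  rewrite pS -!mul_polyC; ring.
have h : b (n + k).+2 * moment ('X^j * (p n * p (n + k.+1)%N)) @[n --> \oo] --> 0.
  rewrite -(mul0r (free_moment j k.+1)); apply: cvgM; last exact: IH.
  by move: b0; rewrite -cvg_shiftS -cvg_shiftS -(@cvg_shiftn k).
rewrite (_ : free_moment j.+1 k.+1 = free_moment j k.+2 + 0 + free_moment j k);
  last by rewrite addr0.
apply: cvgD; last exact: IH.
by apply: cvgD.
Qed.

Definition turan_poly n : {poly R} :=
  p n.+1 ^+ 2 + p n ^+ 2 - ('X - (b n.+2)%:P) * (p n.+1 * p n).

(** The three products contribute twice [free_moment j 0] minus [free_moment j.+1 1], and the latter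
    unfolds to [free_moment j 2 + free_moment j 0]. *)
Lemma moment_turan_poly_cvg j :
  moment ('X^j * turan_poly n) @[n --> \oo] -->
    free_moment j 0 - free_moment j 2.
Proof.
rewrite (_ : (fun n => _) = fun n => moment ('X^j * (p n.+1 * p (n.+1 + 0)%N))
   + moment ('X^j * (p n * p (n + 0)%N))
   - moment ('X^(j.+1) * (p n * p (n + 1)%N))
   + b n.+2 * moment ('X^j * (p n * p (n + 1)%N))); last first.
  apply/funext => n; rewrite -[- _]mulN1r -!momentZ -!momentD; congr moment.
  rewrite /turan_poly !addn0 !addn1 (exprSr 'X j) -!mul_polyC rmorphN1; ring.
rewrite (_ : _ - _ = free_moment j 0 + free_moment j 0 - free_moment j.+1 1 +
  0 * free_moment j 1); last first.
  by rewrite mul0r /=; ring.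
apply: cvgD; first apply: cvgB; first apply: cvgD.
- by have := @moment_cvg j 0%N; rewrite -cvg_shiftS.
- exact: moment_cvg.
- exact: moment_cvg.
- by apply: cvgM; [move: b0; rewrite -cvg_shiftS -cvg_shiftS|exact: moment_cvg].
Qed.

End polynomial_moments.

(** * The limiting moments are those of the semicircle law *)

Section semicircle_moments.
Variable R : realType.
Notation leb := (@lebesgue_measure R).

Lemma continuous_itv_integrable (f : R -> R) (a b : R) :
  {within `[a, b], continuous f} -> leb.-integrable `[a, b] (EFin \o f).
Proof.
by move=> cf; apply: continuous_compact_integrable => //; exact: segment_compact.
Qed.

Lemma derive_continuous (F f : R -> R) :
  (forall x : R, is_derive x 1 F (f x)) -> continuous F.
Proof.
move=> dF x; apply/differentiable_continuous/derivable1_diffP.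
by have := dF x; case.
Qed.

Lemma Rintegral_FTC2 (F f : R -> R) (a b : R) : a < b ->
  (forall x : R, is_derive x 1 F (f x)) -> continuous f ->
  (\int[leb]_(x in `[a, b]) f x)%R = F b - F a.
Proof.
move=> ab dF cf; have cF := derive_continuous dF.
rewrite /Rintegral (@continuous_FTC2 _ f F)//.
- exact: continuous_subspaceT.
- split; [by move=> x _; have := dF x; case| |].
  + by apply: cvg_at_right_filter; exact: cF.
  + by apply: cvg_at_left_filter; exact: cF.
- by move=> x _; rewrite derive1E; have := dF x; case.
Qed.

Lemma is_derive_mull (k : R) (f : R -> R) (x a : R) :
  is_derive x 1 f a -> is_derive x 1 (fun t => k * f t) (k * a).
Proof. exact: is_deriveZ. Qed.

Let cosk (k : nat) (t : R) : R := cos (k%:R * t).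

Let dsink k (x : R) : is_derive x 1 (fun t => sin (k%:R * t)) (k%:R * cosk k x).
Proof.
have h : is_derive x 1 (fun t : R => k%:R * t) k%:R.
  by rewrite -[X in is_derive _ _ _ X]mulr1; apply: is_derive_mull; exact: is_derive_id.
rewrite mulrC; apply: (@is_derive1_comp _ sin); exact: is_derive_sin.
Qed.

Let sinkpi k : sin (k%:R * pi) = 0 :> R.
Proof.
elim: k => [|k IH]; first by rewrite mul0r sin0.
by rewrite -natr1 mulrDl mul1r sinD IH sinpi mul0r mulr0 addr0.
Qed.

Let cont_cosk k : continuous (cosk k).
Proof.
move=> x; apply: continuous_comp; last exact: continuous_cos.
by apply: cvgM; [exact: cvg_cst|exact: cvg_id].
Qed.

Let int_cosk k : (\int[leb]_(t in `[0%R, pi]) cosk k t)%R = pi * (k == 0%N)%:R.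
Proof.
case: k => [|k].
  have d (x : R) : is_derive x 1 id (cosk 0 x).
    by rewrite /cosk mul0r cos0; exact: is_derive_id.
  by rewrite (Rintegral_FTC2 (pi_gt0 R) d)// subr0 mulr1.
have d (x : R) :
    is_derive x 1 (fun t => k.+1%:R^-1 * sin (k.+1%:R * t)) (cosk k.+1 x).
  apply: is_derive_eq (is_derive_mull _ (dsink k.+1 x)) _.
  by rewrite mulrA mulVf ?mul1r ?pnatr_eq0.
by rewrite (Rintegral_FTC2 (pi_gt0 R) d)// sinkpi !mulr0 sin0 mulr0 subr0.
Qed.

Let cont_pow j k : continuous (fun t : R => (2 * cos t) ^+ j * cosk k t).
Proof.
move=> x; apply: cvgM; last exact: cont_cosk.
apply: (@continuous_comp _ _ _ (fun t : R => 2 * cos t) (fun u => u ^+ j)).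
  by apply: cvgM; [exact: cvg_cst|exact: continuous_cos].
exact: exprn_continuous.
Qed.

Let int_pow j k : leb.-integrable `[0%R, pi]
  (EFin \o (fun t : R => (2 * cos t) ^+ j * cosk k t)).
Proof.
by apply: continuous_itv_integrable; apply: continuous_subspaceT; exact: cont_pow.
Qed.

(** The integrals obey the same recursion, since 2 cos t cos(k t) = cos((k+1) t) + cos((k-1) t);
    evenness of the cosine matches the folding at [k = 0]. *)
Lemma free_momentE j k : (\int[leb]_(t in `[0%R, pi])
  ((2 * cos t) ^+ j * cos (k%:R * t)))%R = pi * free_moment R j k.
Proof.
elim: j k => [|j IH] k.
  rewrite -int_cosk; apply: eq_Rintegral => t _.
  by rewrite expr0 mul1r.
pose k' := if k is l.+1 then l else 1%N.
transitivity (\int[leb]_(t in `[0%R, pi])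
  ((2 * cos t) ^+ j * cosk k.+1 t + (2 * cos t) ^+ j * cosk k' t))%R.
  apply: eq_Rintegral => t _; rewrite exprSr -mulrA -mulrDr; congr (_ * _).
  rewrite /cosk /k'; case: (k) => [|l].
    by rewrite mul0r cos0 !mul1r; ring.
  have -> : l.+2%:R * t = l.+1%:R * t + t by rewrite -[l.+2%:R]natr1; ring.
  have -> : l%:R * t = l.+1%:R * t - t by rewrite -[l.+1%:R]natr1; ring.
  by rewrite cosD cosB; ring.
rewrite RintegralD//; try exact: int_pow.
rewrite !IH -mulrDr /= /k'; by case: (k).
Qed.

Definition semicircle (x : R) : R := Num.sqrt (4 - x ^+ 2) / (2 * pi).

Lemma semicircle_continuous : continuous semicircle.
Proof.
move=> x; apply: cvgM; last exact: cvg_cst.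
apply: (@continuous_comp _ _ _ (fun x : R => 4 - x ^+ 2)).
  apply: cvgB; first exact: cvg_cst.
  exact: exprn_continuous.
exact: sqrt_continuous.
Qed.

Lemma semicircle_ge0 x : 0 <= semicircle x.
Proof. by rewrite divr_ge0 ?sqrtr_ge0// mulr_ge0// pi_ge0. Qed.

Lemma semicircle_gt0 x : -2 < x < 2 -> 0 < semicircle x.
Proof.
move=> /andP[x1 x2]; rewrite divr_gt0// ?mulr_gt0 ?pi_gt0// sqrtr_gt0.
by nra.
Qed.

(** Substitute x = 2 cos t: on [0, pi] both sqrt(4 - x^2) and -dx/dt equal 2 sin t, and 1 - cos(2 t)
    = 2 sin^2 t. In the identity [E], [c] stands for pi and [s] for sin t. *)
Lemma free_moment_semicircle j : free_moment R j 0 - free_moment R j 2 =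
  (\int[leb]_(x in `[(-2)%R, 2%R]) (x ^+ j * semicircle x))%R.
Proof.
have pi0 : pi != 0 :> R by rewrite gt_eqF ?pi_gt0.
have E (c a s : R) : c != 0 ->
    a * 1 - a * (1 - 2 * s ^+ 2) = c * (a * (2 * s / (2 * c)) * (2 * s)).
  by move=> c0; field.
have -> : `[(-2)%R, 2%R]%classic = `[2 * cos pi, 2 * cos 0]%classic :> set R.
  by rewrite cospi cos0 mulrN1 mulr1.
have dcos (x : R) : is_derive x 1 (fun t : R => 2 * cos t) (- (2 * sin x)).
  by rewrite -mulrN; apply: is_derive_mull; exact: is_derive_cos.
have ccos := derive_continuous dcos.
have dE : derive1 (fun t : R => 2 * cos t) = (fun t => - (2 * sin t)).
  by apply/funext => t; rewrite derive1E; have := dcos t; case.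
have cd : continuous (fun t : R => - (2 * sin t)).
  move=> t; apply: cvgN; apply: cvgM; [exact: cvg_cst|exact: continuous_sin].
rewrite [in RHS]/Rintegral
  (@integration_by_substitution_decreasing _ (fun t : R => 2 * cos t) _ 0 pi)
  ?pi_ge0//; last 6 first.
- by move=> x y x0 y0 xy /=; rewrite ltr_pM2l// ltr_cos.
- by rewrite dE => x _; exact: cd.
- by rewrite dE; apply/cvg_ex; eexists; apply: cvg_at_right_filter; exact: cd.
- by rewrite dE; apply/cvg_ex; eexists; apply: cvg_at_left_filter; exact: cd.
- split; [by move=> x _; have := dcos x; case| |].
  + by apply: cvg_at_right_filter; exact: ccos.
  + by apply: cvg_at_left_filter; exact: ccos.
- apply: continuous_subspaceT => x; apply: cvgM; first exact: exprn_continuous.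
  exact: semicircle_continuous.
apply: (mulfI pi0); rewrite mulrBr -!free_momentE -RintegralB//; try exact: int_pow.
rewrite -/(Rintegral _ _ _) -RintegralZl//; last first.
  apply: continuous_itv_integrable; apply: continuous_subspaceT => x.
  rewrite dE; apply: cvgM; last by apply: cvgN; exact: cd.
  apply: (@continuous_comp _ _ _ (fun t : R => 2 * cos t)); first exact: ccos.
  apply: cvgM; first exact: exprn_continuous.
  exact: semicircle_continuous.
apply: eq_Rintegral => t; rewrite inE /= in_itv /= => t0.
rewrite dE /= /semicircle.
have -> : 4 - (2 * cos t) ^+ 2 = (2 * sin t) ^+ 2.
  by rewrite exprMn cos2sin2; ring.
rewrite sqrtr_sqr ger0_norm ?mulr_ge0 ?sin_ge0_pi//.
rewrite mul0r cos0 (_ : cos (2 * t) = 1 - 2 * sin t ^+ 2); last first.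
  by rewrite mulr_natl cos_mulr2n cos2sin2; ring.
rewrite [X in pi * (_ * X)](_ : _ = 2 * sin t); last exact: opprK.
exact: (E _ _ _ pi0).
Qed.

End semicircle_moments.

Section polynomial_approximation.
Variable R : realType.

(* The classical iteration for the square root of 'X^2, i.e., for |x|. *)
Fixpoint abs_poly (k : nat) : {poly R} :=
  if k is j.+1 then abs_poly j + 2^-1 *: ('X^2 - abs_poly j ^+ 2) else 0.

(** One iteration multiplies the error by 1 - (t + P)/2 <= 1 - t/2, where t = |u|, and (1 - t/2)(1 +
    (k+1) t/2) <= 1 + k t/2. The third bound gives an error of at most 2/k, uniformly in [u]. *)
Lemma abs_poly_bound k (u : R) : `|u| <= 1 ->
  [/\ 0 <= (abs_poly k).[u], (abs_poly k).[u] <= `|u|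
    & (`|u| - (abs_poly k).[u]) * (1 + k%:R * `|u| / 2) <= `|u|].
Proof.
move=> u1; elim: k => [|k [IH0 IH1 IH2]].
  by rewrite horner0 subr0 !mul0r addr0 mulr1.
have -> : (abs_poly k.+1).[u] =
    (abs_poly k).[u] + (`|u| ^+ 2 - (abs_poly k).[u] ^+ 2) / 2.
  rewrite /= hornerD hornerZ hornerD hornerN !horner_exp hornerX real_normK ?num_real//.
  by rewrite mulrC.
rewrite -[k.+1%:R]natr1; have u0 := normr_ge0 u.
move: IH0 IH1 IH2; set t := `|u| in u0 u1 *; set P := (abs_poly k).[u].
have k0 : 0 <= k%:R :> R by [].
move: k0; set K := k%:R => k0 P0 Pt h.
have h1 : 0 <= (t - P) * (t + P).
  by rewrite mulr_ge0 ?subr_ge0// addr_ge0.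
split.
- by rewrite !expr2; lra.
- have h2 : 0 <= (t - P) * (2 - (t + P)) by rewrite mulr_ge0; lra.
  by rewrite !expr2; lra.
- rewrite (_ : t - (P + (t ^+ 2 - P ^+ 2) / 2) = (t - P) * (1 - (t + P) / 2));
    last by field.
  apply: le_trans h; rewrite -mulrA ler_wpM2l ?subr_ge0//.
  have a1 : 0 <= P * (K + 1) * t by rewrite !mulr_ge0// addr_ge0.
  have a2 : 0 <= t * (K + 1) * t by rewrite !mulr_ge0// addr_ge0.
  by lra.
Qed.

(** Division by [S] brings [x - a] into [-1, 1]; the error there is at most 2/k, hence
    [k > 2 * S / e]. *)
Lemma normr_poly_approx (a M e : R) : 0 < e ->
  exists r : {poly R}, forall x, `|x| <= M -> `| `|x - a| - r.[x] | <= e.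
Proof.
move=> e0; pose S := `|M| + `|a| + 1.
have S0 : 0 < S by rewrite ltr_pwDr// addr_ge0.
pose k := (Num.truncn (2 * S / e)).+1.
have k0 : 0 < k%:R :> R by [].
have ke : 2 * S / e < k%:R by exact: truncnS_gt.
exists (S *: (abs_poly k \Po (S^-1 *: ('X - a%:P)))) => x xM.
rewrite hornerZ horner_comp hornerZ hornerXsubC.
set u := S^-1 * (x - a).
have xE : `|x - a| = S * `|u|.
  by rewrite normrM gtr0_norm ?invr_gt0// mulrA divff ?mul1r ?gt_eqF.
have u1 : `|u| <= 1.
  rewrite normrM gtr0_norm ?invr_gt0// mulrC ler_pdivrMr// mul1r.
  rewrite (le_trans (ler_normB _ _))// /S.
  have := ler_norm M; lra.
have [P0 P1 P2] := abs_poly_bound k u1.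
rewrite xE -mulrBr normrM gtr0_norm// ger0_norm ?subr_ge0//.
have [u0|u0] := leP `|u| 0.
  have -> : `|u| - (abs_poly k).[u] = 0 by apply/eqP; rewrite eq_le; lra.
  by rewrite mulr0 ltW.
rewrite ltr_pdivrMr// in ke.
set E := `|u| - _ in P2 *.
have E0 : 0 <= E by rewrite subr_ge0.
have h : E * k%:R <= 2.
  rewrite -(ler_pM2r u0).
  have : 0 <= E by [].
  by move: P2; rewrite mulrDr mulr1; lra.
rewrite -(ler_pM2l k0); apply: le_trans (_ : 2 * S <= _); last by apply: ltW; lra.
have : E * k%:R * S <= 2 * S by rewrite ler_pM2r.
by lra.
Qed.

End polynomial_approximation.


(** * Weak convergence of the Turán determinants times mu *)

Section turan_weak_limit.
Variables (R : realType) (mu : probability (measurableTypeR R) R) (M : R).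
Hypothesis M_ge2 : 2 <= M.
Let D : set (measurableTypeR R) := `[- M, M].
Notation leb := (@lebesgue_measure R).

Variables (p : nat -> {poly R}) (b : nat -> R).
Hypothesis pS : forall n, 'X * p n.+1 = p n.+2 + b n.+2 *: p n.+1 + p n.
Hypothesis porth : forall m n, moment mu D (p m * p n) = (m == n)%:R.
Hypothesis b0 : b n @[n --> \oo] --> 0.

Let mD : measurable D. Proof. exact: measurable_itv. Qed.

Let DM x : D x -> `|x| <= M.
Proof. by rewrite /D /= in_itv /= ler_norml. Qed.

Let muD : (mu D < +oo)%E.
Proof. by rewrite (le_lt_trans (probability_le1 _ mD))// ltry. Qed.

Let tp n : {poly R} := turan_poly p b n.

Let tp_int (f : R -> R) n : continuous f ->
  mu.-integrable D (EFin \o (fun x => f x * (tp n).[x])).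
Proof.
move=> cf.
have cg : continuous (fun x => f x * (tp n).[x]).
  by move=> x; apply: cvgM; [exact: cf|exact: continuous_horner].
have : compact ((fun x => f x * (tp n).[x]) @` `[- M, M]).
  apply: continuous_compact; last exact: segment_compact.
  exact: continuous_subspaceT.
move=> /compact_bounded [B [_ Bf]].
apply: (@bounded_integrable _ _ _ mu D mD muD _ (B + 1)).
  by apply: measurable_funTS; exact: continuous_measurable_fun.
by move=> x Dx; apply: Bf; [rewrite ltrDl|exists x].
Qed.

(** Continuity is bundled with the limit because it supplies the integrability needed to add and
    scale test functions. *)
Definition turan_weak (f : R -> R) := continuous f /\
  (\int[mu]_(x in D) (f x * (turan_poly p b n).[x]))%R @[n --> \oo] -->
  (\int[leb]_(x in `[(-2)%R, 2%R]) (f x * semicircle x))%R.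

Let semi_int (f : R -> R) : continuous f ->
  leb.-integrable `[(-2)%R, 2%R] (EFin \o (fun x => f x * semicircle x)).
Proof.
move=> cf; apply: continuous_itv_integrable; apply: continuous_subspaceT => x.
by apply: cvgM; [exact: cf|exact: semicircle_continuous].
Qed.

Lemma turan_weakD f g : turan_weak f -> turan_weak g ->
  turan_weak (fun x => f x + g x).
Proof.
move=> [cf hf] [cg hg]; split; first by move=> x; apply: cvgD; [exact: cf|exact: cg].
rewrite [X in _ --> X](_ : _ = (\int[leb]_(x in `[(-2)%R, 2%R]) (f x * semicircle x))%R
  + (\int[leb]_(x in `[(-2)%R, 2%R]) (g x * semicircle x))%R); last first.
  rewrite -RintegralD//; try exact: semi_int.
  by apply: eq_Rintegral => x _; rewrite mulrDl.
rewrite (_ : (fun n => _) = fun n =>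
  (\int[mu]_(x in D) (f x * (turan_poly p b n).[x]))%R +
  (\int[mu]_(x in D) (g x * (turan_poly p b n).[x]))%R).
  exact: cvgD.
apply/funext => n; rewrite -RintegralD//; try exact: tp_int.
by apply: eq_Rintegral => x _; rewrite mulrDl.
Qed.

Lemma turan_weakZ a f : turan_weak f -> turan_weak (fun x => a * f x).
Proof.
move=> [cf hf]; split.
  by move=> x; apply: cvgM; [exact: cvg_cst|exact: cf].
rewrite [X in _ --> X](_ : _ = a *
    (\int[leb]_(x in `[(-2)%R, 2%R]) (f x * semicircle x))%R); last first.
  rewrite -RintegralZl//; try exact: semi_int.
  by apply: eq_Rintegral => x _; rewrite mulrA.
rewrite (_ : (fun n => _) = fun n =>
  a * (\int[mu]_(x in D) (f x * (turan_poly p b n).[x]))%R).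
  by apply: cvgM => //; exact: cvg_cst.
apply/funext => n; rewrite -RintegralZl//; try exact: tp_int.
by apply: eq_Rintegral => x _; rewrite mulrA.
Qed.

Let weak_monomial j : turan_weak (fun x => x ^+ j).
Proof.
split; first exact: exprn_continuous.
rewrite -free_moment_semicircle.
have := @moment_turan_poly_cvg R mu D mD M DM p b pS porth b0 j.
rewrite /moment; under eq_fun do under eq_Rintegral do rewrite hornerM hornerXn.
by [].
Qed.

Let eq_turan_weak f g : f =1 g -> turan_weak f -> turan_weak g.
Proof. by move=> /funext ->. Qed.

Lemma turan_weak_poly (r : {poly R}) : turan_weak (horner r).
Proof.
(* The monomial factor lets the Horner induction pass: each factor 'X removed from [r] raises
   [j]. *)
suff h j : turan_weak (fun x => x ^+ j * r.[x]).
  by apply: eq_turan_weak (h 0%N) => x; rewrite mul1r.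
elim/poly_ind: r j => [|r a IH] j.
  apply: eq_turan_weak (turan_weakZ 0 (weak_monomial 0)) => x.
  by rewrite horner0 mul0r mulr0.
apply: eq_turan_weak (turan_weakD (IH j.+1) (turan_weakZ a (weak_monomial j))) => x.
by rewrite hornerMXaddC exprSr; ring.
Qed.

Let b_bounded : exists B : R, 0 <= B /\ forall n, `|b n| <= B.
Proof.
have : bounded_fun b by apply: cvg_seq_bounded; apply/cvg_ex; exists 0.
move=> [B [_ Bb]]; exists (`|B| + 1); split; first exact: addr_ge0.
by move=> n; apply: Bb => //; rewrite (le_lt_trans (ler_norm B))// ltrDl.
Qed.

(** Outside (-2, 2) the determinant may change sign, so positivity cannot give this bound. On [D]
    its absolute value is at most 1 + M + B times the sum of two squared orthonormal polynomials,
    whose integral is 2. *)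
Let turan_L1 : exists K : R, 0 <= K /\ forall (f : R -> R) (e : R) n, continuous f ->
  (forall x, D x -> `|f x| <= e) ->
  `|(\int[mu]_(x in D) (f x * (tp n).[x]))%R| <= e * K.
Proof.
have [B [B0 Bb]] := b_bounded.
exists (2 * (1 + M + B)); split; first by have := M_ge2; nra.
move=> f e n cf fe.
apply: le_trans (le_normr_Rintegral mD (tp_int n cf)) _.
have int2 k : mu.-integrable D (EFin \o (fun x => (p k * p k).[x])).
  exact: (horner_integrable mu mD DM (p k * p k)).
have intS : mu.-integrable D
    (EFin \o (fun x => (p n.+1 * p n.+1).[x] + (p n * p n).[x])).
  exact: (integrableD mD (int2 n.+1) (int2 n)).
have intK : mu.-integrable D
    (EFin \o (fun x => (e * (1 + M + B)) *
      ((p n.+1 * p n.+1).[x] + (p n * p n).[x]))).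
  exact: (integrableZl mD (e * (1 + M + B)) intS).
apply: (@le_trans _ _ (\int[mu]_(x in D) ((e * (1 + M + B)) *
      ((p n.+1 * p n.+1).[x] + (p n * p n).[x])))%R).
  apply: le_Rintegral => //.
    exact: (integrable_norm (tp_int n cf)).
  move=> x Dx; rewrite normrM -mulrA ler_pM// ?fe//.
  rewrite /tp /turan_poly !(hornerD, hornerN, hornerM, hornerX, hornerC, horner_exp).
  set u := (p n.+1).[x]; set v := (p n).[x].
  have xM := DM Dx; have bB := Bb n.+2.
  have t0 : `|x - b n.+2| <= M + B.
    by rewrite (le_trans (ler_normB _ _))// lerD.
  have uv : `|u * v| <= u * u + v * v.
    rewrite normrM -(ger0_norm (sqr_ge0 u : 0 <= u * u)).
    rewrite -(ger0_norm (sqr_ge0 v : 0 <= v * v)) !normrM.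
    have := sqr_ge0 (`|u| - `|v|); have := normr_ge0 u; have := normr_ge0 v.
    by rewrite expr2; nra.
  rewrite (le_trans (ler_normB _ _))// [X in _ + X]normrM.
  rewrite [X in X + _]ger0_norm; last by rewrite addr_ge0// sqr_ge0.
  have := ler_pM (normr_ge0 _) (normr_ge0 _) t0 uv.
  by lra.
rewrite RintegralZl// RintegralD//.
have := porth n.+1 n.+1; rewrite /moment => ->.
by have := porth n n; rewrite /moment => ->; rewrite !eqxx -[true%:R]/(1 : R); lra.
Qed.

Lemma turan_weak_approx f : continuous f ->
  (forall e : R, 0 < e -> exists r : {poly R}, forall x, D x -> `|f x - r.[x]| <= e) ->
  turan_weak f.
Proof.
move=> cf fr; split => //; apply/cvgrPdist_le => e e0.
have [K [K0 HK]] := turan_L1.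
pose S := (\int[leb]_(x in `[(-2)%R, 2%R]) semicircle x)%R.
have S0 : 0 <= S by apply: Rintegral_ge0 => x _; exact: semicircle_ge0.
have d0 : 0 < e / (3 * (K + S + 1)) by rewrite divr_gt0// mulr_gt0// ltr_wpDl// addr_ge0.
have [r rP] := fr _ d0.
set d := e / _ in d0 rP.
have dE : d * (3 * (K + S + 1)) = e.
  by rewrite /d divfK// mulf_neq0// gt_eqF// ltr_wpDl// addr_ge0.
have [cr] := turan_weak_poly r; move/cvgrPdist_le => /(_ (e / 3)).
have e30 : 0 < e / 3 by rewrite divr_gt0.
move=> /(_ e30); apply: filterS => n.
pose g x := f x - r.[x].
have cg : continuous g.
  by move=> x; apply: cvgB; [exact: cf|exact: cr].
have gd x : D x -> `|g x| <= d by exact: rP.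
have h1 := HK g d n cg gd.
have -> : (\int[mu]_(x in D) (f x * (turan_poly p b n).[x]))%R =
    (\int[mu]_(x in D) (r.[x] * (turan_poly p b n).[x]))%R +
    (\int[mu]_(x in D) (g x * (turan_poly p b n).[x]))%R.
  rewrite -RintegralD//; try exact: tp_int.
  by apply: eq_Rintegral => x _; rewrite /g; ring.
have -> : (\int[leb]_(x in `[(-2)%R, 2%R]) (f x * semicircle x))%R =
    (\int[leb]_(x in `[(-2)%R, 2%R]) (r.[x] * semicircle x))%R +
    (\int[leb]_(x in `[(-2)%R, 2%R]) (g x * semicircle x))%R.
  rewrite -RintegralD//; try exact: semi_int.
  by apply: eq_Rintegral => x _; rewrite /g; ring.
have h2 : `|(\int[leb]_(x in `[(-2)%R, 2%R]) (g x * semicircle x))%R| <= d * S.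
  have cst1 : leb.-integrable `[(-2)%R, 2%R] (EFin \o (fun x => semicircle x)).
    apply: continuous_itv_integrable; apply: continuous_subspaceT.
    exact: semicircle_continuous.
  apply: le_trans (le_normr_Rintegral _ (semi_int cg)) _ => //.
  rewrite -RintegralZl//; apply: le_Rintegral => //.
  - exact: (integrable_norm (semi_int cg)).
  - exact: (integrableZl _ d cst1).
  - move=> x x2; rewrite normrM (ger0_norm (semicircle_ge0 x)).
    rewrite ler_wpM2r ?semicircle_ge0// gd//.
    move: x2; rewrite /D /= !in_itv /= => /andP[? ?].
    by have M2 := M_ge2; apply/andP; split; lra.
set A := (\int[mu]_(x in D) _)%R; set A' := (\int[mu]_(x in D) _)%R in h1 *.
set B := (\int[leb]_(x in _) _)%R; set B' := (\int[leb]_(x in _) _)%R in h2 *.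
move: h1 h2; rewrite !ler_norml => /andP[? ?] /andP[? ?] /andP[? ?].
by apply/andP; split; lra.
Qed.

Lemma turan_weak_dist a : turan_weak (fun x => `|x - a|).
Proof.
apply: turan_weak_approx.
  move=> x; apply: (@continuous_comp _ _ _ (fun x => x - a) (fun x => `|x|)).
    by apply: cvgB; [exact: cvg_id|exact: cvg_cst].
  exact: norm_continuous.
move=> e e0; have [r rP] := normr_poly_approx a M e0.
by exists r => x Dx; apply: rP; exact: DM.
Qed.

End turan_weak_limit.

(** * Integration against a measure with density *)

Section density_measure.
Context d (T : measurableType d) (R : realType).
Variables (mu : {measure set T -> \bar R}) (f : T -> R).
Hypotheses (f0 : forall x, 0 <= f x) (mf : measurable_fun [set: T] f).

(* The proofs are arguments only so that the measure instance below can refer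
   to them. *)
Definition density_measure of (forall x, 0 <= f x) & measurable_fun [set: T] f :
  set T -> \bar R := fun A => (\int[mu]_(x in A) (f x)%:E)%E.

Local Notation nu := (density_measure f0 mf).

Let nu0 : nu set0 = 0%E. Proof. by rewrite /density_measure integral_set0. Qed.

Let nu_ge0 A : (0 <= nu A)%E.
Proof. by apply: integral_ge0 => x _; rewrite lee_fin. Qed.

Let nu_sigma : semi_sigma_additive nu.
Proof.
apply: semi_sigma_additive_nng_induced; first exact/measurable_EFinP.
by move=> x; rewrite lee_fin.
Qed.

HB.instance Definition _ := isMeasure.Build _ _ _ nu nu0 nu_ge0 nu_sigma.

Import HBNNSimple.

Let integral_nnsfun_density (h : {nnsfun T >-> R}) :
  (\int[nu]_x (h x)%:E = \int[mu]_x ((h x)%:E * (f x)%:E))%E.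
Proof.
rewrite integralT_nnsfun sintegralE.
under [RHS]eq_integral => x _.
  rewrite fimfunE -fsumEFin// ge0_mule_fsuml; last first.
    by move=> r; exact: nnfun_muleindic_ge0.
  over.
have mi r : measurable_fun setT (fun x => ((r * \1_(h @^-1` [set r]) x)%:E * (f x)%:E)%E).
  by apply/measurable_EFinP; apply: measurable_funM => //; exact: measurable_funM.
rewrite ge0_integral_fsum//; last first.
  by move=> r x _; rewrite mule_ge0 ?lee_fin ?f0//; have := nnfun_muleindic_ge0 h r x.
apply: eq_fsbigr => r /set_mem [t _ hr].
under eq_integral do rewrite EFinM -muleA.
rewrite ge0_integralZl_EFin//; last 3 first.
- by move=> x _; rewrite mule_ge0// lee_fin.
- by apply/measurable_EFinP; exact: measurable_funM.
- by rewrite -hr; exact: fun_ge0.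
congr (_ * _)%E; rewrite -[LHS]/(density_measure f0 mf _) /density_measure.
rewrite integral_mkcond; apply: eq_integral => x _.
by rewrite epatch_indic muleC.
Qed.

Lemma integral_density_measure (h : T -> \bar R) : (forall x, 0 <= h x)%E ->
  measurable_fun [set: T] h ->
  (\int[nu]_x h x = \int[mu]_x (h x * (f x)%:E))%E.
Proof.
move=> h0 mh.
have [g [g_nd gh]] := approximation measurableT mh (fun x _ => h0 x).
transitivity (limn (fun n => \int[nu]_x (g n x)%:E)%E).
  rewrite -monotone_convergence//.
  - by apply: eq_integral => x _; apply/esym/cvg_lim => //; exact: gh.
  - by move=> n; exact/measurable_EFinP.
  - by move=> n x _; rewrite lee_fin.
  - by move=> x _ m n mn; rewrite lee_fin; exact/lefP/g_nd.
transitivity (limn (fun n => \int[mu]_x ((g n x)%:E * (f x)%:E))%E); last first.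
  rewrite -monotone_convergence//.
  - apply: eq_integral => x _; apply/cvg_lim => //.
    by apply: cvgeZr => //; exact: gh.
  - by move=> n; apply/measurable_EFinP; exact: measurable_funM.
  - by move=> n x _; rewrite mule_ge0 ?lee_fin.
  - move=> x _ m n mn; rewrite lee_wpmul2r ?lee_fin//; exact/lefP/g_nd.
by apply/congr_lim/funext => n; exact: integral_nnsfun_density.
Qed.

End density_measure.

Section trapezoid.
Variable R : realType.

(** Rises on [c, c + h], is 1 up to d - h, and returns to 0 at d. The factors [-1 *] match the shape
    produced by [turan_weakD] and [turan_weakZ]. *)
Definition trapezoid (c d h x : R) : R :=
  (2 * h)^-1 * (`|x - c| + -1 * `|x - (c + h)| + -1 * `|x - (d - h)| + `|x - d|).

Lemma trapezoid_bound c d h x : 0 < h -> c + h <= d - h ->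
  0 <= trapezoid c d h x <= 1.
Proof.
move=> h0 cd; have h20 : 0 < (2 * h)^-1 by rewrite invr_gt0 mulr_gt0.
rewrite /trapezoid pmulr_rge0// ler_pdivrMl ?mulr_gt0// mulr1.
case: (lerP 0 (x - c)) => h1; case: (lerP 0 (x - (c + h))) => h2;
  case: (lerP 0 (x - (d - h))) => h3; case: (lerP 0 (x - d)) => h4;
  rewrite ?(ger0_norm h1) ?(ger0_norm h2) ?(ger0_norm h3) ?(ger0_norm h4)
    ?(ltr0_norm h1) ?(ltr0_norm h2) ?(ltr0_norm h3) ?(ltr0_norm h4);
  apply/andP; split; lra.
Qed.

Lemma trapezoid_out c d h x : 0 < h -> c + h <= d - h ->
  x <= c \/ d <= x -> trapezoid c d h x = 0.
Proof.
move=> h0 cd xcd; rewrite /trapezoid; apply/eqP; rewrite mulf_eq0; apply/orP; right.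
apply/eqP; case: xcd => xcd.
  by rewrite !ler0_norm; lra.
by rewrite !ger0_norm; lra.
Qed.

Lemma trapezoid_in c d h x : 0 < h -> c + h <= x <= d - h ->
  trapezoid c d h x = 1.
Proof.
move=> h0 /andP[cx xd]; rewrite /trapezoid.
have h20 : 2 * h != 0 by rewrite mulf_neq0// gt_eqF.
apply: (mulfI h20); rewrite mulrA divff// mul1r mulr1.
rewrite ger0_norm; last lra.
rewrite ger0_norm; last lra.
rewrite ler0_norm; last lra.
by rewrite ler0_norm; lra.
Qed.

End trapezoid.

(** * The limit relation on open intervals *)

Section jacobi_density.
Variables (R : realType) (mu : probability (measurableTypeR R) R) (M : R).
Hypothesis M_ge2 : 2 <= M.
Let D : set (measurableTypeR R) := `[- M, M].
Notation leb := (@lebesgue_measure R).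

Variables (p : nat -> {poly R}) (b : nat -> R).
Hypothesis p0 : p 0%N = 1.
Hypothesis p1 : 'X * p 0%N = p 1%N + b 1%N *: p 0%N.
Hypothesis pS : forall n, 'X * p n.+1 = p n.+2 + b n.+2 *: p n.+1 + p n.
Hypothesis porth : forall m n, moment mu D (p m * p n) = (m == n)%:R.
Hypothesis b_cvg : b n @[n --> \oo] --> 0.
Hypothesis b_inc : forall n, b n.+1 <= b n.+2.

Let y (x : R) n := x - b n.+1.

Definition turan_limit (x : R) : R := limn (turan (fun n => x - b n.+1)).

Let horner_tri x n : (p n).[x] = tri (y x) n.+1.
Proof.
pose f k := if k is j.+1 then (p j).[x] else 0.
have [] // : f n.+1 = tri (y x) n.+1; apply: tri_unique => //.
  by rewrite /f p0 hornerC.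
case=> [|k]; rewrite /f /y.
  have := congr1 (horner^~ x) p1.
  rewrite p0 !(hornerD, hornerM, hornerZ, hornerX, hornerC) => h; lra.
have := congr1 (horner^~ x) (pS k).
by rewrite !(hornerD, hornerM, hornerZ, hornerX, hornerC) => h; lra.
Qed.

Let horner_turan x n : (turan_poly p b n).[x] = turan (y x) n.+1.
Proof.
rewrite /turan_poly !(hornerD, hornerN, hornerM, hornerX, hornerC, horner_exp).
by rewrite /turan !horner_tri.
Qed.

Let y_dec x n : y x n.+1 <= y x n. Proof. by rewrite /y lerD2l lerN2 b_inc. Qed.

Let y_cvg x : y x n @[n --> \oo] --> x.
Proof.
rewrite -[X in _ --> X]subr0; apply: cvgB; first exact: cvg_cst.
by move: b_cvg; rewrite -cvg_shiftS.
Qed.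

Let y_lt (x : R) : x < 2 -> exists n, y x n < 2.
Proof.
move=> x2; have /cvgr_lt := y_cvg (x := x).
by move=> /(_ _ x2) [n _ /(_ n (leqnn n))] h; exists n.
Qed.

Lemma turan_limitP (x : R) : -2 < x < 2 ->
  0 < turan_limit x /\ turan (fun n => x - b n.+1) n @[n --> \oo] --> turan_limit x.
Proof.
move=> /andP[x1 x2]; have [m ym] := y_lt x2.
have [L L0 tL] := turan_cvg_exists x1 (y_dec x) (@y_cvg x) ym.
by rewrite /turan_limit (cvg_lim _ tL).
Qed.

Let tp_cvg (x : R) : -2 < x < 2 ->
  (turan_poly p b n).[x] @[n --> \oo] --> turan_limit x.
Proof.
move=> x2; have [_] := turan_limitP x2; rewrite -cvg_shiftS.
by rewrite (_ : (fun n => (turan_poly p b n).[x]) = fun n => turan (y x) n.+1) //;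
  apply/funext => n; rewrite horner_turan.
Qed.

(** Since [y x n] increases with [x], an index [m] good for the right end point [d] is good on all
    of [c, d], and [turan_ub] becomes uniform. The 4 bounds [2 - y], as y >= x > -2. *)
Let tp_bounded (c d : R) : -2 < c -> d < 2 -> exists (m : nat) (B : R),
  forall k (x : R), c <= x <= d -> `|(turan_poly p b (k + m)).[x]| <= B.
Proof.
move=> c2 d2; have [m ym] := y_lt d2.
have [B HB] : exists B : R, forall x : R, c <= x <= d -> `|(turan_poly p b m).[x]| <= B.
  pose K := [set` `[c, d]] : set R.
  have KM x : K x -> `|x| <= 2.
    by rewrite /K /= in_itv /= ler_norml => /andP[? ?]; apply/andP; split; lra.
  have [B HB] := horner_bounded KM (turan_poly p b m).
  by exists B => x xcd; apply: HB; rewrite /K /= in_itv.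
exists m, (4 * B / (2 - y d m)) => k x /andP[cx xd].
have x1 : -2 < x by lra.
have x2 : x < 2 by lra.
have ym1 : y x m.+1 <= y d m by rewrite (le_trans (y_dec _ _))// /y lerD2r.
have ym1' : y x m.+1 < 2 by exact: le_lt_trans ym.
have yge n : x <= y x n by exact: (ge_lim (y_dec x) (@y_cvg x)).
have ylt n : (m <= n)%N -> y x n.+1 < 2.
  elim: n => [|n IH]; first by rewrite leqn0 => /eqP m0; move: ym1'; rewrite m0.
  rewrite leq_eqVlt => /predU1P[<-//|] /IH; apply: le_lt_trans.
  exact: y_dec.
have tgt0 n : (m <= n)%N -> 0 < turan (y x) n.+1.
  move=> mn; apply: turan_gt0; first exact: lt_le_trans (yge _).
  exact: ylt.
have := turan_ub (y_dec x) ym1' k.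
have := HB x; rewrite cx xd => /(_ isT); rewrite !horner_turan addnS.
rewrite !gtr0_norm ?tgt0 ?leq_addl// => tB ub.
have d0 : 0 < 2 - y d m by rewrite subr_gt0.
have t0 := tgt0 m (leqnn m); have t1 := tgt0 (k + m)%N (leq_addl _ _).
have ge := yge (k + m).+1.
rewrite ler_pdivlMr//.
have a1 : turan (y x) (k + m).+1 * (2 - y d m) <= turan (y x) (k + m).+1 * (2 - y x m.+1).
  by rewrite ler_pM2l// lerD2l lerN2.
have a2 : turan (y x) m.+1 * (2 - y x (k + m).+1) <= B * 4.
  apply: ler_pM => //; [exact: ltW| |lra].
  by rewrite subr_ge0 ltW// ylt// leq_addl.
by lra.
Qed.

Let mD : measurable D. Proof. exact: measurable_itv. Qed.

Let DM (x : R) : D x -> `|x| <= M.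
Proof. by rewrite /D /= in_itv /= ler_norml. Qed.

Let trapezoid_weak c d h : turan_weak mu M p b (trapezoid c d h).
Proof.
have wd a := turan_weak_dist M_ge2 pS porth b_cvg a.
have wD := @turan_weakD _ mu M p b.
have wZ := @turan_weakZ _ mu M p b.
exact: (wZ _ _ (wD _ _ (wD _ _ (wD _ _ (wd c) (wZ _ _ (wd (c + h))))
  (wZ _ _ (wd (d - h)))) (wd d))).
Qed.

Let Rintegral_support (nu : {measure set (measurableTypeR R) -> \bar R})
    (A B : set R) (f : R -> R) : A `<=` B -> (forall x, ~ A x -> f x = 0) ->
  (\int[nu]_(x in B) f x)%R = (\int[nu]_(x in A) f x)%R.
Proof.
move=> AB fA; rewrite Rintegral_mkcond [RHS]Rintegral_mkcond; congr Rintegral.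
apply/funext => x; rewrite !patchE; case: ifPn => xB; case: ifPn => xA //.
  by rewrite fA// => /mem_set xA'; move: xA; rewrite xA'.
by move: xB; rewrite mem_set//; apply: AB; exact: set_mem.
Qed.

(** Both sides are limits of one sequence: weak convergence gives the right one, bounded convergence
    the left one. The support of the trapezoid confines the integrals to where [tp_bounded] applies,
    and the shift by [m] to the indices where it does. *)
Let trapezoid_integral c d h : -2 < c -> d < 2 -> 0 < h -> c + h <= d - h ->
  (\int[mu]_(x in `]c, d[) (trapezoid c d h x * turan_limit x))%R =
  (\int[leb]_(x in `]c, d[) (trapezoid c d h x * semicircle x))%R.
Proof.
move=> c2 d2 h0 cd.
have [m [B HB]] := tp_bounded c2 d2.
have out x : ~ `]c, d[%classic x -> trapezoid c d h x = 0.
  move=> xcd; apply: trapezoid_out => //.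
  move: xcd; rewrite /= in_itv /= => /negP; rewrite negb_and -!leNgt.
  by move=> /orP[]; [left|right].
have [ct] := trapezoid_weak c d h.
rewrite (@Rintegral_support _ `]c, d[%classic); last 2 first.
- by move=> x /=; rewrite !in_itv /= => /andP[? ?]; apply/andP; split; lra.
- by move=> x /out ->; rewrite mul0r.
rewrite -(@cvg_shiftn m) => hl; apply/esym; apply: (cvg_unique _ hl) => //.
rewrite (_ : [sequence _]_n = fun k => (\int[mu]_(x in `]c, d[)
    (trapezoid c d h x * (turan_poly p b (k + m)%N).[x]))%R); last first.
  apply/funext => k /=; apply: Rintegral_support.
    move=> x /=; rewrite !in_itv /= => /andP[? ?].
    by have M2 := M_ge2; apply/andP; split; lra.
  by move=> x /out ->; rewrite mul0r.
apply: (@bounded_cvg_Rintegral _ _ _ _ _ _ _ _ _ B) => //.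
- by rewrite (le_lt_trans (probability_le1 _ _))// ltry.
- move=> k; apply: measurable_funM; last exact: measurable_poly.
  by apply: measurable_funTS; exact: continuous_measurable_fun.
- move=> k x; rewrite /= in_itv /= => /andP[/ltW cx /ltW xd].
  have /andP[t0 t1] := trapezoid_bound x h0 cd.
  rewrite normrM (ger0_norm t0) -[B]mul1r ler_pM// HB//.
  by rewrite cx xd.
- move=> x; rewrite /= in_itv /= => /andP[cx xd].
  apply: cvgM; first exact: cvg_cst.
  rewrite (_ : (fun n => _) = [sequence (turan_poly p b (k + m)%N).[x]]_k)//.
  rewrite (@cvg_shiftn m _ (fun k => (turan_poly p b k).[x])).
  by apply: tp_cvg; apply/andP; split; lra.
Qed.

Lemma turan_limit_bounded (c d : R) : -2 < c -> d < 2 ->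
  exists B : R, forall x, c <= x <= d -> `|turan_limit x| <= B.
Proof.
move=> c2 d2; have [m [B HB]] := tp_bounded c2 d2.
exists B => x xcd.
have h : (turan_poly p b (k + m)%N).[x] @[k --> \oo] --> turan_limit x.
  rewrite (@cvg_shiftn m _ (fun k => (turan_poly p b k).[x])).
  by apply: tp_cvg; move/andP: xcd => [? ?]; apply/andP; split; lra.
by apply: (cvgn_le (cvg_norm h)) => k; exact: HB.
Qed.

Lemma measurable_turan_limit :
  measurable_fun (`](-2), 2[ : set (measurableTypeR R)) turan_limit.
Proof.
apply: (@measurable_fun_cvg _ _ _ _ (fun n x => (turan_poly p b n).[x])).
  by move=> n; exact: measurable_poly.
by move=> x; rewrite /= in_itv /=; exact: tp_cvg.
Qed.

Lemma turan_limit_itv c d : -2 < c -> c < d -> d < 2 ->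
  (\int[mu]_(x in `]c, d[) turan_limit x)%R =
  (\int[leb]_(x in `]c, d[) semicircle x)%R.
Proof.
move=> c2 cd d2.
(* [n.+2] ensures [2 * h n <= d - c] from the start. *)
pose h n : R := (d - c) / n.+2%:R.
have h0 n : 0 < h n by rewrite divr_gt0// subr_gt0.
have hcd n : c + h n <= d - h n.
  have : h n <= (d - c) / 2.
    by rewrite ler_pM2l ?subr_gt0// lef_pV2 ?posrE// ler_nat.
  by lra.
have hcvg : h n @[n --> \oo] --> 0.
  rewrite -[X in _ --> X](mulr0 (d - c)); apply: cvgM; first exact: cvg_cst.
  by have := @cvg_harmonic R; rewrite -cvg_shiftS.
have tcvg x : c < x < d -> trapezoid c d (h n) x @[n --> \oo] --> (1 : R).
  move=> /andP[cx xd].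
  apply: cvg_near_cst.
  have : 0 < Num.min (x - c) (d - x) by rewrite lt_min !subr_gt0 cx.
  move=> /(cvgr_lt _ hcvg); apply: filterS => n; rewrite lt_min => /andP[h1 h2].
  by apply: trapezoid_in => //; apply/andP; split; lra.
have [B HB] := turan_limit_bounded c2 d2.
have mcd : measurable (`]c, d[%classic : set (measurableTypeR R)) by exact: measurable_itv.
have mt n (E : set (measurableTypeR R)) : measurable_fun E (trapezoid c d (h n)).
  apply: measurable_funTS; apply: continuous_measurable_fun.
  by have [] := trapezoid_weak c d (h n).
have l1 : (\int[mu]_(x in `]c, d[) (trapezoid c d (h n) x * turan_limit x))%R
    @[n --> \oo] --> (\int[mu]_(x in `]c, d[) turan_limit x)%R.
  apply: (@bounded_cvg_Rintegral _ _ _ _ _ _ _ _ _ B) => //.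
  - by rewrite (le_lt_trans (probability_le1 _ _))// ltry.
  - move=> n; apply: measurable_funM => //.
    apply: measurable_funS measurable_turan_limit => //.
    by move=> x /=; rewrite !in_itv /= => /andP[? ?]; apply/andP; split; lra.
  - move=> n x; rewrite /= in_itv /= => /andP[/ltW cx /ltW xd].
    have /andP[t0 t1] := trapezoid_bound x (h0 n) (hcd n).
    by rewrite normrM (ger0_norm t0) -[B]mul1r ler_pM// HB// cx xd.
  - move=> x; rewrite /= in_itv /= => xcd.
    by rewrite -[X in _ --> X]mul1r; apply: cvgM; [exact: tcvg|exact: cvg_cst].
have l2 : (\int[leb]_(x in `]c, d[) (trapezoid c d (h n) x * semicircle x))%R
    @[n --> \oo] --> (\int[leb]_(x in `]c, d[) semicircle x)%R.
  apply: (@bounded_cvg_Rintegral _ _ _ _ _ _ _ _ _ ((2 * pi)^-1 * 2)) => //.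
  - by rewrite /= lebesgue_measure_itv /= lte_fin cd -EFinB ltry.
  - move=> n; apply: measurable_funM => //.
    by apply: measurable_funTS; apply: continuous_measurable_fun;
      exact: semicircle_continuous.
  - move=> n x _.
    have /andP[t0 t1] := trapezoid_bound x (h0 n) (hcd n).
    rewrite normrM (ger0_norm t0) -[_ * 2]mul1r ler_pM//.
    rewrite ger0_norm ?semicircle_ge0// /semicircle mulrC ler_wpM2l//.
      by rewrite invr_ge0 mulr_ge0// pi_ge0.
    rewrite -[leRHS]ger0_norm// -sqrtr_sqr ler_wsqrtr// !expr2.
    by have := sqr_ge0 x; rewrite expr2; lra.
  - move=> x; rewrite /= in_itv /= => xcd.
    by rewrite -[X in _ --> X]mul1r; apply: cvgM; [exact: tcvg|exact: cvg_cst].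
apply: (cvg_unique _ l1) => //.
rewrite (_ : (fun n => _) = fun n =>
  (\int[leb]_(x in `]c, d[) (trapezoid c d (h n) x * semicircle x))%R)//.
by apply/funext => n; rewrite trapezoid_integral.
Qed.

End jacobi_density.

(** * From intervals to Borel sets *)

Section density_from_intervals.
Variables (R : realType) (mu : probability (measurableTypeR R) R) (u v : R).
Notation leb := (@lebesgue_measure R).
Let E : set (measurableTypeR R) := `]u, v[.
Variables (t rho : R -> R).
Hypothesis uv : u < v.
Hypothesis mt : measurable_fun E t.
Hypothesis t_gt0 : forall x, u < x < v -> 0 < t x.
Hypothesis t_bounded : forall c d, u < c -> d < v ->
  exists B : R, forall x, c <= x <= d -> `|t x| <= B.
Hypothesis rho_cont : continuous rho.
Hypothesis rho_ge0 : forall x, 0 <= rho x.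
Hypothesis t_rho : forall c d, u < c -> c < d -> d < v ->
  (\int[mu]_(x in `]c, d[) t x)%R = (\int[leb]_(x in `]c, d[) rho x)%R.

Let mE : measurable E. Proof. exact: measurable_itv. Qed.

Let EP x : E x = (u < x < v) :> Prop.
Proof. by rewrite /E /= in_itv. Qed.

Let tE x := (t \_ E) x.
Let rE x := (rho \_ E) x.

Let tE_ge0 x : 0 <= tE x.
Proof.
rewrite /tE patchE; case: ifPn => // /set_mem; rewrite EP => xE.
by rewrite ltW// t_gt0.
Qed.

Let rE_ge0 x : 0 <= rE x.
Proof. by rewrite /rE patchE; case: ifPn. Qed.

Let mtE : measurable_fun [set: measurableTypeR R] tE.
Proof. exact/(measurable_restrictT _ mE). Qed.

Let mrE : measurable_fun [set: measurableTypeR R] rE.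
Proof.
apply/(measurable_restrictT _ mE).
by apply: measurable_funTS; exact: continuous_measurable_fun.
Qed.

(** [m1] is [t dmu] and [m2] is [rho dx], both extended by zero outside [E] so that a uniqueness
    theorem on the whole line applies. *)
Let m1 : {measure set (measurableTypeR R) -> \bar R} :=
  density_measure mu tE_ge0 mtE.
Let m2 : {measure set (measurableTypeR R) -> \bar R} :=
  density_measure leb rE_ge0 mrE.

Let m12_itv c d : u < c -> d < v -> m1 `]c, d[%classic = m2 `]c, d[%classic.
Proof.
move=> uc dv; have [cd|dc] := ltP c d; last first.
  by rewrite set_itv_ge ?measure0// bnd_simp -leNgt.
have sub x : `]c, d[%classic x -> x \in E.
  rewrite /= in_itv /= => /andP[? ?]; apply/mem_set; rewrite EP.
  by apply/andP; split; lra.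
transitivity (\int[mu]_(x in `]c, d[) (t x)%:E)%E.
  by apply: eq_integral => x; rewrite inE => /sub xE; rewrite /tE patchE xE.
transitivity (\int[leb]_(x in `]c, d[) (rho x)%:E)%E; last first.
  by apply: eq_integral => x; rewrite inE => /sub xE; rewrite /rE patchE xE.
(* [t_rho] compares real integrals, so both extended ones must be finite for it to determine
   them. *)
have f1 : (\int[mu]_(x in `]c, d[) (t x)%:E)%E \is a fin_num.
  have [B HB] := t_bounded uc dv.
  apply: integrable_fin_num; first exact: measurable_itv.
  apply: (@bounded_integrable _ _ _ _ _ _ _ _ B).
  - exact: measurable_itv.
  - by rewrite (le_lt_trans (probability_le1 _ _))// ltry.
  - by apply: measurable_funS mt => // x /sub /set_mem.
  - by move=> x; rewrite /= in_itv /= => /andP[/ltW cx /ltW xd]; rewrite HB// cx xd.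
have f2 : (\int[leb]_(x in `]c, d[) (rho x)%:E)%E \is a fin_num.
  apply: integrable_fin_num => //.
  apply: (@integrableS _ _ _ leb `[c, d]%classic `]c, d[%classic) => //.
    by apply: subset_itv; rewrite bnd_simp.
  by apply: continuous_itv_integrable; exact: continuous_subspaceT.
by rewrite -(fineK f1) -(fineK f2); congr EFin; exact: t_rho.
Qed.

Let m_restrict (m : {measure set (measurableTypeR R) -> \bar R}) (f : R -> R)
    (f0 : forall x, 0 <= f x) mf A : (forall x, ~ E x -> f x = 0) ->
  measurable A -> density_measure m f0 mf A = density_measure m f0 mf (A `&` E).
Proof.
move=> fE mA; rewrite /density_measure integral_mkcond [RHS]integral_mkcond.
apply: eq_integral => x _; rewrite !patchE in_setI.
case: (x \in A) => //=; case: ifPn => // xE; rewrite fE//.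
by move/mem_set; rewrite (negbTE xE).
Qed.

(** [t] may be unbounded near the ends of [E], so the part of the interval in [E] is exhausted from
    inside by the [F n], which may be empty for small [n]. *)
Let m12_all c d : m1 `]c, d[%classic = m2 `]c, d[%classic.
Proof.
have zE f x : ~ E x -> (f \_ E) x = 0 :> R.
  by move=> xE; rewrite patchE memNset.
have -> : m1 `]c, d[%classic = m1 (`]c, d[%classic `&` E).
  by apply: m_restrict; [exact: zE|exact: measurable_itv].
have -> : m2 `]c, d[%classic = m2 (`]c, d[%classic `&` E).
  by apply: m_restrict; [exact: zE|exact: measurable_itv].
pose e n : R := n.+1%:R^-1.
pose F n : set (measurableTypeR R) :=
  `](Num.max c (u + e n)), (Num.min d (v - e n))[%classic.
have mF n : measurable (F n) by exact: measurable_itv.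
have e0 n : 0 < e n by rewrite invr_gt0.
have FE : `]c, d[%classic `&` E = \bigcup_n F n.
  apply/seteqP; split => x /=.
    rewrite /E /= !in_itv /= => -[/andP[cx xd] /andP[ux xv]].
    have : 0 < Num.min (x - u) (v - x) by rewrite lt_min !subr_gt0 ux.
    move=> /(cvgr_lt _ (@cvg_harmonic R)) [n _ /(_ n (leqnn n))].
    rewrite lt_min => /andP[h1 h2].
    exists n => //; rewrite /F /= in_itv /= gt_max lt_min cx xd /=.
    by move: h1 h2; rewrite /harmonic /= -/(e n) => h1 h2; apply/andP; split; lra.
  move=> [n _]; rewrite /F /E /= !in_itv /= gt_max lt_min.
  move=> /andP[/andP[cx ux] /andP[xd xv]]; rewrite cx xd; split => //.
  by have := e0 n; move=> ?; apply/andP; split; lra.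
have ndF : {homo F : n m / (n <= m)%N >-> (n <= m)%O}.
  move=> n m nm; apply/subsetPset => x; rewrite /F /= !in_itv /= !gt_max !lt_min.
  move=> /andP[/andP[cx ux] /andP[xd xv]]; rewrite cx xd /=.
  have : e m <= e n by rewrite /e lef_pV2 ?posrE// ler_nat.
  by move=> ?; apply/andP; split; lra.
have mUF : measurable (\bigcup_n F n) by exact: bigcupT_measurable.
have c1 := @nondecreasing_cvg_mu _ _ _ m1 F mF mUF ndF.
have c2 := @nondecreasing_cvg_mu _ _ _ m2 F mF mUF ndF.
rewrite FE; apply: (cvg_unique _ c1) => //.
rewrite (_ : m1 \o F = m2 \o F)//; apply/funext => n /=; apply: m12_itv.
  by rewrite lt_max ltrDl e0 orbT.
by rewrite gt_min ltrBlDr ltrDl e0 orbT.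
Qed.

(** Open intervals form a generating family stable under intersection. The finiteness of [m1] on the
    covering intervals is read off [m2], as [rho] is integrable on [u, v]. *)
Let m12 A : measurable (A : set (measurableTypeR R)) -> m1 A = m2 A.
Proof.
move=> mA; pose g n : set (measurableTypeR R) := `](- n%:R), n%:R[%classic.
apply: (@measure_unique _ _ (measurableTypeR R) (@RGenOpens.G R) g _ _ _ _ m1 m2) => //.
- exact: RGenOpens.measurableE.
- move=> _ _ [x1 [y1 ->]] [x2 [y2 ->]].
  exists (Num.max x1 x2), (Num.min y1 y2).
  apply/seteqP; split => z /=; rewrite !in_itv /= gt_max lt_min.
    by move=> [/andP[-> ->] /andP[-> ->]].
  by move=> /andP[/andP[-> ->] /andP[-> ->]].
- by move=> n; exists (- n%:R), n%:R.
- apply/seteqP; split => // z _; exists (Num.truncn `|z|).+1 => //.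
  by rewrite /g /= in_itv /= -ltr_norml; exact: truncnS_gt.
- by move=> _ [x [y ->]]; exact: m12_all.
- move=> n; rewrite /g m12_all.
  apply: (@le_lt_trans _ _ (\int[leb]_(x in `[u, v]) (rho x)%:E)%E).
    rewrite (_ : m2 _ = (\int[leb]_(x in g n) (rE x)%:E)%E)//.
    rewrite integral_mkcond [leRHS]integral_mkcond.
    apply: ge0_le_integral => //.
    + by move=> x _; rewrite patchE; case: ifPn => // _; rewrite lee_fin.
    + apply/(measurable_restrictT _ (measurable_itv _)); apply/measurable_EFinP.
      exact: measurable_funTS.
    + apply/(measurable_restrictT _ (measurable_itv _)); apply/measurable_EFinP.
      apply: measurable_funTS; exact: continuous_measurable_fun.
    + move=> x _; rewrite !patchE /rE.
      case: ifPn => _; case: ifPn => xuv //; rewrite ?lee_fin//.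
        by rewrite patchE; case: ifPn.
      rewrite patchE; case: ifPn => // /set_mem xE; move: xuv => /negP[].
      by apply/mem_set; move: xE; rewrite EP /= in_itv /= => /andP[/ltW -> /ltW ->].
  have ir : leb.-integrable `[u, v] (EFin \o rho).
    by apply: continuous_itv_integrable; exact: continuous_subspaceT.
  have : (\int[leb]_(x in `[u, v]) (rho x)%:E)%E \is a fin_num.
    by apply: integrable_fin_num.
  by rewrite ltey_eq => ->.
Qed.

(** As [t > 0] on [E], [mu A] is the integral of 1/t over [A] against [m1]; replacing [m1] by [m2]
    gives the integral of rho/t. *)
Lemma has_density_from_itv : has_density_on mu E (fun x => rho x / t x).
Proof.
have mV : measurable_fun E (fun x => (t x)^-1).
  (* Inversion agrees with the measurable map [powR] of exponent -1 because [t] is positive on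
     [E]. *)
  apply: (@eq_measurable_fun _ _ _ _ _ (fun x => t x `^ (-1))).
    move=> x /set_mem; rewrite EP => xE.
    by rewrite powRN powRr1// ltW// t_gt0.
  exact: (@measurableT_comp _ _ _ _ _ _ (@powR R ^~ (-1))).
split.
- apply: measurable_funM => //.
  by apply: measurable_funTS; exact: continuous_measurable_fun.
- by move=> x; rewrite EP => xE; rewrite divr_ge0// ltW// t_gt0.
move=> A mA AE.
pose h x := (((fun x => (t x)^-1) \_ A) x)%:E.
have h0 x : (0 <= h x)%E.
  rewrite /h patchE; case: ifPn => // /set_mem /AE; rewrite EP => xE.
  by rewrite lee_fin invr_ge0 ltW// t_gt0.
have mh : measurable_fun [set: measurableTypeR R] h.
  apply/measurable_EFinP/(measurable_restrictT _ mA).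
  exact: measurable_funS mV.
transitivity (\int[m1]_x h x)%E.
  rewrite integral_density_measure// -[mu A]mul1e -integral_cst//.
  rewrite integral_mkcond; apply: eq_integral => x _.
  rewrite /h /tE !patchE; case: ifPn => [/set_mem xA|]; last by rewrite mul0e.
  have xE := AE _ xA; have tx : t x != 0 by rewrite gt_eqF// t_gt0.
  by rewrite mem_set// -EFinM mulVf.
rewrite (@eq_measure_integral _ _ _ _ m2); last by move=> B mB _; exact: m12.
rewrite integral_density_measure// [RHS]integral_mkcond; apply: eq_integral => x _.
rewrite /h /rE !patchE; case: ifPn => [/set_mem xA|]; last by rewrite mul0e.
by rewrite (mem_set (AE _ xA)) -EFinM mulrC.
Qed.

End density_from_intervals.

Section spectral_density.
Variables (R : realType) (mu : probability (measurableTypeR R) R).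
Notation leb := (@lebesgue_measure R).

Lemma compactly_supported_itv : compactly_supported mu ->
  exists2 M : R, 2 <= M & mu (~` `[- M, M]%classic) = 0%E.
Proof.
move=> [K [cK muK]]; have [B [_ KB]] := compact_bounded cK.
pose M := Num.max 2 (B + 1); exists M; first by rewrite le_max lexx.
have mK : measurable (K : set (measurableTypeR R)).
  by apply: closed_measurable; exact: compact_closed.
have mM : measurable (`[- M, M]%classic : set (measurableTypeR R)).
  exact: measurable_itv.
have mKC := measurableC mK; have mMC := measurableC mM.
apply/eqP; rewrite eq_le measure_ge0 andbT -muK.
apply: le_measure; rewrite ?inE//.
apply: subsetC => x Kx; rewrite /= in_itv /= -ler_norml.
by rewrite /M le_max (KB (B + 1)) ?orbT// ltrDl.
Qed.

Lemma integral_supp (D : set (measurableTypeR R)) (f : R -> R) :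
  measurable D -> mu (~` D) = 0%E ->
  measurable_fun [set: measurableTypeR R] f ->
  (\int[mu]_x (f x)%:E = \int[mu]_(x in D) (f x)%:E)%E.
Proof.
move=> mD muD mf; rewrite [RHS]integral_mkcond.
apply: ae_eq_integral => //.
- exact/measurable_EFinP.
- apply/(measurable_restrictT _ mD); apply: measurable_funTS.
  exact/measurable_EFinP.
exists (~` D); split => //; first exact: measurableC.
move=> x /= fx Dx; apply: fx => _; by rewrite patchE mem_set.
Qed.

Lemma spectral_density (b : nat -> R) :
  spectral_measure (fun _ => 1) b mu -> b n @[n --> \oo] --> 0 ->
  (forall n, b n.+1 <= b n.+2) ->
  has_density_on mu `]-2, 2[ (fun x => semicircle x / turan_limit b x).
Proof.
move=> [supp [p [[_ orth] [p0 rec]]]] b_cvg b_inc.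
have [M M2 muM] := compactly_supported_itv supp.
have p1 : 'X * p 0%N = p 1%N + b 1%N *: p 0%N.
  by rewrite rec scale1r scaler0 addr0.
have pS n : 'X * p n.+1 = p n.+2 + b n.+2 *: p n.+1 + p n.
  by rewrite rec !scale1r.
have porth m n : moment mu `[- M, M]%classic (p m * p n) = (m == n)%:R.
  rewrite /moment /Rintegral
    -(@integral_supp `[- M, M]%classic (horner (p m * p n)) (measurable_itv _) muM);
    last exact: measurable_poly.
  have := orth m n; under eq_integral do rewrite -hornerM.
  by move=> ->.
apply: has_density_from_itv => //.
- exact: (measurable_turan_limit p0 p1 pS b_cvg b_inc).
- move=> x x2; by have [] := turan_limitP b_cvg b_inc x2.
- by move=> c d; exact: (turan_limit_bounded p0 p1 pS b_cvg b_inc).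
- exact: semicircle_continuous.
- exact: semicircle_ge0.
- by move=> c d; exact: (turan_limit_itv M2 p0 p1 pS porth b_cvg b_inc).
Qed.

End spectral_density.

(** * Euler integrals *)

Section half_line_integrals.
Variable R : realType.
Notation leb := (@lebesgue_measure R).
Notation pos := (`]0%R, +oo[%classic : set R).

Lemma posP (x : R) : pos x = (0 < x) :> Prop.
Proof. by rewrite /= in_itv /= andbT. Qed.

(** The half-line is exhausted by [1/(n+2), n+2], a nondegenerate interval already for [n = 0]. *)
Let e (n : nat) : R := n.+2%:R^-1.
Let e_gt0 n : 0 < e n. Proof. by rewrite invr_gt0. Qed.
Let e_lt n : e n < n.+2%:R.
Proof. by rewrite (@lt_trans _ _ 1)// ?invf_lt1// ltr1n. Qed.

Lemma pos_bigcup : pos = \bigcup_n `[e n, n.+2%:R]%classic.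
Proof.
apply/seteqP; split => x; rewrite posP.
  move=> x0; exists (Num.truncn x + Num.truncn x^-1)%N => //.
  rewrite /= in_itv /=; apply/andP; split.
    rewrite /e -[leRHS]invrK lef_pV2 ?posrE ?invr_gt0// ltW//.
    by rewrite (lt_le_trans (truncnS_gt _))// ler_nat ltnS leqW// leq_addl.
  by rewrite ltW// (lt_le_trans (truncnS_gt _))// ler_nat ltnS leqW// leq_addr.
by move=> [n _]; rewrite /= in_itv /= => /andP[h _]; rewrite (lt_le_trans _ h).
Qed.

Lemma nd_pos_itv :
  {homo (fun n => `[e n, n.+2%:R]%classic) : n m / (n <= m)%N >-> (n <= m)%O}.
Proof.
move=> n m nm; apply/subsetPset => x; rewrite /= !in_itv /= => /andP[h1 h2].
apply/andP; split; last by rewrite (le_trans h2)// ler_nat; lia.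
by rewrite (le_trans _ h1)// lef_pV2 ?posrE// ler_nat; lia.
Qed.

Section change_of_variables.
Variables (F f : R -> R).
Hypothesis dF : forall v : R, 0 < v -> is_derive v 1 F (f v).
Hypothesis cf : forall v : R, 0 < v -> {for v, continuous f}.

Let F'E (v : R) : 0 < v -> derive1 F v = f v.
Proof. by move=> v0; rewrite derive1E; have := dF v0; case. Qed.

Let cF (v : R) : 0 < v -> {for v, continuous F}.
Proof.
move=> v0; apply/differentiable_continuous/derivable1_diffP.
by have := dF v0; case.
Qed.

Let nearF' (v : R) : 0 < v -> \forall x \near v, derive1 F x = f x.
Proof.
by move=> v0; near=> x; apply: F'E; near: x; exact: lt_nbhsr.
Unshelve. all: by end_near. Qed.

Let cF' (v : R) : 0 < v -> {for v, continuous (derive1 F)}.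
Proof.
move=> v0; rewrite /prop_for /continuous_at F'E//.
by apply: cvg_trans (cf v0); apply: near_eq_cvg; apply: filterS (nearF' v0) => x ->.
Qed.

Let dFab (a b : R) : 0 < a -> a < b -> derivable_oo_LRcontinuous F a b.
Proof.
move=> a0 ab; split.
- move=> x; rewrite in_itv /= => /andP[ax _].
  by have := dF (lt_trans a0 ax); case.
- by apply: cvg_at_right_filter; exact: cF.
- by apply: cvg_at_left_filter; apply: cF; exact: lt_trans ab.
Qed.

(** On each compact interval the fundamental theorem bounds the integral by an increment of [F], at
    most [M]; monotone convergence does the rest. *)
Lemma integral_derive_le (g : R -> R) (M : R) :
  measurable_fun (pos : set (measurableTypeR R)) g ->
  (forall v : R, 0 < v -> 0 <= g v <= f v) ->
  (forall v : R, 0 < v -> 0 <= F v <= M) ->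
  (\int[leb]_(x in pos) (g x)%:E <= M%:E)%E.
Proof.
move=> mg gf FM; rewrite pos_bigcup.
have mi n : measurable (`[e n, n.+2%:R]%classic : set (measurableTypeR R)).
  exact: measurable_itv.
have pI n x : `[e n, n.+2%:R]%classic x -> 0 < x.
  by rewrite /= in_itv /= => /andP[h _]; rewrite (lt_le_trans _ h).
have mgn n : measurable_fun (`[e n, n.+2%:R]%classic : set (measurableTypeR R)) g.
  by apply: measurable_funS mg => // x /pI; rewrite posP.
have g0 n x : `[e n, n.+2%:R]%classic x -> (0 <= (EFin \o g) x)%E.
  by move=> /pI x0; rewrite lee_fin; have /andP[] := gf _ x0.
have h := @ge0_nondecreasing_set_cvg_integral _ (measurableTypeR R) _ _
  (EFin \o g) leb nd_pos_itv mi (fun n => (measurable_EFinP _ _).2 (mgn n)) g0.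
rewrite -(cvg_lim _ h)//; apply: lime_le; first by apply/cvg_ex; eexists; exact: h.
apply: nearW => n.
have fc : {within `[e n, n.+2%:R], continuous f}.
  apply: continuous_in_subspaceT => x /set_mem /pI x0; exact: cf.
apply: (@le_trans _ _ (\int[leb]_(x in `[e n, n.+2%:R]) (f x)%:E)%E).
  apply: ge0_le_integral => //.
  - by move=> x /pI x0 /=; rewrite lee_fin; have /andP[] := gf _ x0.
  - exact/measurable_EFinP.
  - by apply/measurable_EFinP; exact: (subspace_continuous_measurable_fun (mi n) fc).
  - by move=> x /pI x0; rewrite lee_fin; have /andP[] := gf _ x0.
rewrite (continuous_FTC2 (e_lt n) fc (dFab (e_gt0 n) (e_lt n))); last first.
  move=> x; rewrite in_itv /= => /andP[h1 _].
  exact/F'E/(lt_trans (e_gt0 n)).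
rewrite -EFinB lee_fin.
have /andP[_ h1] : 0 <= F n.+2%:R <= M by exact: FM.
by have /andP[h2 _] := FM _ (e_gt0 n); lra.
Qed.

(** Substitution on compact intervals followed by monotone convergence on both sides: [G] being
    nonnegative, the identity holds in the extended reals and presupposes no integrability. *)
Lemma integral_subst_decr (G : R -> R) (E : set R) :
  (forall v : R, 0 < v -> f v < 0) ->
  F @` pos = E -> is_interval E ->
  (forall x, E x -> {for x, continuous G}) -> (forall x, E x -> 0 <= G x) ->
  (\int[leb]_(x in E) (G x)%:E = \int[leb]_(v in pos) (G (F v) * - f v)%:E)%E.
Proof.
move=> f0 FE iE cG G0.
have EF v : 0 < v -> E (F v) by move=> v0; rewrite -FE; exists v; rewrite ?posP.
have Fdecr a b : 0 < a -> a < b -> F b < F a.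
  move=> a0 ab; have [dab _ _] := dFab a0 ab.
  apply: (@ltr0_derive1_decr _ F a b) => //.
  - move=> x; rewrite in_itv /= => /andP[ax _].
    by rewrite F'E ?f0// (lt_trans a0).
  - by apply: derivable_oo_LRcontinuous_within; exact: dFab.
have pI n x : `[e n, n.+2%:R]%classic x -> 0 < x.
  by rewrite /= in_itv /= => /andP[h _]; rewrite (lt_le_trans _ h).
pose I n := `[F n.+2%:R, F (e n)]%classic : set R.
have IE n x : I n x -> E x.
  rewrite /I /= in_itv /= => h.
  by apply: (iE (F n.+2%:R) (F (e n)) _ _ x h); exact: EF.
have EI : E = \bigcup_n I n.
  apply/seteqP; split => x; last by move=> [n _] /IE.
  rewrite -FE pos_bigcup => -[v [n _ vn] <-]; exists n => //.
  have v0 := pI _ _ vn; move: vn; rewrite /I /= !in_itv /= => /andP[].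
  rewrite le_eqVlt => /predU1P[->|h1]; rewrite le_eqVlt => /predU1P[->|h2];
    rewrite ?lexx ?andbT ?ltW// ?Fdecr//.
have ndI : {homo I : n m / (n <= m)%N >-> (n <= m)%O}.
  have Fle a b : 0 < a -> a <= b -> F b <= F a.
    by move=> a0; rewrite le_eqVlt => /predU1P[->//|/(Fdecr _ _ a0)/ltW].
  move=> n m nm; apply/subsetPset => x; rewrite /I /= !in_itv /= => /andP[h1 h2].
  apply/andP; split.
    by rewrite (le_trans _ h1)// Fle// ler_nat; lia.
  by rewrite (le_trans h2)// Fle// lef_pV2 ?posrE// ler_nat; lia.
have mI n : measurable (I n : set (measurableTypeR R)) by exact: measurable_itv.
have mi n : measurable (`[e n, n.+2%:R]%classic : set (measurableTypeR R)).
  exact: measurable_itv.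
have cGI n : {within `[F n.+2%:R, F (e n)], continuous G}.
  by apply: continuous_in_subspaceT => x /set_mem /IE; exact: cG.
have mG n : measurable_fun (I n : set (measurableTypeR R)) (EFin \o G).
  by apply/measurable_EFinP; exact: (subspace_continuous_measurable_fun (mI n) (cGI n)).
have mH n : measurable_fun (`[e n, n.+2%:R]%classic : set (measurableTypeR R))
    (EFin \o (fun v => G (F v) * - f v)).
  apply/measurable_EFinP; apply: (subspace_continuous_measurable_fun (mi n)).
  apply: continuous_in_subspaceT => v /set_mem /pI v0.
  apply: cvgM; last by apply: cvgN; exact: cf.
  by apply: continuous_comp; [exact: cF|apply: cG; exact: EF].
have GI n x : I n x -> (0 <= (EFin \o G) x)%E.
  by move=> /IE xE; rewrite lee_fin G0.
have HI n v : `[e n, n.+2%:R]%classic v -> (0 <= (EFin \o (fun v => (G (F v) * - f v)%R)) v)%E.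
  move=> /pI v0; rewrite lee_fin mulr_ge0 ?G0//; first exact: EF.
  by rewrite oppr_ge0 ltW// f0.
have l1 := @ge0_nondecreasing_set_cvg_integral _ (measurableTypeR R) _ I
  (EFin \o G) leb ndI mI mG GI.
have l2 := @ge0_nondecreasing_set_cvg_integral _ (measurableTypeR R) _ _
  (EFin \o (fun v => G (F v) * - f v)) leb nd_pos_itv mi mH HI.
rewrite -EI in l1; rewrite -pos_bigcup in l2.
suff eqn n : (\int[leb]_(x in I n) (EFin \o G) x =
    \int[leb]_(v in `[e n, n.+2%:R]) (EFin \o (fun v => (G (F v) * - f v)%R)) v)%E.
  by move: l1; rewrite (funext eqn) => {}l1; exact: (cvg_unique _ l1 l2).
rewrite /I /=.
rewrite (@integration_by_substitution_decreasing _ F G _ _ (ltW (e_lt n)))//.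
- by apply: eq_integral => v /set_mem /pI v0; rewrite /= -(F'E v0).
- by move=> x z _ /pI z0 xz; exact: Fdecr.
- by move=> x; rewrite in_itv /= => /andP[h _]; apply: cF'; exact: lt_trans h.
- apply/cvg_ex; eexists; apply: cvg_at_right_filter; exact: cF'.
- apply/cvg_ex; eexists; apply: cvg_at_left_filter; exact: cF'.
- by apply: dFab.
Qed.

End change_of_variables.

End half_line_integrals.

Section euler_integrals.
Variable R : realType.
Notation leb := (@lebesgue_measure R).
Notation pos := (`]0%R, +oo[%classic : set R).

(** The rate [k] serves the double integral behind the beta function, whose inner integrals have
    varying rates. *)
Definition gamma_int (s k : R) : \bar R :=
  (\int[leb]_(t in pos) (t `^ (s - 1) * expR (- (k * t)))%:E)%E.

Lemma continuous_powR (r x : R) : 0 < x ->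
  {for x, continuous (fun t : R => t `^ r)}.
Proof.
move=> x0; apply/differentiable_continuous/derivable1_diffP.
by have := @is_derive1_powR R r x x0; case.
Qed.

Lemma measurable_gamma_fun (s k : R) (D : set (measurableTypeR R)) :
  measurable_fun D (fun t : R => t `^ (s - 1) * expR (- (k * t))).
Proof.
apply: measurable_funTS; apply: measurable_funM; first exact: measurable_powR.
by apply: measurableT_comp => //; apply: measurableT_comp.
Qed.

Lemma gamma_int_ge0 s k : (0 <= gamma_int s k)%E.
Proof.
by apply: integral_ge0 => t _; rewrite lee_fin mulr_ge0 ?powR_ge0 ?expR_ge0.
Qed.

(** For t > 1 and an integer m >= s the square is at most 4 t^(2m), and the exponential series gives
    t^(2m) <= (2m)! e^t. *)
Lemma sqr_powR_le_expR (s : R) : 0 < s ->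
  exists2 K : R, 0 < K & forall t, 0 < t -> (1 + t `^ s) ^+ 2 <= K * expR t.
Proof.
move=> s0; pose m := (Num.truncn s).+1.
have sm : s <= m%:R by rewrite ltW// truncnS_gt.
exists (4 * (m.*2)`!%:R); first by rewrite mulr_gt0// ltr0n fact_gt0.
move=> t t0.
have [t1|t1] := leP t 1.
  have e1 : 1 `^ s = 1 :> R by rewrite powR1.
  have h : t `^ s <= 1 by rewrite -[leRHS]e1 ge0_ler_powR// ?nnegrE// ltW.
  have h0 : 0 <= t `^ s by exact: powR_ge0.
  apply: (@le_trans _ _ 4); first by rewrite expr2; nra.
  rewrite -mulrA ler_peMr//; apply: mulr_ege1; first by rewrite ler1n fact_gt0.
  by rewrite -[leLHS]expR0 ler_expR ltW.
have h : t `^ s <= t ^+ m.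
  by rewrite -powR_mulrn ?(ltW t0)// ler_powR// ltW.
have h1 : 1 <= t ^+ m by rewrite exprn_ege1// ltW.
have h2 : t ^+ m.*2 <= (m.*2)`!%:R * expR t.
  have := expR_ge1Dxn (m.*2).-1 (ltW t0); rewrite prednK// => h2.
  rewrite [leRHS]mulrC -ler_pdivrMr ?ltr0n ?fact_gt0//; apply: le_trans h2.
  by rewrite lerDr.
apply: (@le_trans _ _ (4 * t ^+ m.*2)); last by rewrite -mulrA ler_pM2l.
rewrite -muln2 exprM; have h0 : 0 <= t `^ s by exact: powR_ge0.
by move: h h1 h0; set a := t `^ s; set b := t ^+ m; rewrite !expr2; nra.
Qed.

(** The integrand lies below K t^(s-1) / (1 + t^s)^2, whose primitive [F] is bounded on the whole
    half-line; the single comparison covers both the singularity at 0 and the tail. *)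
Lemma gamma_int_lty s : 0 < s -> (gamma_int s 1 < +oo)%E.
Proof.
move=> s0; have [K K0 HK] := sqr_powR_le_expR s0.
have u0 (t : R) : 0 < 1 + t `^ s by rewrite ltr_pwDl// powR_ge0.
pose F (t : R) := K / s * (1 - (1 + t `^ s)^-1).
pose f (t : R) := K * (t `^ (s - 1) * (1 + t `^ s) ^- 2).
apply: (@le_lt_trans _ _ (K / s)%:E); last exact: ltry.
apply: (@integral_derive_le _ F f).
- move=> v v0; have dp := @is_derive1_powR R s v v0.
  have du : is_derive v 1 (fun t : R => 1 + t `^ s) (0 + s * v `^ (s - 1)).
    by apply: is_deriveD.
  have dV : is_derive v 1 (fun t : R => (1 + t `^ s)^-1)
     (- (1 + v `^ s) ^- 2 *: (0 + s * v `^ (s - 1))).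
    by apply: is_deriveV; rewrite ?gt_eqF.
  have dB : is_derive v 1 (fun t : R => 1 - (1 + t `^ s)^-1)
      (0 - (- (1 + v `^ s) ^- 2 *: (0 + s * v `^ (s - 1)))).
    by apply: is_deriveB.
  apply: is_derive_eq (is_derive_mull (K / s) dB) _.
  rewrite /f /GRing.scale /= !add0r mulNr opprK.
  move: (v `^ (s - 1)) (_ ^- 2) => x y; field; exact: lt0r_neq0.
- move=> v v0; have cp r := @continuous_powR r v v0.
  apply: cvgM; first exact: cvg_cst.
  apply: cvgM; first exact: cp.
  apply: cvgV; first by rewrite expf_neq0// gt_eqF.
  apply: (@continuous_comp _ _ _ (fun t : R => 1 + t `^ s) (fun u => u ^+ 2)).
    by apply: cvgD; [exact: cvg_cst|exact: cp].
  exact: exprn_continuous.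
- exact: measurable_gamma_fun.
- move=> t t0; rewrite mulr_ge0 ?powR_ge0 ?expR_ge0//= /f mulrCA ler_wpM2l ?powR_ge0//.
  rewrite mul1r expRN -[K * _]invrK lef_pV2 ?posrE ?expR_gt0//.
    by rewrite invfM invrK mulrC ler_pdivrMr// mulrC HK.
  by rewrite invr_gt0 mulr_gt0// invr_gt0 exprn_gt0.
- move=> t t0; have Ks : 0 <= K / s by rewrite divr_ge0 ?ltW.
  have u1 : (1 + t `^ s)^-1 <= 1.
    by rewrite invf_le1// lerDl powR_ge0.
  have u2 : 0 < (1 + t `^ s)^-1 by rewrite invr_gt0.
  rewrite mulr_ge0 ?subr_ge0//= ler_piMr//; lra.
Qed.

Lemma gamma_int_gt0 s : 0 < s -> (0 < gamma_int s 1)%E.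
Proof.
move=> s0.
(* A lower bound for the integrand on [1, 2]: the power is monotone, so its minimum is at an end
   point, which one depending on the sign of [s - 1]. *)
pose k : R := Num.min 1 (2 `^ (s - 1)) * expR (-2).
have k0 : 0 < k by rewrite mulr_gt0 ?expR_gt0// lt_min ltr01 powR_gt0.
apply: (@lt_le_trans _ _ (\int[leb]_(t in `[1%R, 2%R]) (cst k%:E t))%E).
  rewrite integral_cst//= lebesgue_measure_itv/= lte_fin ltr1n/= -EFinB -EFinM lte_fin.
  by rewrite mulr_gt0//; lra.
have sub : `[1%R, 2%R]%classic `<=` pos.
  by move=> x; rewrite posP /= in_itv /= => /andP[x1 _]; rewrite (lt_le_trans ltr01).
apply: (@le_trans _ _ (\int[leb]_(t in `[1%R, 2%R]) (t `^ (s - 1) * expR (- (1 * t)))%:E)%E).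
  apply: ge0_le_integral => //.
  - by move=> t _ /=; rewrite lee_fin ltW.
  - by apply/measurable_EFinP; exact: measurable_gamma_fun.
  - move=> t; rewrite /= in_itv /= => /andP[t1 t2]; rewrite lee_fin ler_pM//.
    + rewrite ge_min; have [s1|s1] := leP 1 s.
        have e1 : 1 `^ (s - 1) = 1 :> R by rewrite powR1.
        by rewrite -[X in X <= _]e1 ge0_ler_powR ?nnegrE ?subr_ge0//; lra.
      apply/orP; right; rewrite !powR_expR; [|lra|lra].
      rewrite ler_expR -subr_ge0 -mulrBr nmulr_rge0 ?subr_lt0//.
      by rewrite subr_le0 ler_ln ?posrE//; lra.
    + by rewrite ler_expR; lra.
apply: ge0_subset_integral => //.
- by apply/measurable_EFinP; exact: measurable_gamma_fun.
- by move=> t _; rewrite lee_fin mulr_ge0 ?powR_ge0 ?expR_ge0.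
Qed.

Lemma gamma_intE s : 0 < s -> gamma_int s 1 = (Gamma s)%:E.
Proof.
move=> s0; rewrite /Gamma /Rintegral.
have -> : (\int[leb]_(t in pos) (t `^ (s - 1) * expR (- t))%:E = gamma_int s 1)%E.
  by apply: eq_integral => t _; rewrite mul1r.
have fin : gamma_int s 1 \is a fin_num.
  by rewrite ge0_fin_numE; [exact: gamma_int_lty|exact: gamma_int_ge0].
by rewrite fineK.
Qed.

Lemma Gamma_gt0 (s : R) : 0 < s -> 0 < Gamma s.
Proof. by move=> s0; rewrite -lte_fin -gamma_intE// gamma_int_gt0. Qed.

(* Both sides are pulled back along v |-> 1 / (k v), resp. v |-> 1 / v. *)
Lemma gamma_int_scale s k : 0 < k ->
  gamma_int s k = ((k `^ (- s))%:E * gamma_int s 1)%E.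
Proof.
move=> k0.
have key (j : R) : 0 < j -> gamma_int s j = ((j `^ (- s))%:E *
    \int[leb]_(v in pos) (v `^ (- s - 1) * expR (- v^-1))%:E)%E.
  move=> j0; pose F (v : R) := j^-1 * v^-1; pose f (v : R) := j^-1 * - v ^- 2.
  rewrite /gamma_int (@integral_subst_decr _ F f _ _ _ pos).
  - rewrite -ge0_integralZl_EFin ?powR_ge0//.
    + apply: eq_integral => v; rewrite inE posP => v0; rewrite -EFinM; congr EFin.
      have Fv : F v = expR (- (ln j + ln v)).
        by rewrite /F opprD expRD -!lnV ?posrE// !lnK ?posrE ?invr_gt0.
      have fv : - f v = expR (- ln j + (- ln v - ln v)).
        rewrite /f mulrN opprK !expRD -!lnV ?posrE// !lnK ?posrE ?invr_gt0//.
        by rewrite expr2 invfM.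
      have F0 : 0 < F v by rewrite mulr_gt0 ?invr_gt0.
      have jF : j * F v = v^-1 by rewrite /F mulrA divff ?mul1r ?gt_eqF.
      rewrite jF fv !powR_expR// Fv expRK -!expRD.
      by congr expR; ring.
    + by move=> v _; rewrite lee_fin mulr_ge0 ?powR_ge0 ?expR_ge0.
    + apply/measurable_EFinP; apply: measurable_funM.
        by apply: measurable_funTS; exact: measurable_powR.
      apply: measurableT_comp => //; apply: measurableT_comp => //.
      apply: (@eq_measurable_fun _ _ _ _ _ (fun t : R => t `^ (-1))).
        by move=> x; rewrite inE posP => x0; rewrite powRN powRr1// ltW.
      by apply: measurable_funTS; exact: measurable_powR.
  - move=> v v0; apply: is_derive_mull.
    have h : is_derive v 1 (fun x : R => x^-1) (- v ^- 2 *: 1).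
      by apply: is_deriveV; rewrite gt_eqF.
    by apply: is_derive_eq h _; rewrite /GRing.scale /= mulr1.
  - move=> v v0; apply: cvgM; first exact: cvg_cst.
    apply: cvgN; apply: cvgV; first by rewrite expf_neq0// gt_eqF.
    exact: exprn_continuous.
  - by move=> v v0; rewrite /f mulrN oppr_lt0 mulr_gt0 ?invr_gt0 ?exprn_gt0.
  - apply/seteqP; split => x; rewrite posP.
      by move=> [v]; rewrite posP => v0 <-; rewrite mulr_gt0 ?invr_gt0.
    move=> x0; exists (j * x)^-1; first by rewrite posP invr_gt0 mulr_gt0.
    by rewrite /F invrK mulrA mulVf ?mul1r ?gt_eqF.
  - exact: interval_is_interval.
  - move=> x; rewrite posP => x0.
    apply: cvgM; first exact: continuous_powR.
    apply: (@continuous_comp _ _ _ (fun t : R => - (j * t)) expR).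
      by apply: cvgN; apply: cvgM; [exact: cvg_cst|exact: cvg_id].
    exact: continuous_expR.
  - by move=> x _; rewrite mulr_ge0 ?powR_ge0 ?expR_ge0.
by rewrite !key// powR1 mul1e.
Qed.

End euler_integrals.

Lemma mulf_eq_div (R : realFieldType) (g r b : R) :
  0 < g -> b = g * r -> r = b / g.
Proof. by move=> g0 ->; rewrite mulrAC divff ?mul1r// gt_eqF. Qed.

Section beta_integral.
Variable R : realType.
Notation leb := (@lebesgue_measure R).
Notation pos := (`]0%R, +oo[%classic : set R).
Variables p q : R.
Hypotheses (p0 : 0 < p) (q0 : 0 < q).

(** Euler's beta function B(p, q) in half-line form, related to the usual one by x = v / (1 + v). *)
Definition beta_int : \bar R :=
  (\int[leb]_(v in pos) (v `^ (p - 1) * (1 + v) `^ (- (p + q)))%:E)%E.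

Let mp : measurable (pos : set (measurableTypeR R)).
Proof. exact: measurable_itv. Qed.

(** Extension by zero turns a double integral over the quadrant into one over the plane. *)
Let A : measurableTypeR R -> R :=
  (fun t : R => t `^ (p + q - 1) * expR (- (1 * t))) \_ pos.
Let B : measurableTypeR R -> R := (fun v : R => v `^ (p - 1)) \_ pos.

Let A_ge0 t : 0 <= A t.
Proof. by rewrite /A patchE; case: ifPn => // _; rewrite mulr_ge0 ?powR_ge0 ?expR_ge0. Qed.

Let B_ge0 v : 0 <= B v.
Proof. by rewrite /B patchE; case: ifPn => // _; exact: powR_ge0. Qed.

Let mA : measurable_fun [set: measurableTypeR R] A.
Proof.
have h : measurable_fun (pos : set (measurableTypeR R))
    (fun t : R => t `^ (p + q - 1) * expR (- (1 * t))).
  exact: measurable_gamma_fun.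
exact: ((measurable_restrictT _ mp).1 h).
Qed.

Let mB : measurable_fun [set: measurableTypeR R] B.
Proof.
have h : measurable_fun (pos : set (measurableTypeR R)) (fun v : R => v `^ (p - 1)).
  by apply: measurable_funTS; exact: measurable_powR.
exact: ((measurable_restrictT _ mp).1 h).
Qed.

(** The kernel t^(p+q-1) e^(-t) v^(p-1) e^(-t v) is a gamma integrand of rate [t] in the variable
    [v], and one of rate [1 + v] in the variable [t]. *)
Let inner_v t : (\int[leb]_v (A t * B v * expR (- (t * v)))%:E =
  (A t * (t `^ (- p) * Gamma p))%:E)%E.
Proof.
have [t0|t0] := ltP 0 t; last first.
  have -> : A t = 0.
    by rewrite /A patchE memNset// posP => tp; move: t0; rewrite leNgt tp.
  by rewrite mul0r; apply: integral0_eq => v _; rewrite !mul0r.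
rewrite EFinM [(t `^ _ * _)%:E]EFinM -gamma_intE// -gamma_int_scale//.
rewrite -ge0_integralZl_EFin//; last 2 first.
- by move=> v _; rewrite lee_fin mulr_ge0 ?powR_ge0 ?expR_ge0.
- by apply/measurable_EFinP; exact: measurable_gamma_fun.
rewrite [RHS]integral_mkcond; apply: eq_integral => v _.
rewrite /B !patchE; case: ifPn => _; last by rewrite mulr0 mul0r.
by rewrite -EFinM mulrA.
Qed.

Let inner_t v : (\int[leb]_t (A t * B v * expR (- (t * v)))%:E =
  (B v * ((1 + v) `^ (- (p + q)) * Gamma (p + q)))%:E)%E.
Proof.
have [v0|v0] := ltP 0 v; last first.
  have -> : B v = 0.
    by rewrite /B patchE memNset// posP => vp; move: v0; rewrite leNgt vp.
  by rewrite mul0r; apply: integral0_eq => t _; rewrite mulr0 mul0r.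
have v1 : 0 < 1 + v by rewrite addr_gt0.
rewrite EFinM [(_ `^ (- (p + q)) * _)%:E]EFinM -gamma_intE ?addr_gt0// -gamma_int_scale//.
rewrite -ge0_integralZl_EFin//; last 2 first.
- by move=> t _; rewrite lee_fin mulr_ge0 ?powR_ge0 ?expR_ge0.
- by apply/measurable_EFinP; exact: measurable_gamma_fun.
rewrite [RHS]integral_mkcond; apply: eq_integral => t _.
rewrite /A !patchE; case: ifPn => _; last by rewrite mul0r mul0r.
rewrite -EFinM; congr EFin.
have -> : - ((1 + v) * t) = - (1 * t) + - (t * v) by ring.
by rewrite expRD; ring.
Qed.

Let tonelli : (\int[leb]_t (A t * (t `^ (- p) * Gamma p))%:E =
  \int[leb]_v (B v * ((1 + v) `^ (- (p + q)) * Gamma (p + q)))%:E)%E.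
Proof.
pose f (z : measurableTypeR R * measurableTypeR R) : \bar R :=
  (A z.1 * B z.2 * expR (- (z.1 * z.2)))%:E.
have mf : measurable_fun setT f.
  apply/measurable_EFinP; apply: measurable_funM.
    by apply: measurable_funM; exact: measurableT_comp.
  apply: measurableT_comp => //; apply: measurableT_comp => //.
  exact: measurable_funM.
have f0 z : (0 <= f z)%E.
  by rewrite lee_fin !mulr_ge0 ?A_ge0 ?B_ge0 ?expR_ge0.
transitivity (\int[leb]_t \int[leb]_v f (t, v))%E.
  by apply: eq_integral => t _; rewrite -inner_v.
rewrite (@fubini_tonelli _ _ _ _ R leb leb f mf f0).
by apply: eq_integral => v _; rewrite -inner_t.
Qed.

Lemma beta_gammaE : ((Gamma p * Gamma q)%:E = (Gamma (p + q))%:E * beta_int)%E.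
Proof.
have gp := ltW (Gamma_gt0 p0); have gpq := ltW (Gamma_gt0 (addr_gt0 p0 q0)).
transitivity (\int[leb]_t (A t * (t `^ (- p) * Gamma p))%:E)%E.
  rewrite EFinM -(gamma_intE q0) /gamma_int -ge0_integralZl_EFin; last 4 first.
  - exact: mp.
  - by move=> t _; rewrite lee_fin mulr_ge0 ?powR_ge0 ?expR_ge0.
  - by apply/measurable_EFinP; exact: measurable_gamma_fun.
  - exact: gp.
  rewrite integral_mkcond; apply: eq_integral => t _.
  rewrite /A !patchE; case: ifPn => [|_]; last by rewrite mul0r.
  rewrite inE posP => t0; rewrite -EFinM; congr EFin.
  have -> : t `^ (q - 1) = t `^ (p + q - 1) * t `^ (- p).
    by rewrite !(powR_expR _ t0) -expRD; congr expR; ring.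
  by move: (t `^ (p + q - 1)) (t `^ (- p)) (expR _) (Gamma p) => a b c e; ring.
rewrite tonelli /beta_int -ge0_integralZl_EFin; last 4 first.
- exact: mp.
- by move=> v _; rewrite lee_fin mulr_ge0 ?powR_ge0.
- apply/measurable_EFinP; apply: measurable_funM.
    by apply: measurable_funTS; exact: measurable_powR.
  apply: measurable_funTS.
  apply: (@measurableT_comp _ _ _ _ _ _ (@powR R ^~ (- (p + q)))).
    exact: measurable_powR.
  exact: measurable_funD.
- exact: gpq.
rewrite [RHS]integral_mkcond; apply: eq_integral => v _.
rewrite /B !patchE; case: ifPn => _; last by rewrite mul0r.
rewrite -EFinM; congr EFin.
by move: (v `^ _) (_ `^ (- (p + q))) (Gamma _) => a b c; ring.
Qed.

Lemma beta_intE : beta_int = (Gamma p * Gamma q / Gamma (p + q))%:E.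
Proof.
have gpq := Gamma_gt0 (addr_gt0 p0 q0).
have := beta_gammaE; case: beta_int => [r| |] h.
- by congr EFin; apply: (mulf_eq_div gpq); exact: EFin_inj h.
- by move: h; rewrite gt0_muley; [|rewrite lte_fin; exact: gpq].
- by move: h; rewrite gt0_muleNy; [|rewrite lte_fin; exact: gpq].
Qed.

End beta_integral.

(** * Sums over the growth region *)

Section integral_test.
Variable R : realType.
Notation leb := (@lebesgue_measure R).
Notation pos := (`]0%R, +oo[%classic : set R).
Variable phi : R -> R.
Hypothesis phi_ge0 : forall t, 0 <= phi t.
Hypothesis phi_noninc : forall t u, 0 < t -> t <= u -> phi u <= phi t.
Hypothesis mphi : forall D : set (measurableTypeR R), measurable_fun D phi.

Let unit_itv (a : R) : 0 < a ->
  ((phi (a + 1))%:E <= \int[leb]_(t in `]a, (a + 1)%R]) (phi t)%:E <= (phi a)%:E)%E.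
Proof.
move=> a0.
have vol (r : R) : (\int[leb]_(t in `]a, (a + 1)%R]) (cst r%:E t) = r%:E)%E.
  rewrite integral_cst//= lebesgue_measure_itv/= lte_fin ltrDl ltr01.
  by rewrite -EFinD addrAC subrr add0r mule1.
have vol_ge (r : R) : (r%:E <= \int[leb]_(t in `]a, (a + 1)%R]) (cst r%:E t))%E.
  by rewrite vol.
have vol_le (r : R) : (\int[leb]_(t in `]a, (a + 1)%R]) (cst r%:E t) <= r%:E)%E.
  by rewrite vol.
have mi : measurable (`]a, (a + 1)%R]%classic : set (measurableTypeR R)).
  exact: measurable_itv.
apply/andP; split.
  apply: (le_trans (vol_ge (phi (a + 1)))); apply: ge0_le_integral; first exact: mi.
  - by move=> t _; rewrite lee_fin phi_ge0.
  - exact: measurable_cst.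
  - by apply/measurable_EFinP; exact: mphi.
  - move=> t; rewrite /= in_itv /= => /andP[h1 h2]; rewrite lee_fin phi_noninc//.
    exact: lt_trans h1.
apply: (le_trans _ (vol_le (phi a))); apply: ge0_le_integral; first exact: mi.
- by move=> t _; rewrite lee_fin phi_ge0.
- by apply/measurable_EFinP; exact: mphi.
- exact: measurable_cst.
- by move=> t; rewrite /= in_itv /= => /andP[h1 h2]; rewrite lee_fin phi_noninc// ltW.
Qed.

Variable K : R.
Hypothesis first_le : (\int[leb]_(t in `]0%R, 1%R]) (phi t)%:E <= K%:E)%E.

Let first_itv : ((phi 1)%:E <= \int[leb]_(t in `]0%R, 1%R]) (phi t)%:E)%E.
Proof.
have vol (r : R) : (\int[leb]_(t in `]0%R, 1%R]) (cst r%:E t) = r%:E)%E.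
  by rewrite integral_cst//= lebesgue_measure_itv/= lte_fin ltr01 -EFinB subr0 mule1.
rewrite -(vol (phi 1)); apply: ge0_le_integral.
- exact: measurable_itv.
- by move=> t _; rewrite lee_fin phi_ge0.
- exact: measurable_cst.
- by apply/measurable_EFinP; exact: mphi.
- by move=> t; rewrite /= in_itv /= => /andP[h1 h2]; rewrite lee_fin phi_noninc.
Qed.

Let head n : \bar R := (\int[leb]_(t in `]0%R, n.+1%:R]) (phi t)%:E)%E.

Let headS n : head n.+1 =
  (head n + \int[leb]_(t in `]n.+1%:R, (n.+1%:R + 1)%R]) (phi t)%:E)%E.
Proof.
rewrite /head -ge0_integral_setU; last 5 first.
- exact: measurable_itv.
- exact: measurable_itv.
- by apply/measurable_EFinP; exact: mphi.
- by move=> t _; rewrite lee_fin phi_ge0.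
- apply/disj_set2P; rewrite -subset0 => t [] /=; rewrite !in_itv /= => /andP[_ h1].
  by move=> /andP[h2 _]; move: (le_lt_trans h1 h2); rewrite ltxx.
congr (integral _ _ _); apply/seteqP; split => t /=; rewrite !in_itv /=.
  rewrite natr1 => /andP[t0 t1]; have [h|h] := leP t n.+1%:R; [left|right].
    by rewrite t0.
  by rewrite t1.
case=> /andP[h1 h2].
  by rewrite h1 (le_trans h2)// ler_nat.
by rewrite -[n.+2%:R]natr1 h2 (lt_trans _ h1).
Qed.

Let head_bounds n :
  ((\sum_(k < n.+1) phi k.+1%:R)%:E <= head n <=
   (K + \sum_(k < n) phi k.+1%:R)%:E)%E.
Proof.
elim: n => [|n /andP[IH1 IH2]].
  by rewrite big_ord1 big_ord0 addr0 /head first_itv first_le.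
have n0 : 0 < n.+1%:R :> R by [].
have /andP[h1 h2] := unit_itv n0.
rewrite headS; apply/andP; split.
  rewrite [X in phi X]natr1 in h1.
  by rewrite big_ord_recr /= EFinD; exact: (leeD IH1 h1).
have -> : (K + \sum_(k < n.+1) phi k.+1%:R)%:E =
    ((K + \sum_(k < n) phi k.+1%:R)%:E + (phi n.+1%:R)%:E)%E.
  by rewrite big_ord_recr /= addrA EFinD.
exact: (leeD IH2 h2).
Qed.

Variable N : nat.
Hypothesis phi_tail : forall t, N.+1%:R <= t -> phi t = 0.

Let total : (\int[leb]_(t in pos) (phi t)%:E = head N)%E.
Proof.
rewrite /head integral_mkcond [RHS]integral_mkcond; apply: eq_integral => t _.
rewrite !patchE; case: ifPn => [|tp].
  rewrite inE posP => t0; case: ifPn => // /negP tN; rewrite phi_tail//.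
  rewrite leNgt; apply/negP => tN'; apply: tN; apply/mem_set.
  by rewrite /= in_itv /= t0 ltW.
case: ifPn => //; rewrite inE /= in_itv /= => /andP[t0 _].
by move: tp; rewrite mem_set// posP.
Qed.

(** Since [phi] may blow up at 0, the cell ]0, 1] cannot be bounded by a value of [phi]; its
    integral enters through [K]. The last term of the lower sum, [phi N.+1%:R], vanishes. *)
Lemma integral_test : ((\sum_(n < N) phi n.+1%:R)%:E <=
  \int[leb]_(t in pos) (phi t)%:E <= (K + \sum_(n < N) phi n.+1%:R)%:E)%E.
Proof.
rewrite total; have := head_bounds N.
by rewrite big_ord_recr /= phi_tail// addr0.
Qed.

End integral_test.

Section decay_sums.
Variable R : realType.
Notation leb := (@lebesgue_measure R).
Notation pos := (`]0%R, +oo[%classic : set R).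
Variables (C beta s : R).
Hypotheses (C0 : 0 < C) (beta0 : 0 < beta) (s0 : 0 < s) (bs : s < beta^-1).

Section fixed_delta.
Variable delta : R.
Hypothesis delta0 : 0 < delta.

(** The positive part makes [phi] nonincreasing and zero past the turning point, as [0] to a
    positive power is 0. *)
Let phi (t : R) : R := Num.max (C * t `^ (- beta) - delta) 0 `^ s.

Let phi_ge0 t : 0 <= phi t. Proof. exact: powR_ge0. Qed.

Let le_powRN t u : 0 < t -> t <= u -> u `^ (- beta) <= t `^ (- beta).
Proof.
move=> t0 tu; have u0 : 0 < u by exact: lt_le_trans tu.
by rewrite !powR_expR// ler_expR ler_nM2l ?oppr_lt0// ler_ln ?posrE.
Qed.

Let phi_noninc t u : 0 < t -> t <= u -> phi u <= phi t.
Proof.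
move=> t0 tu.
have m0 (x : R) : 0 <= Num.max x 0 by rewrite le_max lexx orbT.
apply: ge0_ler_powR; [exact: ltW|exact: m0|exact: m0|].
have h : C * u `^ (- beta) - delta <= C * t `^ (- beta) - delta.
  by rewrite lerD2r ler_pM2l// le_powRN.
by rewrite ge_max !le_max lexx h orbT.
Qed.

Let mphi (D : set (measurableTypeR R)) : measurable_fun D phi.
Proof.
apply: measurable_funTS; apply: (@measurableT_comp _ _ _ _ _ _ (@powR R ^~ s)).
  exact: measurable_powR.
apply: measurable_maxr; last exact: measurable_cst.
apply: measurable_funB; last exact: measurable_cst.
apply: measurable_funM; [exact: measurable_cst|exact: measurable_powR].
Qed.

(** On ]0, 1] one has phi(t) <= C^s t^(-beta s) and 1 <= e e^(-t), whence the gamma value;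
    [s < 1/beta] makes its argument positive. It does not depend on delta, so sum and integral
    differ by O(1). *)
Definition first_cell_bound : R := C `^ s * (expR 1 * Gamma (1 - beta * s)).

Let bs1 : 0 < 1 - beta * s.
Proof. by rewrite subr_gt0 -ltr_pdivlMl// mulr1. Qed.

Let first_le :
  (\int[leb]_(t in `]0%R, 1%R]) (phi t)%:E <= first_cell_bound%:E)%E.
Proof.
have h t : 0 < t -> t <= 1 ->
    phi t <= C `^ s * (expR 1 * (t `^ (1 - beta * s - 1) * expR (- (1 * t)))).
  move=> t0 t1.
  have Ct : 0 <= C * t `^ (- beta) by rewrite mulr_ge0 ?powR_ge0// ltW.
  have h : phi t <= (C * t `^ (- beta)) `^ s.
    apply: ge0_ler_powR; [exact: ltW|by rewrite nnegrE le_max lexx orbT|exact: Ct|].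
    by rewrite ge_max Ct andbT ltW// gtrBl.
  apply: le_trans h _; rewrite powRM; [|exact: ltW|exact: powR_ge0].
  apply: ler_wpM2l; first exact: powR_ge0.
  rewrite !(powR_expR _ t0) powR_expR; last exact: expR_gt0.
  rewrite expRK -!expRD ler_expR.
  have -> : s * (- beta * ln t) = (1 - beta * s - 1) * ln t by ring.
  by lra.
have mg : measurable_fun (pos : set (measurableTypeR R))
    (fun t : R => (t `^ (1 - beta * s - 1) * expR (- (1 * t)))%:E).
  by apply/measurable_EFinP; exact: measurable_gamma_fun.
have mp : measurable (pos : set (measurableTypeR R)) by exact: measurable_itv.
rewrite /first_cell_bound (EFinM (C `^ s)) (EFinM (expR 1)) -(gamma_intE bs1) /gamma_int.
rewrite -ge0_integralZl_EFin; last 4 first.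
- exact: mp.
- by move=> v _; rewrite lee_fin mulr_ge0 ?powR_ge0 ?expR_ge0.
- exact: mg.
- exact: expR_ge0.
rewrite -ge0_integralZl_EFin; last 4 first.
- exact: mp.
- move=> v _; rewrite mule_ge0 ?lee_fin ?expR_ge0//.
  by rewrite mulr_ge0 ?powR_ge0 ?expR_ge0.
- by apply: emeasurable_funM; [exact: measurable_cst|exact: mg].
- exact: powR_ge0.
have sub : `]0%R, 1%R]%classic `<=` pos.
  by move=> x; rewrite posP /= in_itv /= => /andP[].
apply: (@le_trans _ _ (\int[leb]_(t in `]0%R, 1%R]) ((C `^ s)%:E *
    ((expR 1)%:E * (t `^ (1 - beta * s - 1) * expR (- (1 * t)))%:E)))%E).
  apply: ge0_le_integral; first exact: measurable_itv.
  - by move=> t _; rewrite lee_fin phi_ge0.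
  - by apply/measurable_EFinP; exact: mphi.
  - apply: (emeasurable_funM (f := cst _)); first exact: measurable_cst.
    apply: (emeasurable_funM (f := cst _)); first exact: measurable_cst.
    by apply/measurable_EFinP; exact: measurable_gamma_fun.
  - move=> t; rewrite /= in_itv /= => /andP[t0 t1]; rewrite -!EFinM lee_fin.
    exact: h.
apply: ge0_subset_integral; [exact: measurable_itv|exact: mp| | |exact: sub].
- apply: (emeasurable_funM (f := cst _)); first exact: measurable_cst.
  by apply: (emeasurable_funM (f := cst _)); [exact: measurable_cst|exact: mg].
- move=> v _; rewrite -!EFinM lee_fin.
  by rewrite mulr_ge0 ?powR_ge0// mulr_ge0 ?expR_ge0// mulr_ge0 ?powR_ge0 ?expR_ge0.
Qed.

Variable N : nat.
Hypothesis before : forall n, (n < N)%N -> delta <= decay C beta n.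
Hypothesis after : decay C beta N < delta.

Let phi_tail t : N.+1%:R <= t -> phi t = 0.
Proof.
move=> tN; rewrite /phi max_r ?powR0 ?gt_eqF//.
rewrite subr_le0 ltW//; apply: le_lt_trans after.
by rewrite /decay ler_pM2l// le_powRN.
Qed.

Let phi_nat n : (n < N)%N -> phi n.+1%:R = (decay C beta n - delta) `^ s.
Proof. by move=> nN; rewrite /phi max_l// subr_ge0 before. Qed.

Lemma decay_sum_integral :
  ((\sum_(n < N) (decay C beta n - delta) `^ s)%:E <=
    \int[leb]_(t in pos) (phi t)%:E <=
   (first_cell_bound + \sum_(n < N) (decay C beta n - delta) `^ s)%:E)%E.
Proof.
have E : \sum_(n < N) (decay C beta n - delta) `^ s = \sum_(n < N) phi n.+1%:R.
  by apply: eq_bigr => i _; rewrite phi_nat.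
rewrite E; exact: (integral_test phi_ge0 phi_noninc mphi first_le phi_tail).
Qed.

(** [m] is the zero of C t^(-beta) - delta. The substitution t = m (1 + v)^(-1/beta) maps the
    half-line onto ]0, m[ and turns C t^(-beta) - delta into delta v. *)
Lemma decay_integralE : (\int[leb]_(t in pos) (phi t)%:E =
  ((C / delta) `^ beta^-1 / beta * delta `^ s)%:E * beta_int (s + 1) (beta^-1 - s))%E.
Proof.
pose m := (C / delta) `^ beta^-1.
have Cd0 : 0 < C / delta by rewrite divr_gt0.
have m0 : 0 < m by exact: powR_gt0.
have mE : C * m `^ (- beta) = delta.
  rewrite /m !(powR_expR _ Cd0) powR_expR ?expR_gt0// expRK.
  have -> : - beta * (beta^-1 * ln (C / delta)) = - ln (C / delta).
    by rewrite mulNr mulrA divff ?gt_eqF// mul1r.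
  by rewrite expRN lnK ?posrE// invf_div mulrC divfK// gt_eqF.
have -> : (\int[leb]_(t in pos) (phi t)%:E = \int[leb]_(t in `]0%R, m[) (phi t)%:E)%E.
  rewrite integral_mkcond [RHS]integral_mkcond; apply: eq_integral => t _.
  rewrite !patchE; case: ifPn => [|tp].
    rewrite inE posP => t0; case: ifPn => // /negP tN.
    rewrite /phi max_r ?powR0 ?gt_eqF// subr_le0 -mE ler_pM2l// le_powRN//.
    rewrite leNgt; apply/negP => tN'; apply: tN; apply/mem_set.
    by rewrite /= in_itv /= t0.
  case: ifPn => //; rewrite inE /= in_itv /= => /andP[t0 _].
  by move: tp; rewrite mem_set// posP.
pose F (v : R) := m * (1 + v) `^ (- beta^-1).
pose f (v : R) := m * (- beta^-1 * (1 + v) `^ (- beta^-1 - 1)).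
have v1 (v : R) : 0 < v -> 0 < 1 + v by move=> v0; rewrite addr_gt0.
rewrite (@integral_subst_decr _ F f _ _ _ `]0%R, m[%classic).
- rewrite /beta_int -ge0_integralZl_EFin//; last 3 first.
  + by move=> v _; rewrite lee_fin mulr_ge0 ?powR_ge0.
  + apply/measurable_EFinP; apply: measurable_funM.
      by apply: measurable_funTS; exact: measurable_powR.
    apply: measurable_funTS.
    apply: (@measurableT_comp _ _ _ _ _ _ (@powR R ^~ _)).
      exact: measurable_powR.
    exact: measurable_funD.
  + by rewrite !mulr_ge0 ?powR_ge0// invr_ge0 ltW.
  apply: eq_integral => v; rewrite inE posP => v0; rewrite -EFinM; congr EFin.
  have CF : C * F v `^ (- beta) - delta = delta * v.
    rewrite /F powRM ?powR_ge0 ?ltW// mulrA mE !(powR_expR _ (v1 v v0)).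
    rewrite powR_expR ?expR_gt0// expRK.
    have -> : - beta * (- beta^-1 * ln (1 + v)) = ln (1 + v).
      by rewrite mulrA mulrNN divff ?gt_eqF// mul1r.
    by rewrite lnK ?posrE ?v1//; ring.
  rewrite /phi CF max_l ?mulr_ge0 ?ltW// powRM ?ltW// /f -/m.
  have -> : s + 1 - 1 = s by ring.
  have -> : - (s + 1 + (beta^-1 - s)) = - beta^-1 - 1 by ring.
  by move: (m) (delta `^ s) (v `^ s) (_ `^ (- beta^-1 - 1)) => k x y z; ring.
- move=> v v0; apply: is_derive_mull.
  have dp := @is_derive1_powR R (- beta^-1) (1 + v) (v1 v v0).
  have du : is_derive v 1 (fun v : R => 1 + v) (0 + 1) by apply: is_deriveD.
  by apply: is_derive_eq (is_derive1_comp dp du) _; rewrite add0r mulr1.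
- move=> v v0; apply: cvgM; first exact: cvg_cst.
  apply: cvgM; first exact: cvg_cst.
  apply: (@continuous_comp _ _ _ (fun v : R => 1 + v) (fun t => t `^ _)).
    by apply: cvgD; [exact: cvg_cst|exact: cvg_id].
  exact: (continuous_powR (v1 v v0)).
- move=> v v0; rewrite /f mulNr mulrN oppr_lt0 !mulr_gt0 ?powR_gt0 ?invr_gt0//.
  exact: v1.
- apply/seteqP; split => x.
    move=> [v]; rewrite posP => v0 <-; rewrite /= in_itv /= mulr_gt0 ?powR_gt0 ?v1//=.
    rewrite gtr_pMr// powR_expR ?v1// -[ltRHS]expR0 ltr_expR mulNr oppr_lt0.
    by rewrite mulr_gt0 ?invr_gt0// ln_gt0// ltrDl.
  rewrite /= in_itv /= => /andP[x0 xm].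
  have xm0 : 0 < x / m by rewrite divr_gt0.
  have h : 1 < (x / m) `^ (- beta).
    rewrite powR_expR// -[ltLHS]expR0 ltr_expR nmulr_rgt0 ?oppr_lt0//.
    by rewrite ln_lt0// xm0 ltr_pdivrMr// mul1r.
  exists ((x / m) `^ (- beta) - 1); first by rewrite /= in_itv /= andbT subr_gt0.
  rewrite /F addrC subrK powR_expR ?powR_gt0// powR_expR// expRK.
  have -> : - beta^-1 * (- beta * ln (x / m)) = ln (x / m).
    by rewrite mulrA mulrNN mulVf ?gt_eqF// mul1r.
  by rewrite lnK ?posrE// mulrC divfK// gt_eqF.
- exact: interval_is_interval.
- move=> x; rewrite /= in_itv /= => /andP[x0 xm].
  have xp : 0 < Num.max (C * x `^ (- beta) - delta) 0.
    rewrite lt_max subr_gt0 -mE ltr_pM2l//.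
    by rewrite !powR_expR// ltr_expR ltr_nM2l ?oppr_lt0// ltr_ln ?posrE// xm.
  apply: (@continuous_comp _ _ _ (fun x : R => Num.max (C * x `^ (- beta) - delta) 0)
    (fun t => t `^ s)).
    apply: continuous_max.
      apply: cvgB; last exact: cvg_cst.
      by apply: cvgM; [exact: cvg_cst|exact: continuous_powR].
    exact: cvg_cst.
  exact: (continuous_powR xp).
- by move=> x _; exact: phi_ge0.
Qed.

End fixed_delta.

Lemma decay_sum_gamma (delta : R) (N : nat) : 0 < delta ->
  (forall n, (n < N)%N -> delta <= decay C beta n) -> decay C beta N < delta ->
  `|\sum_(n < N) (decay C beta n - delta) `^ s -
    beta^-1 * C `^ beta^-1 *
    (Gamma (s + 1) * Gamma (beta^-1 - s) / Gamma (beta^-1 + 1)) *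
    delta `^ (s - beta^-1)| <= first_cell_bound.
Proof.
move=> delta0 before after.
have := decay_sum_integral delta0 before after.
have p0 : 0 < s + 1 by rewrite addr_gt0.
have q0 : 0 < beta^-1 - s by rewrite subr_gt0.
rewrite decay_integralE// beta_intE// -EFinM !lee_fin.
have -> : s + 1 + (beta^-1 - s) = beta^-1 + 1 by ring.
have -> : (C / delta) `^ beta^-1 / beta * delta `^ s =
    beta^-1 * C `^ beta^-1 * delta `^ (s - beta^-1).
  have Cd0 : 0 < C / delta by rewrite divr_gt0.
  rewrite !powR_expR// ln_div ?posrE//.
  rewrite mulrAC -expRD mulrC -mulrA; congr (_ * _).
  by rewrite -expRD; congr expR; ring.
rewrite (mulrAC _ (delta `^ _)).
set S := \sum_(n < N) _; set I := _ * delta `^ _ => /andP[h1 h2].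
by rewrite ler_norml; apply/andP; split; lra.
Qed.

End decay_sums.

(** * Expansion of arcosh with a uniform remainder *)

Section arcosh_expansion.
Variables (R : realType) (c : nat -> R).
Hypothesis hc : arcosh_taylor_coefs c.

(** Geometric comparison with ratio t = z / rho <= 1/2. The partial tails satisfy the invariant
    bound 2 B (t^L - t^(n+L)). *)
Lemma pseries_tail (rho z : R) (L : nat) (B : R) : 0 < rho ->
  (forall i, `|c i * rho ^+ i| <= B) -> 0 <= z <= rho / 2 ->
  cvgn (pseries c z) ->
  `|limn (pseries c z) - \sum_(l < L) c l * z ^+ l| <= 2 * B / rho ^+ L * z ^+ L.
Proof.
move=> rho0 cB /andP[z0 zrho] cz.
have B0 : 0 <= B by exact: le_trans (cB 0%N).
pose t := z / rho.
have t0 : 0 <= t by rewrite divr_ge0// ltW.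
have t1 : t <= 2^-1 by rewrite ler_pdivrMr// mulrC.
have term i : `|c i * z ^+ i| <= B * t ^+ i.
  have -> : c i * z ^+ i = (c i * rho ^+ i) * t ^+ i.
    by rewrite -mulrA -exprMn /t mulrCA divff ?mulr1// gt_eqF.
  by rewrite normrM [X in _ * X]ger0_norm ?exprn_ge0// ler_wpM2r// exprn_ge0.
have tail n : `|pseries c z (n + L)%N - \sum_(l < L) c l * z ^+ l| <=
    2 * B * (t ^+ L - t ^+ (n + L)).
  elim: n => [|n IH].
    by rewrite add0n /pseries /series /= big_mkord !subrr normr0 mulr0.
  rewrite addSn /pseries seriesS -/(pseries c z (n + L)%N) /= -addrA.
  rewrite (le_trans (ler_normD _ _))//.
  apply: le_trans (lerD (term _) IH) _.
  have p0 : 0 <= t ^+ (n + L) by exact: exprn_ge0.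
  have : 2 * (B * (t * t ^+ (n + L))) <= B * t ^+ (n + L).
    have -> : 2 * (B * (t * t ^+ (n + L))) = B * (2 * t * t ^+ (n + L)) by ring.
    by rewrite ler_wpM2l// ler_piMl//; lra.
  by rewrite exprS; lra.
have -> : 2 * B / rho ^+ L * z ^+ L = 2 * B * t ^+ L.
  by rewrite /t expr_div_n; ring.
have cz' : pseries c z (n + L)%N - \sum_(l < L) c l * z ^+ l @[n --> \oo] -->
    limn (pseries c z) - \sum_(l < L) c l * z ^+ l.
  by apply: cvgB; [rewrite (@cvg_shiftn L _ (pseries c z))|exact: cvg_cst].
apply: (cvgn_le (cvg_norm cz')) => n; apply: le_trans (tail n) _.
by rewrite ler_wpM2l ?mulr_ge0// lerBlDr lerDl exprn_ge0.
Qed.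

Lemma sqrtr_exprE (z : R) (l : nat) : 0 <= z ->
  Num.sqrt z * z ^+ l = z `^ (l%:R + 2^-1).
Proof.
rewrite le_eqVlt => /predU1P[<-|z0].
  by rewrite sqrtr0 mul0r powR0// gt_eqF// ltr_pwDr.
rewrite -powR12_sqrt; last exact: ltW.
rewrite -powR_mulrn; last exact: ltW.
by rewrite !(powR_expR _ z0) -expRD; congr expR; ring.
Qed.

Lemma arcosh0 : arcosh (1 + 0 / 2) = 0 :> R.
Proof.
have [a0 h] := arcosh_spec (lexx (0 : R)).
apply/eqP; rewrite eq_le a0 andbT -ler_expR expR0.
apply: ge1_addV_le; rewrite ?invr1//; last by rewrite h; lra.
by rewrite -[leLHS]expR0 ler_expR.
Qed.

(** The series represents arcosh only near 0, whereas the arguments [decay n - delta] range up to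
    [C]. Beyond a fixed [w > 0] all terms are bounded and z^(L + 1/2) is bounded below, so a larger
    constant suffices. *)
Lemma arcosh_expansion (Z : R) (L : nat) : 0 < Z -> exists2 K : R, 0 <= K &
  forall z, 0 <= z <= Z ->
  `|arcosh (1 + z / 2) - \sum_(l < L) c l * z `^ (l%:R + 2^-1)|
    <= K * z `^ (L%:R + 2^-1).
Proof.
(* Convergence at [rho < r] bounds the [c i * rho ^+ i]; the tail estimate then holds up to
   [w = rho / 2]. *)
move=> Z0; have [r r0 hr] := hc; pose rho := r / 2.
have rho0 : 0 < rho by rewrite divr_gt0.
have rhor : 0 < rho < r by rewrite rho0 /rho; lra.
have [crho _] := hr _ rhor.
have [B cB] : exists B, forall i, `|c i * rho ^+ i| <= B.
  have c0 := cvg_series_cvg_0 crho.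
  have : bounded_fun (fun i => c i * rho ^+ i).
    by apply: cvg_seq_bounded; apply/cvg_ex; exists 0.
  move=> [B [_ HB]]; exists (B + 1) => i; apply: HB => //.
  by rewrite ltrDl.
have B0 : 0 <= B by exact: le_trans (cB 0%N).
pose w := rho / 2.
have w0 : 0 < w by rewrite divr_gt0.
pose K1 := 2 * B / rho ^+ L.
have K10 : 0 <= K1.
  by apply: divr_ge0; [exact: mulr_ge0|apply: exprn_ge0; exact: ltW].
pose S := arcosh (1 + Z / 2) + \sum_(l < L) `|c l| * Z `^ (l%:R + 2^-1).
have aZ := arcosh_ge0 (ltW Z0).
have S0 : 0 <= S.
  by rewrite addr_ge0// sumr_ge0// => i _; rewrite mulr_ge0 ?powR_ge0.
pose wL := w `^ (L%:R + 2^-1).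
have wL0 : 0 < wL by exact: powR_gt0.
have ex0 l : 0 <= l%:R + 2^-1 :> R by rewrite addr_ge0.
exists (K1 + S / wL); first by rewrite addr_ge0// divr_ge0// ltW.
move=> z /andP[z0 zZ].
have zL0 := powR_ge0 z (L%:R + 2^-1).
have [zw|wz] := leP z w.
  apply: (@le_trans _ _ (K1 * z `^ (L%:R + 2^-1))); last first.
    by rewrite ler_wpM2r// lerDl divr_ge0// ltW.
  move: z0; rewrite le_eqVlt => /predU1P[<-|z0].
    rewrite arcosh0 big1 ?subrr ?normr0; first by rewrite mulr_ge0 ?powR_ge0.
    move=> i _.
    by rewrite powR0 ?mulr0// gt_eqF// ltr_pwDr.
  have zr : 0 < z < r by rewrite z0; rewrite /w /rho in zw; lra.
  have [cz ->] := hr _ zr.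
  have z1 : 0 <= z <= rho / 2 by rewrite (ltW z0).
  have := pseries_tail L rho0 cB z1 cz.
  move=> /(ler_wpM2l (sqrtr_ge0 z)); rewrite -{1}[Num.sqrt z]ger0_norm ?sqrtr_ge0//.
  rewrite -normrM mulrBr mulr_sumr => h.
  rewrite -sqrtr_exprE ?(ltW z0)// mulrCA; apply: le_trans h.
  rewrite le_eqVlt; apply/orP; left; apply/eqP; congr (`|_ - _|).
  by apply: eq_bigr => i _; rewrite mulrCA sqrtr_exprE// ltW.
apply: (@le_trans _ _ S); last first.
  rewrite mulrDl; apply: (@le_trans _ _ (S / wL * z `^ (L%:R + 2^-1))); last first.
    by rewrite lerDr mulr_ge0.
  rewrite -mulrA; apply: ler_peMr => //.
  rewrite mulrC ler_pdivlMr// mul1r; apply: ge0_ler_powR => //.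
  - by rewrite nnegrE ltW.
  - exact: ltW.
apply: le_trans (ler_normB _ _) _; apply: lerD.
  rewrite ger0_norm ?arcosh_ge0//.
  by rewrite -ler_expR le_arcosh.
apply: le_trans (ler_norm_sum _ _ _) _; apply: ler_sum => i _.
rewrite normrM ler_wpM2l// ger0_norm ?powR_ge0//.
by apply: ge0_ler_powR => //; rewrite nnegrE ltW.
Qed.

(** Half-argument formula: for a = 2 t the equation e^a + e^(-a) = 2 + e^2 becomes 2 sinh t = e, and
    [expR_ge1Dx] at t and -t controls a - e. *)
Lemma arcosh_sqr_approx (e : R) : 0 < e <= 2^-1 ->
  `|arcosh (1 + e ^+ 2 / 2) - e| <= 2 * e ^+ 2.
Proof.
move=> /andP[e0 e1]; have [a0 h] := arcosh_spec (sqr_ge0 e).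
set a := arcosh _ in a0 h *; pose t := a / 2.
have t0 : 0 <= t by rewrite divr_ge0.
have at2 : a = t + t by rewrite /t; field.
have g0 : 0 < expR t by exact: expR_gt0.
have gV : expR t * (expR t)^-1 = 1 by rewrite divff// gt_eqF.
have gE : expR t - (expR t)^-1 = e.
  have g1 : 1 <= expR t by rewrite -[leLHS]expR0 ler_expR.
  have gV1 : (expR t)^-1 <= 1 by rewrite invf_le1.
  apply/eqP; rewrite -(@eqrXn2 _ 2)//; [|lra|exact: ltW].
  apply/eqP; move: h; rewrite at2 expRD invfM.
  by move: gV; move: (expR t) (_^-1) => x y xy; rewrite !expr2; lra.
have l1 := expR_ge1Dx t; have l2 := expR_ge1Dx (- t).
rewrite expRN in l2.
have te : t <= e.
  suff : (expR t)^-1 <= 1 by lra.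
  by rewrite invf_le1//; lra.
have u1 : (expR t)^-1 * (1 + t) <= 1.
  by rewrite mulrC ler_pdivrMr// mul1r.
have u2 : expR t * (1 - t) <= 1.
  by rewrite -ler_pdivlMl// mulr1.
move: gE u1 u2 l1 l2; move: (expR t) (_^-1) => x y gE u1 u2 l1 l2.
have tt : t * t <= e * e by rewrite ler_pM.
have xt : 0 <= (x - 1 - t) by lra.
have t12 : t <= 2^-1 by lra.
have tt0 : 0 <= t * t by rewrite mulr_ge0.
rewrite at2 ler_norml expr2; apply/andP; split.
  have : x <= 1 + t + 2 * (t * t) by nra.
  lra.
have : y <= 1 - t + t * t by nra.
lra.
Qed.

(** The leading term of the second asymptotics is written without c_0. At z = e^2 the one-term
    expansion and [arcosh_sqr_approx] differ by at most a multiple of e^2; divide by e and let e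
    tend to 0. *)
Lemma coef0_eq1 : c 0%N = 1.
Proof.
have [K K0 HK] := arcosh_expansion 1 ltr01.
have key (e : R) : 0 < e <= 2^-1 -> `|1 - c 0%N| <= (2 + K) * e.
  move=> e01; have /andP[e0 e1] := e01.
  have z1 : 0 <= e ^+ 2 <= 1.
    by rewrite sqr_ge0 expr_le1//; lra.
  have := HK _ z1; rewrite big_ord1.
  rewrite -!sqrtr_exprE ?sqr_ge0// sqrtr_sqr (gtr0_norm e0) [in X in _ - X]expr0 mulr1 expr1.
  have := arcosh_sqr_approx e01; set a := arcosh _ => h1 h2.
  rewrite -(ler_pM2l e0) -[X in X * _](gtr0_norm e0) -normrM mulrBr mulr1.
  have -> : e - e * c 0%N = (a - c 0%N * e) - (a - e) by ring.
  rewrite (le_trans (ler_normB _ _))// (le_trans (lerD h2 h1))//.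
  have : 0 <= K * (e ^+ 2) * (1 - e).
    by rewrite !mulr_ge0 ?sqr_ge0//; lra.
  by rewrite !expr2; lra.
apply/eqP; rewrite eq_sym -subr_eq0 -normr_eq0 eq_le normr_ge0 andbT leNgt.
apply/negP => d0; set d := `|_| in d0 key.
have K2 : 0 < 2 + K by rewrite ltr_pwDl.
pose e := Num.min 2^-1 (d / (2 * (2 + K))).
have e0 : 0 < e by rewrite lt_min invr_gt0 ltr0n/= divr_gt0// mulr_gt0.
have e12 : e <= 2^-1 by rewrite ge_min lexx.
have ed : e <= d / (2 * (2 + K)) by rewrite ge_min lexx orbT.
have := key e; rewrite e0 e12 => /(_ isT) h.
have : (2 + K) * e <= d / 2.
  rewrite -(ler_pM2l K2) in ed; apply: le_trans ed _.
  have E (k x : R) : k != 0 -> k * (x / (2 * k)) = x / 2 by move=> ?; field.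
  by rewrite E ?gt_eqF.
by lra.
Qed.

End arcosh_expansion.

(** * Asymptotics of the weight *)

(** Makes the index set of the asymptotic sum an initial segment, possibly empty. *)
Lemma ex_nat_cutoff (R : realType) (a : R) :
  exists L : nat, forall l : nat, (l < L)%N = (l%:R < a).
Proof.
have exP : exists n : nat, a <= n%:R.
  by exists (Num.bound `|a|); apply: le_trans (ler_norm a) (ltW (archi_boundP _)).
case: (ex_minnP exP) => L aL minL; exists L => l.
rewrite ltNge; apply/idP/negP => [lL /minL|/negP]; first by rewrite leqNgt lL.
by rewrite -ltNge; apply: contraTT; rewrite -leqNgt -leNgt => Ll;
  apply: le_trans aL _; rewrite ler_nat.
Qed.

Section log_weight.
Variables (R : realType) (C beta : R) (C0 : 0 < C) (beta0 : 0 < beta).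
Variable c : nat -> R.
Hypothesis hc : arcosh_taylor_coefs c.

Local Notation decay := (decay C beta).

Definition weight_coef (l : nat) : R :=
  c l * (Gamma (l%:R + 3 / 2) * Gamma (beta^-1 - 2^-1 - l%:R)
         / Gamma (beta^-1 + 1)).

Lemma turning_index delta : 0 < delta ->
  exists2 N, (forall n, (n < N)%N -> delta <= decay n) & decay N < delta.
Proof.
move=> d0; have exP : exists n, decay n < delta.
  have /cvgrPdist_lt/(_ delta d0)[n _ hn] := decay_cvg C beta0.
  exists n; have := hn n (leqnn n); rewrite /= sub0r normrN.
  exact: le_lt_trans (ler_norm _).
case: (ex_minnP exP) => N aN minN; exists N => // n nN.
by rewrite leNgt; apply/negP => /minN; rewrite leqNgt nN.
Qed.

Lemma decay_powR_le (p : R) n : 1 <= beta * p ->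
  decay n `^ p <= C `^ p * n.+1%:R^-1.
Proof.
move=> bp; have -> : decay n = C * n.+1%:R `^ (- beta) by [].
rewrite powRM ?powR_ge0 ?(ltW C0)// -powRrM.
rewrite ler_pM2l ?powR_gt0//.
rewrite !powR_expR// -[leRHS]lnK ?posrE ?invr_gt0// lnV ?posrE// ler_expR.
by rewrite !mulNr lerN2 ler_peMl// ln_ge0// ler1n.
Qed.

Lemma decay_sum_weight_coef l delta N : l%:R < beta^-1 - 2^-1 -> 0 < delta ->
  (forall n, (n < N)%N -> delta <= decay n) -> decay N < delta ->
  `|c l * \sum_(n < N) (decay n - delta) `^ (l%:R + 2^-1) -
    beta^-1 * C `^ beta^-1 * (weight_coef l * delta `^ (- beta^-1 + l%:R + 2^-1))|
  <= `|c l| * first_cell_bound C beta (l%:R + 2^-1).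
Proof.
move=> lb d0 before after.
have s0 : 0 < l%:R + 2^-1 :> R by rewrite ltr_wpDl.
have sb : l%:R + 2^-1 < beta^-1 :> R by rewrite -ltrBrDr.
have := decay_sum_gamma C0 beta0 s0 sb d0 before after.
have -> : l%:R + 2^-1 + 1 = l%:R + 3 / 2 :> R by field.
have -> : beta^-1 - (l%:R + 2^-1) = beta^-1 - 2^-1 - l%:R by ring.
have -> : l%:R + 2^-1 - beta^-1 = - beta^-1 + l%:R + 2^-1 by ring.
move=> /(ler_wpM2l (normr_ge0 (c l))); rewrite -normrM mulrBr; congr (`|_ - _| <= _).
rewrite /weight_coef; move: (Gamma _) (Gamma _) (Gamma _) (delta `^ _) => x y z t.
by rewrite !mulrA; congr (_ * _); ring.
Qed.

(** Two comparisons through the double sum [B]: the remainders of the expansion add up to a harmonic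
    sum, and each of the [L] retained power sums is within a constant of its gamma expression. *)
Lemma arcosh_sum_asymptotics (L : nat) :
  (forall l : nat, (l < L)%N = (l%:R < beta^-1 - 2^-1)) ->
  exists2 K : R, 0 <= K & forall delta N, 0 < delta <= 2^-1 ->
  (forall n, (n < N)%N -> delta <= decay n) -> decay N < delta ->
  `|\sum_(n < N) arcosh (1 + (decay n - delta) / 2) -
    beta^-1 * C `^ beta^-1 *
    \sum_(l < L) weight_coef l * delta `^ (- beta^-1 + l%:R + 2^-1)|
  <= K * `|ln delta|.
Proof.
move=> HL; have [KA KA0 HA] := arcosh_expansion hc L C0.
have [KN KN0 HN] := ln_turning_index C0 beta0.
pose p : R := L%:R + 2^-1.
have p0 : 0 <= p by rewrite addr_ge0.
(* [L] is the first index not below 1/beta - 1/2, so the first omitted power of the decay is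
   dominated by 1/(n+1). *)
have bp : 1 <= beta * p.
  have : ~~ (L < L)%N by rewrite ltnn.
  by rewrite HL -leNgt mulrC -ler_pdivrMr// div1r lerBlDr.
pose D := \sum_(l < L) `|c l| * first_cell_bound C beta (l%:R + 2^-1).
pose M := KA * C `^ p.
have M0 : 0 <= M by rewrite mulr_ge0 ?powR_ge0.
have l2 : 0 < ln 2 :> R by rewrite ln_gt0 // ltr1n.
exists (M * KN + (M + `|D|) / ln 2).
  apply: addr_ge0; first exact: mulr_ge0.
  by apply: divr_ge0; [exact: addr_ge0|exact: ltW].
move=> delta N d01 before after; have /andP[d0 d1] := d01.
have ld := ln2_le_norm_ln d01.
have lN := HN _ _ d01 before.
set S := \sum_(n < N) arcosh _; set A := \sum_(l < L) _.
pose B := \sum_(l < L) c l * \sum_(n < N) (decay n - delta) `^ (l%:R + 2^-1).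
have SB : `|S - B| <= M * (1 + KN * `|ln delta|).
  have -> : S - B = \sum_(n < N) (arcosh (1 + (decay n - delta) / 2) -
      \sum_(l < L) c l * (decay n - delta) `^ (l%:R + 2^-1)).
    rewrite sumrB /S /B; congr (_ - _); rewrite exchange_big /=.
    by apply: eq_bigr => l _; rewrite mulr_sumr.
  apply: le_trans (ler_norm_sum _ _ _) _.
  apply: (@le_trans _ _ (\sum_(n < N) M * n.+1%:R^-1)).
    apply: ler_sum => n _.
    have z0 : 0 <= decay n - delta by rewrite subr_ge0 before.
    have zC : decay n - delta <= C.
      by apply: le_trans (decay_le_C C0 beta0 n); rewrite lerBlDr lerDl ltW.
    have zz : 0 <= decay n - delta <= C by rewrite z0 zC.
    apply: le_trans (HA _ zz) _; rewrite -[M * _]mulrA ler_wpM2l//.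
    apply: le_trans (decay_powR_le _ bp); apply: ge0_ler_powR => //.
    - by rewrite nnegrE ltW// decay_gt0.
    - by rewrite lerBlDr lerDl ltW.
  rewrite -mulr_sumr ler_wpM2l//; apply: le_trans (harmonic_sum_le R N) _.
  by rewrite lerD2l; apply: le_trans lN; rewrite ler_ln ?posrE// ler_nat.
have BA : `|B - beta^-1 * C `^ beta^-1 * A| <= `|D|.
  apply: le_trans (ler_norm D); rewrite /B /A mulr_sumr -sumrB.
  apply: le_trans (ler_norm_sum _ _ _) _; apply: ler_sum => l _.
  by apply: decay_sum_weight_coef => //; rewrite -HL.
have h : M + `|D| <= (M + `|D|) / ln 2 * `|ln delta|.
  rewrite -mulrA; apply: ler_peMr; first by rewrite addr_ge0.
  by rewrite mulrC ler_pdivlMr// mul1r.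
have := ler_distD B S (beta^-1 * C `^ beta^-1 * A).
have := lerD SB BA; rewrite [(M * KN + _) * _]mulrDl mulrDr mulr1 mulrA.
move: h; lra.
Qed.

(** At x = 2 - delta the square root is that of delta (4 - delta), so the numerator of the weight
    affects only the error term. *)
Lemma ln_semicircle_edge : exists2 K : R, 0 <= K & forall delta : R,
  0 < delta <= 2^-1 -> `|ln (semicircle (2 - delta))| <= K * `|ln delta|.
Proof.
have l2 : 0 < ln 2 :> R by rewrite ln_gt0 // ltr1n.
pose W : R := `|ln (2 * pi)| + ln 4.
have W0 : 0 <= W by rewrite addr_ge0// ln_ge0// ler1n.
exists (1 + W / ln 2); first by rewrite addr_ge0// divr_ge0// ltW.
move=> delta d01; have ld := ln2_le_norm_ln d01; have /andP[d0 d1] := d01.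
rewrite /semicircle.
have -> : 4 - (2 - delta) ^+ 2 = delta * (4 - delta) by ring.
have d4 : 0 < 4 - delta by lra.
rewrite ln_div ?posrE ?sqrtr_gt0 ?mulr_gt0 ?pi_gt0//.
rewrite -powR12_sqrt ?(ltW (mulr_gt0 d0 d4))// ln_powR mulrC [ln (delta * _)]lnM ?posrE//.
have l4 : 0 <= ln (4 - delta) <= ln 4.
  by rewrite ln_ge0 ?ler_ln ?posrE//=; lra.
have h : W <= W / ln 2 * `|ln delta|.
  by rewrite -mulrA; apply: ler_peMr => //; rewrite mulrC ler_pdivlMr// mul1r.
apply: le_trans (ler_normB _ _) _; rewrite [(1 + _) * _]mulrDl mul1r.
suff : `|(ln delta + ln (4 - delta)) / 2| <= `|ln delta| + ln 4.
  by move: h; rewrite /W; lra.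
rewrite normrM (ger0_norm (_ : 0 <= 2^-1)) ?invr_ge0//.
have /andP[l40 l41] := l4.
have := ler_normD (ln delta) (ln (4 - delta)); rewrite (ger0_norm l40).
have := normr_ge0 (ln delta); lra.
Qed.

Lemma log_weight_asymptotics (b : nat -> R) (L : nat) :
  (forall n, b n.+1 = - decay n) -> b n @[n --> \oo] --> 0 ->
  (forall l : nat, (l < L)%N = (l%:R < beta^-1 - 2^-1)) ->
  exists2 K : R, 0 <= K & forall delta, 0 < delta <= 2^-1 ->
  `|- (ln (semicircle (2 - delta) / turan_limit b (2 - delta)) / 2) -
    beta^-1 * C `^ beta^-1 *
    \sum_(l < L) weight_coef l * delta `^ (- beta^-1 + l%:R + 2^-1)|
  <= K * `|ln delta|.
Proof.
move=> bE b_cvg HL.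
have b_inc n : b n.+1 <= b n.+2 by rewrite !bE lerN2 decay_le.
have [K1 K10 H1] := ln_turan_limit C0 beta0.
have [K2 K20 H2] := arcosh_sum_asymptotics HL.
have [K3 K30 H3] := ln_semicircle_edge.
exists (K1 + K2 + K3); first by rewrite !addr_ge0.
move=> delta d01; have /andP[d0 d1] := d01.
have x2 : -2 < 2 - delta < 2 by apply/andP; split; lra.
have [T0 Tcvg] := turan_limitP b_cvg b_inc x2.
have [N before after] := turning_index d0.
have TE : (fun n => 2 - delta - b n.+1) = (fun n => 2 - delta + decay n).
  by apply/funext => n; rewrite bE opprK.
rewrite TE in Tcvg.
have := H1 _ _ _ d01 before after Tcvg; have := H2 _ _ d01 before after.
have := H3 _ d01.
rewrite ln_div ?posrE ?semicircle_gt0//.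
set S := \sum_(n < N) _; set A := _ * \sum_(l < L) _.
set s := ln (semicircle _); set t := ln (turan_limit _ _).
move=> h3 h2 h1; have -> : - ((s - t) / 2) - A = (t / 2 - S) + (S - A) - s / 2.
  by field.
apply: le_trans (ler_normB _ _) _; have := ler_normD (t / 2 - S) (S - A).
rewrite [`|s / 2|]normrM (ger0_norm (_ : 0 <= 2^-1)) ?invr_ge0//.
have := normr_ge0 s; rewrite !mulrDl; lra.
Qed.

End log_weight.

Section leading_term.
Variables (R : realType) (C beta : R) (C0 : 0 < C) (beta0 : 0 < beta).
Variable c : nat -> R.
Hypothesis hc : arcosh_taylor_coefs c.

Lemma le_powR_le1 (d p q : R) : 0 < d <= 1 -> p <= q -> d `^ q <= d `^ p.
Proof.
move=> /andP[d0 d1] pq; rewrite !powR_expR// ler_expR ler_wnM2r//.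
exact: ln_le0.
Qed.

Lemma norm_ln_le_powR (d e : R) : 0 < d <= 1 -> 0 < e ->
  `|ln d| <= e^-1 * d `^ (- e).
Proof.
move=> /andP[d0 d1] e0; rewrite powR_expR// ler_pdivlMl//.
rewrite ler0_norm ?ln_le0// mulrN -mulNr.
by apply: le_trans (expR_ge1Dx _); rewrite lerDr.
Qed.

Definition leading_coef : R :=
  beta^-1 * C `^ beta^-1 *
  (Gamma (3 / 2) * Gamma (beta^-1 - 2^-1) / Gamma (beta^-1 + 1)).

Lemma leading_coef_gt0 : 0 < beta^-1 - 2^-1 -> 0 < leading_coef.
Proof.
move=> b2; rewrite /leading_coef !mulr_gt0 ?invr_gt0 ?powR_gt0 ?Gamma_gt0//.
by rewrite addr_gt0 ?invr_gt0.
Qed.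

(** The terms with l >= 1 have exponents at least 3/2 - 1/beta. For beta < 2/3 this number is
    negative, so the logarithm is O of that power as well. *)
Lemma leading_term_asymptotics (f : R -> R) (K : R) (L : nat) :
  0 <= K -> beta < 2 / 3 ->
  (forall l : nat, (l < L)%N = (l%:R < beta^-1 - 2^-1)) ->
  (forall delta, 0 < delta <= 2^-1 ->
  `|f delta - beta^-1 * C `^ beta^-1 *
    \sum_(l < L) weight_coef beta c l * delta `^ (- beta^-1 + l%:R + 2^-1)|
  <= K * `|ln delta|) ->
  exists2 K' : R, 0 <= K' & forall delta, 0 < delta <= 2^-1 ->
  `|f delta - leading_coef * delta `^ (2^-1 - beta^-1)|
  <= K' * delta `^ (3 / 2 - beta^-1).
Proof.
move=> K0 b23 HL Hf.
have e0 : 0 < beta^-1 - 3 / 2.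
  rewrite subr_gt0 -[3 / 2]invrK ltf_pV2 ?posrE// ?invr_gt0 ?divr_gt0//.
  by rewrite invf_div.
set e := beta^-1 - 3 / 2 in e0.
have L0 : (0 < L)%N by rewrite HL; rewrite /e in e0; lra.
case: L L0 HL Hf => // L _ HL Hf.
set A := beta^-1 * _ in Hf.
have A0 : 0 <= A by rewrite mulr_ge0 ?powR_ge0// invr_ge0 ltW.
pose S := \sum_(l < L) `|weight_coef beta c l.+1|.
have S0 : 0 <= S by exact: sumr_ge0.
exists (K * e^-1 + A * S).
  by apply: addr_ge0; apply: mulr_ge0 => //; rewrite invr_ge0 ltW.
move=> delta d01; have /andP[d0 d1] := d01.
have d01' : 0 < delta <= 1 by apply/andP; split; lra.
have := Hf _ d01; rewrite big_ord_recl /=.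
set T := \sum_(_ < L) _ => h.
have T_le : `|T| <= S * delta `^ (3 / 2 - beta^-1).
  apply: le_trans (ler_norm_sum _ _ _) _; rewrite mulr_suml; apply: ler_sum => l _.
  rewrite normrM ler_wpM2l// ger0_norm ?powR_ge0//; apply: le_powR_le1 => //.
  rewrite /bump /= add1n -natr1.
  by have := ler0n R l; lra.
have ln_le := norm_ln_le_powR d01' e0.
rewrite (_ : - e = 3 / 2 - beta^-1) in ln_le; last by rewrite /e opprB.
have lead : leading_coef * delta `^ (2^-1 - beta^-1) =
    A * (weight_coef beta c 0 * delta `^ (- beta^-1 + 0%:R + 2^-1)).
  rewrite /weight_coef (coef0_eq1 hc) mul1r add0r subr0 addr0.
  by rewrite [2^-1 - _]addrC /leading_coef -/A -[LHS]mulrA.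
rewrite lead.
have -> : f delta - A * (weight_coef beta c 0 * delta `^ (- beta^-1 + 0%:R + 2^-1)) =
  (f delta - A * (weight_coef beta c 0 * delta `^ (- beta^-1 + 0%:R + 2^-1) + T))
  + A * T by ring.
apply: le_trans (ler_normD _ _) _; rewrite mulrDl; apply: lerD.
  by apply: le_trans h _; rewrite -mulrA ler_wpM2l.
by rewrite normrM (ger0_norm A0) -[A * S * _]mulrA ler_wpM2l.
Qed.

End leading_term.

Theorem mainTheorem4 (R : realType) (C beta : R)
    (mu : probability (measurableTypeR R) R) (c : nat -> R)
    (hC : 0 < C) (hbeta : 0 < beta)
    (hmu : spectral_measure (fun _ => 1) (fun n => - C * n%:R `^ (- beta)) mu)
    (hc : arcosh_taylor_coefs c) :
  exists w Q : R -> R,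
    [/\ has_density_on mu `]-2, 2[ w,
        forall x, -2 < x < 2 -> w x = expR (- 2 * Q x),
        (fun x => Q x -
           beta^-1 * C `^ beta^-1 *
           \sum_(l \in [set l : nat | l%:R < beta^-1 - 2^-1])
             c l * (Gamma (l%:R + 3 / 2) * Gamma (beta^-1 - 2^-1 - l%:R)
                    / Gamma (beta^-1 + 1))
             * (2 - x) `^ (- beta^-1 + l%:R + 2^-1))
          =O_ (2^'-) (fun x => `|ln (2 - x)|)
      & beta < 2 / 3 ->
        exists2 h : R -> R,
          h =O_ (2^'-) (fun x => 2 - x)
        & \forall x \near 2^'-,
            Q x = beta^-1 * C `^ beta^-1 *
                  (Gamma (3 / 2) * Gamma (beta^-1 - 2^-1)
                   / Gamma (beta^-1 + 1))
                  * (2 - x) `^ (2^-1 - beta^-1) * (1 + h x)].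
Proof.
pose b := fun n : nat => - C * n%:R `^ (- beta).
have bE n : b n.+1 = - decay C beta n by rewrite /b /decay mulNr.
have b_cvg : b n @[n --> \oo] --> 0.
  have /cvgN := decay_cvg C hbeta; rewrite oppr0 => h; rewrite -cvg_shiftS.
  by apply: cvg_trans h; apply: near_eq_cvg; near=> n; rewrite /= bE.
have b_inc n : b n.+1 <= b n.+2 by rewrite !bE lerN2 decay_le.
have [L HL] := ex_nat_cutoff (beta^-1 - 2^-1).
have [K K0 HK] := log_weight_asymptotics hC hbeta hc bE b_cvg HL.
pose w x := semicircle x / turan_limit b x.
pose Q x := - (ln (w x) / 2).
have w_gt0 x : -2 < x < 2 -> 0 < w x.
  move=> x2; apply: divr_gt0; first exact: semicircle_gt0.
  by have [] := turan_limitP b_cvg b_inc x2.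
have near2 : \forall x \near (2 : R)^'-, 0 < 2 - x <= 2^-1.
  have l : (2 : R) - 2^-1 < 2 by lra.
  by near=> x; apply/andP; split;
    [rewrite subr_gt0; near: x; exact: nbhs_left_lt
    |rewrite lerBlDl -lerBlDr ltW//; near: x; exact: nbhs_left_gt].
exists w, Q; split.
- exact: spectral_density hmu b_cvg b_inc.
- move=> x x2; rewrite /Q.
  have -> : - 2 * - (ln (w x) / 2) = ln (w x) by field.
  by rewrite lnK// posrE w_gt0.
(* [eqO_exP] asks for a positive constant, and [K] may be 0. *)
- apply/eqO_exP; exists (K + 1); first by rewrite ltr_wpDl.
  near=> x.
  have d01 : 0 < 2 - x <= 2^-1 by near: x.
  have IL : [set l : nat | l%:R < beta^-1 - 2^-1] = `I_L.
    by apply/seteqP; split => l /=; rewrite HL.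
  rewrite IL -fsbig_ord normr_id.
  have := HK _ d01; rewrite subKr => h; apply: le_trans (_ : K * _ <= _).
    exact: h.
  by rewrite ler_wpM2r// lerDl.
move=> b23.
have b2 : 0 < beta^-1 - 2^-1.
  by rewrite subr_gt0 ltf_pV2 ?posrE//; lra.
have [K' K'0 HK'] := leading_term_asymptotics (f := fun d => Q (2 - d)) hbeta hc K0 b23 HL HK.
have A0 := leading_coef_gt0 hC hbeta b2.
(* The relative error is defined by division, legitimate because the gamma values make the leading
   coefficient positive. Dividing the bound of order 3/2 - 1/beta by [P] leaves one factor 2 - x. *)
pose P x := leading_coef C beta * (2 - x) `^ (2^-1 - beta^-1).
exists (fun x => Q x / P x - 1).
  apply/eqO_exP; exists (K' / leading_coef C beta + 1).
    by rewrite ltr_wpDl// divr_ge0// ltW.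
  near=> x.
  have d01 : 0 < 2 - x <= 2^-1 by near: x.
  have /andP[d0 _] := d01.
  have P0 : 0 < P x by rewrite mulr_gt0// powR_gt0.
  have -> : Q x / P x - 1 = (Q x - P x) / P x.
    by rewrite mulrBl divff// (gt_eqF P0).
  rewrite normrM normfV (gtr0_norm P0) (gtr0_norm d0) ler_pdivrMr//.
  have := HK' _ d01; rewrite subKr => h; apply: le_trans h _.
  have -> : 3 / 2 - beta^-1 = 1 + (2^-1 - beta^-1) by lra.
  rewrite powRD ?(gt_eqF d0) ?implybT// powRr1 ?(ltW d0)//.
  rewrite /P; have := powR_ge0 (2 - x) (2^-1 - beta^-1).
  move: A0 d0; set A := leading_coef _ _; move: (2 - x) (_ `^ _) => d t A0 d0 t0.
  have -> : (K' / A + 1) * d * (A * t) = K' * (d * t) + A * d * t.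
    by field; rewrite gt_eqF.
  by rewrite lerDl; apply: mulr_ge0 => //; apply: mulr_ge0; exact: ltW.
near=> x.
have d01 : 0 < 2 - x <= 2^-1 by near: x.
have /andP[d0 _] := d01.
have P0 : 0 < P x by rewrite mulr_gt0// powR_gt0.
rewrite -[_ * (2 - x) `^ _]/(P x) addrCA subrr addr0 mulrCA divff ?mulr1//.
by rewrite gt_eqF.
Unshelve. all: by end_near.
Qed.
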